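(* Let $\mathcal D$ be a hyperbolic automorphism of the two-dimensional torus and let $C=\begin{bmatrix} k & l\\ m & n\end{bmatrix}\in GL(2,\mathbb Z)$ be a matrix with nonnegative integer entries such that $\mathcal D$ is represented, in some basis of the lattice $L$, by $C^T$ or by $-C^T$. Then there are exactly $$\left[\frac{k+l+m+n}{2}\right]$$ nonequivalent Berg partitions of $\mathcal D$ with the connectivity matrix $C$ (i.e. exactly this many equivalence classes of Berg partitions of $\mathcal D$ whose connectivity matrix, for a suitable ordering of the two rectangles, is $C$), where $[\cdot]$ denotes the integer part of a real number.
   Context: Hyperbolic toral automorphism: coordinates in $\mathbb R^2$ are chosen so that the stable direction is horizontal and the unstable direction is vertical; thus $L\subset\mathbb R^2$ is a lattice isomorphic to $\mathbb Z^2$, $\mathbb T^2=\mathbb R^2/L$ with projection $\pi:\mathbb R^2\to\mathbb T^2$, and $\mathcal D:\mathbb T^2\to\mathbb T^2$ is induced by $D=\begin{bmatrix}\mu&0\\0&\lambda\end{bmatrix}$ with $D(L)=L$, $|\lambda|>1$, $|\mu|=1/|\lambda|<1$. Then $L$ has no nonzero elements on the coordinate axes. Bi-partition: let $\{e,f\}$ be a basis of $L$ with $e=[v,p]$ in the open first quadrant and $f=[-u,q]$ in the open second quadrant ($u,v,p,q>0$). Let $R_1=[0,u]\times[0,p]$ and $R_2=[-v,0]\times[0,q]$; the translates of $R_1$ and $R_2$ by vectors of $L$ tile the plane. The pair $\{R_1,R_2\}$ (more precisely the pair of its images in $\mathbb T^2$), as well as any pair obtained from it by a common translation, is called a bi-partition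 of $\mathbb T^2$ (associated with the basis $\{e,f\}$). The horizontal spine $J^s\subset\mathbb T^2$ is the union of the projected horizontal sides of the two rectangles, the vertical spine $J^u\subset\mathbb T^2$ is the union of the projected vertical sides. They are segments in $\mathbb T^2$; for the pair above they are the images of $[-v,u]\times\{0\}$ and $\{0\}\times[0,p+q]$. Berg partition of $\mathcal D$: a bi-partition $\{R_1,R_2\}$ with $\mathcal D(J^s)\subset J^s$ and $\mathcal D(J^u)\supset J^u$. Connectivity matrix of a Berg partition (with rectangles ordered as $R_1,R_2$): the $2\times2$ matrix $C=(c_{ij})$ where $c_{ij}$ is the number of translates of $R_j$ by elements of $L$ in $\mathbb R^2$ that are intersected (in their interiors) by the image $D R_i$ of the interior of $R_i$, lifted to the plane. Reordering the rectangles replaces $C$ by $\sigma C\sigma$ with $\sigma=\begin{bmatrix}0&1\\1&0\end{bmatrix}$. Equivalence: the centralizer $Z(\mathcal D)$ is the group of homeomorphisms of $\mathbb T^2$ commuting with $\mathcal D$. Two Berg partitions of $\mathcal D$ are equivalent if there is a mapping in $Z(\mathcal D)$ which takes one partition into the other, without regard to the ordering of the rectangles. *)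

(* Defs.v *)
From HB Require Import structures.
From mathcomp Require Import all_boot all_order all_algebra all_fingroup.
From mathcomp Require Import generic_quotient.
From mathcomp Require Import all_classical all_reals all_analysis.

Set Implicit Arguments.
Unset Strict Implicit.
Unset Printing Implicit Defensive.

Import Order.TTheory GRing.Theory Num.Theory.
Import numFieldNormedType.Exports.

Local Open Scope classical_set_scope.
Local Open Scope ring_scope.
Local Open Scope card_scope.
Local Open Scope quotient_scope.

Section Lattice.
Variable R : realType.
Local Notation plane := (R * R)%type.

Definition lattice_basis (L : set plane) (e f : plane) : Prop :=
  (forall a b : R, a *: e + b *: f = 0 -> a = 0 /\ b = 0) /\
  L = [set z | exists a b : int, z = e *~ a + f *~ b].

Record lattice : Type := Lattice {
  lattice_set :> set plane;
  latticeP : exists e f, lattice_basis lattice_set e f }.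

Lemma lattice0 (L : lattice) : (L : set plane) 0.
Proof.
by case: (latticeP L) => e [f [_ ->]]; exists 0, 0; rewrite !mulr0z addr0.
Qed.

Lemma latticeB (L : lattice) x y :
  (L : set plane) x -> (L : set plane) y -> (L : set plane) (x - y).
Proof.
case: (latticeP L) => e [f [_ ->]] [a [b ->]] [c [d ->]].
by exists (a - c), (b - d); rewrite !mulrzBr opprD addrACA.
Qed.

Lemma latticeN (L : lattice) x : (L : set plane) x -> (L : set plane) (- x).
Proof. by move=> Lx; rewrite -sub0r; exact: latticeB (lattice0 L) Lx. Qed.

Definition lattice_rel (L : lattice) : rel plane :=
  fun x y => `[< (L : set plane) (x - y) >].

Lemma lattice_rel_equiv (L : lattice) : equiv_class_of (lattice_rel L).
Proof.
split=> [x|x y|y x z]; rewrite /lattice_rel.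
- by rewrite subrr; apply/asboolP; exact: lattice0.
- by apply/asboolP/asboolP => /latticeN; rewrite opprB.
- move=> /asboolP Lxy /asboolP Lyz; apply/asboolP.
  by have := latticeB Lxy (latticeN Lyz); rewrite opprK addrA subrK.
Qed.

Canonical lattice_equiv (L : lattice) : equiv_rel plane :=
  EquivRelPack (lattice_rel_equiv L).

End Lattice.

Notation torus L := (quotient_topology {eq_quot (lattice_equiv L)}).

Section Torus.
Variables (R : realType) (L : lattice R).
Local Notation plane := (R * R)%type.

Definition proj (x : plane) : torus L := \pi_(torus L) x.

Lemma projP (x y : plane) : proj x = proj y <-> (L : set plane) (x - y).
Proof.
split=> [/eqmodP /asboolP //|Lxy]; apply/eqmodP; exact/asboolP.
Qed.

Definition diag_map (mu lambda : R) (x : plane) : plane :=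
  (mu * x.1, lambda * x.2).

Definition hyperbolic_automorphism (mu lambda : R) : Prop :=
  [/\ diag_map mu lambda @` L = L, 1 < `|lambda| & `|mu| = `|lambda|^-1].

(* Reads off a representative: this is the induced map only when the lattice
   is invariant, cf. toral_mapE. *)
Definition toral_map (mu lambda : R) (x : torus L) : torus L :=
  proj (diag_map mu lambda (repr x)).

Lemma toral_mapE (mu lambda : R) : hyperbolic_automorphism mu lambda ->
  forall x, toral_map mu lambda (proj x) = proj (diag_map mu lambda x).
Proof.
move=> [DL _ _] x; apply/projP.
have Lx : (L : set plane) (repr (proj x) - x) by apply/projP; exact: reprK.
suff -> : diag_map mu lambda (repr (proj x)) - diag_map mu lambda x =
          diag_map mu lambda (repr (proj x) - x).
  by rewrite -DL; exists (repr (proj x) - x).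
by rewrite /diag_map [LHS]surjective_pairing /= -!mulrBr.
Qed.

(* Matrices act on columns: the j-th column of M lists the coordinates, in the
   basis (e, f), of the image of the j-th basis vector. *)
Definition represented_by (mu lambda : R) (e f : plane) (M : 'M[int]_2) : Prop :=
  diag_map mu lambda e = e *~ M 0 0 + f *~ M 1 0 /\
  diag_map mu lambda f = e *~ M 0 1 + f *~ M 1 1.

(* bp_shift is the common translation of the two standard rectangles. *)
Record bipartition : Type := Bipartition {
  bp_e : plane;
  bp_f : plane;
  bp_shift : plane;
  bp_basis : lattice_basis L bp_e bp_f;
  bp_e_quadrant : 0 < bp_e.1 /\ 0 < bp_e.2;
  bp_f_quadrant : bp_f.1 < 0 /\ 0 < bp_f.2 }.

(* With e = [v, p] and f = [-u, q]: index 0 is the shifted [0, u] x [0, p],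
   index 1 is the shifted [-v, 0] x [0, q]. *)
Definition lower_left (P : bipartition) (i : 'I_2) : plane :=
  bp_shift P + (if i == 0 then 0 else (- (bp_e P).1, 0)).

Definition upper_right (P : bipartition) (i : 'I_2) : plane :=
  bp_shift P + (if i == 0 then (- (bp_f P).1, (bp_e P).2)
                else (0, (bp_f P).2)).

Definition xside (P : bipartition) (i : 'I_2) : set R :=
  `[(lower_left P i).1, (upper_right P i).1].

Definition yside (P : bipartition) (i : 'I_2) : set R :=
  `[(lower_left P i).2, (upper_right P i).2].

Definition rect (P : bipartition) (i : 'I_2) : set plane :=
  xside P i `*` yside P i.

Definition hsides (P : bipartition) (i : 'I_2) : set plane :=
  xside P i `*` [set (lower_left P i).2; (upper_right P i).2].

Definition vsides (P : bipartition) (i : 'I_2) : set plane :=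
  [set (lower_left P i).1; (upper_right P i).1] `*` yside P i.

Definition hspine (P : bipartition) : set (torus L) :=
  \bigcup_i (proj @` hsides P i).

Definition vspine (P : bipartition) : set (torus L) :=
  \bigcup_i (proj @` vsides P i).

(* The unordered pair of images in the torus. *)
Definition pieces (P : bipartition) : set (set (torus L)) :=
  [set proj @` rect P i | i in [set: 'I_2]].

Definition is_berg (mu lambda : R) (P : bipartition) : Prop :=
  toral_map mu lambda @` hspine P `<=` hspine P /\
  vspine P `<=` toral_map mu lambda @` vspine P.

Definition crossed_translates (mu lambda : R) (P : bipartition) (i j : 'I_2) :
    set plane :=
  [set z | (L : set plane) z /\
    diag_map mu lambda @` (rect P i)° `&` [set z + x | x in (rect P j)°]
      !=set0].

(* The permutation s is the chosen ordering of the two rectangles. *)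
Definition connectivity_matrix (mu lambda : R) (P : bipartition) (s : 'S_2)
    (C : 'M[nat]_2) : Prop :=
  forall i j, crossed_translates mu lambda P (s i) (s j) #= `I_(C i j).

Definition berg_partitions (mu lambda : R) (C : 'M[nat]_2) :
    set (set (set (torus L))) :=
  [set pieces P | P in [set P | is_berg mu lambda P /\
     exists s : 'S_2, connectivity_matrix mu lambda P s C]].

Definition homeomorphism (h : torus L -> torus L) : Prop :=
  continuous h /\
  exists g : torus L -> torus L, [/\ continuous g, cancel h g & cancel g h].

Definition centralizer (mu lambda : R) : set (torus L -> torus L) :=
  [set h | homeomorphism h /\
    h \o toral_map mu lambda = toral_map mu lambda \o h].

Definition berg_equiv (mu lambda : R) (A B : set (set (torus L))) : Prop :=
  exists h, centralizer mu lambda h /\ [set h @` X | X in A] = B.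

Definition berg_classes (mu lambda : R) (C : 'M[nat]_2) :
    set (set (set (set (torus L)))) :=
  [set [set B | berg_partitions mu lambda C B /\ berg_equiv mu lambda A B]
     | A in berg_partitions mu lambda C].

End Torus.

Arguments proj {R} L x.
Arguments berg_partitions {R} L mu lambda C.
Arguments centralizer {R} L mu lambda.
Arguments berg_classes {R} L mu lambda C.

Definition mx22 (T : Type) (k l m n : T) : 'M[T]_2 :=
  \matrix_(i, j) if i == 0 then (if j == 0 then k else l)
                 else (if j == 0 then m else n).

(* Main.v *)
From mathcomp Require Import all_boot all_order all_algebra all_fingroup.
From mathcomp Require Import all_classical all_reals all_analysis.
From mathcomp Require Import generic_quotient.
From mathcomp Require Import ring lra zify.
Require Import Defs.
Import Order.TTheory GRing.Theory Num.Theory.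
Import numFieldNormedType.Exports.
Set Implicit Arguments.
Unset Strict Implicit.
Unset Printing Implicit Defensive.
Local Open Scope classical_set_scope.
Local Open Scope ring_scope.
Local Open Scope card_scope.

(** Write e = (v, p) and f = (-u, q) for the basis of a bi-partition, z for its
    translation and H = p + q.  Its horizontal spine is the image of the segment
    z + [-v, u] x 0 and its vertical spine that of z + 0 x [0, H].  Lattice vectors
    off the origin have no zero coordinate, since D or its inverse would shrink
    them to arbitrarily short ones; hence D maps the lifted horizontal spine into
    one translate of itself, and dually for the vertical spine.  This says that
    D z - z is, modulo the lattice, (s, 0), where s is the first coordinate of a
    lattice vector tau = (s, t), the offset, such that s + mu [-v, u] lies in
    [-v, u] and lambda [0, H] contains t + [0, H] (is_bergP).

    The image of a rectangle is a stack of slices of tiles (tile_stack), so the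
    connectivity matrix C is the matrix of D in the basis (e, f), up to the sign of
    lambda (connectivityP).  It determines the basis up to its order and a diagonal
    linear map, and so only the offset remains to be counted.  The rectangle in
    which tau has to lie is narrower than e - f, which makes the sum of the
    coordinates of tau an injective invariant; it takes exactly the S - 1
    consecutive values between those of the bottom and the top corner, S being the
    sum of the entries of C (offset_index_range, offset_index_inj,
    offset_index_surj).

    Homeomorphisms that commute with D are affine (centralizer_affine): they are
    additive, hence linear, along stable and unstable leaves.  An affine map that
    carries one bi-partition to another one with the same basis has linear part 1
    or -1 (pieces_rigid), because the vertical sections of the union of the
    translates of the narrower rectangle have a single length.  The first kind
    preserves the offset, the second one reflects the range of offsets and turns
    the index N in 0, ..., S - 2 into S - 2 - N (equiv_classification).  The pairs
    {N, S - 2 - N} are represented by the N smaller than S / 2. *)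

(** * Lattices and hyperbolic maps *)

Section LatticePoints.
Variable R : realType.
Local Notation plane := (R * R)%type.
Implicit Types (x y w e f : plane) (i j : int).

Lemma plane_eqP x y : x.1 = y.1 -> x.2 = y.2 -> x = y.
Proof. by case: x => ? ?; case: y => ? ? /= -> ->. Qed.

Lemma fst_sub x y : (x - y).1 = x.1 - y.1.
Proof. by []. Qed.

Lemma snd_sub x y : (x - y).2 = x.2 - y.2.
Proof. by []. Qed.

Lemma fst_mulrz x i : (x *~ i).1 = x.1 * i%:~R.
Proof.
have h (n : nat) : (x *+ n).1 = x.1 * n%:R.
  by elim: n => [|n IH]; rewrite ?mulr0n ?mulr0// !mulrS mulrDr mulr1 /= IH.
case: i => n; first exact: h.
by rewrite NegzE !mulrNz mulrN /= -!pmulrn h.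
Qed.

Lemma snd_mulrz x i : (x *~ i).2 = x.2 * i%:~R.
Proof.
have h (n : nat) : (x *+ n).2 = x.2 * n%:R.
  by elim: n => [|n IH]; rewrite ?mulr0n ?mulr0// !mulrS mulrDr mulr1 /= IH.
case: i => n; first exact: h.
by rewrite NegzE !mulrNz mulrN /= -!pmulrn h.
Qed.

Lemma fst_comb e f i j : (e *~ i + f *~ j).1 = e.1 * i%:~R + f.1 * j%:~R.
Proof. by rewrite /= !fst_mulrz. Qed.

Lemma snd_comb e f i j : (e *~ i + f *~ j).2 = e.2 * i%:~R + f.2 * j%:~R.
Proof. by rewrite /= !snd_mulrz. Qed.

Lemma intr_cases i : [\/ 1 <= i%:~R :> R, i = 0 | i%:~R <= -1 :> R].
Proof.
have [h|h|->] := ltgtP i 0; [|constructor 1|by constructor 2].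
  by constructor 3; rewrite -[-1]/((-1)%:~R) ler_int; lia.
by rewrite ler1z.
Qed.

Section Closure.
Variable L : lattice R.

Lemma latticeD x y : (L : set plane) x -> (L : set plane) y ->
  (L : set plane) (x + y).
Proof. by move=> Lx Ly; rewrite -[y]opprK; apply: latticeB => //; exact: latticeN. Qed.

Variables e f : plane.
Hypothesis Lef : lattice_basis L e f.

Lemma lattice_coords w : (L : set plane) w <-> exists i j, w = e *~ i + f *~ j.
Proof. by case: Lef => _ {1}->. Qed.

Lemma basis_fst : (L : set plane) e.
Proof. by apply/lattice_coords; exists 1, 0; rewrite mulr0z addr0. Qed.

Lemma basis_snd : (L : set plane) f.
Proof. by apply/lattice_coords; exists 0, 1; rewrite mulr0z add0r. Qed.

Lemma basis_cross : e.1 * f.2 - e.2 * f.1 != 0.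
Proof.
apply/eqP => h; case: Lef => ind _.
have [f2 e2] : f.2 = 0 /\ - e.2 = 0.
  by apply: ind; apply: plane_eqP; rewrite /= /GRing.scale /=; lra.
have [f1 e1] : f.1 = 0 /\ - e.1 = 0.
  by apply: ind; apply: plane_eqP; rewrite /= /GRing.scale /=; lra.
have [] := ind 1 0; last by move=> /eqP; rewrite oner_eq0.
by apply: plane_eqP; rewrite /= /GRing.scale /=; rewrite ?e1 ?e2 ?f1 ?f2; lra.
Qed.

Lemma basis_coords_inj i j i' j' :
  e *~ i + f *~ j = e *~ i' + f *~ j' -> i = i' /\ j = j'.
Proof.
move=> E; have E1 := congr1 fst E; have E2 := congr1 snd E.
rewrite !fst_comb in E1; rewrite !snd_comb in E2.
have cr := basis_cross.
have hi : (i%:~R - i'%:~R) * (e.1 * f.2 - e.2 * f.1) = 0 :> R.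
  have := congr1 (fun a => a * f.2) E1; have := congr1 (fun a => a * f.1) E2 => /=; lra.
have hj : (j%:~R - j'%:~R) * (e.1 * f.2 - e.2 * f.1) = 0 :> R.
  have := congr1 (fun a => a * e.2) E1; have := congr1 (fun a => a * e.1) E2 => /=; lra.
split; apply/eqP; rewrite -(eqr_int R) -subr_eq0.
  by move/eqP: hi; rewrite mulf_eq0 (negbTE cr) orbF.
by move/eqP: hj; rewrite mulf_eq0 (negbTE cr) orbF.
Qed.

End Closure.

(** A lattice is discrete: by Cramer's rule the integer coordinates of a short
    vector are smaller than one. *)
Lemma lattice_discrete (L : lattice R) : exists2 r : R, 0 < r &
  forall w, (L : set plane) w -> `|w.1| < r -> `|w.2| < r -> w = 0.
Proof.
have [e [f Lef]] := latticeP L.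
have cr := basis_cross Lef.
set d := e.1 * f.2 - e.2 * f.1 in cr.
pose B := 1 + `|e.1| + `|e.2| + `|f.1| + `|f.2|.
have B0 : 0 < B.
  by rewrite /B; have:= normr_ge0 e.1; have:= normr_ge0 e.2;
    have:= normr_ge0 f.1; have:= normr_ge0 f.2; lra.
have d0 : 0 < `|d| by rewrite normr_gt0.
exists (`|d| / (2 * B)); first by rewrite divr_gt0// mulr_gt0.
move=> w /(lattice_coords Lef)[i [j ->]].
rewrite fst_comb snd_comb.
set W1 := (X in `|X| < _ -> _); set W2 := (X in _ -> `|X| < _ -> _) => h1 h2.
have hb (a b : R) : `|a| <= B -> `|b| <= B -> `|W1 * a - W2 * b| < `|d|.
  move=> ha hb; apply: (le_lt_trans (ler_normB _ _)); rewrite !normrM.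
  have : `|W1| * `|a| <= `|W1| * B by rewrite ler_wpM2l.
  have : `|W2| * `|b| <= `|W2| * B by rewrite ler_wpM2l.
  rewrite ltr_pdivlMr ?mulr_gt0// in h1; rewrite ltr_pdivlMr ?mulr_gt0// in h2.
  lra.
have small k : `|k%:~R * d| < `|d| -> k = 0.
  rewrite normrM gtr_pMl// -intr_norm -[1]/(1%:~R) ltr_int => ?; lia.
have -> : i = 0.
  apply: small; rewrite (_ : _ * d = W1 * f.2 - W2 * f.1); last by rewrite /W1 /W2 /d; ring.
  by apply: hb; rewrite /B; have:= normr_ge0 e.1; have:= normr_ge0 e.2;
    have:= normr_ge0 f.1; have:= normr_ge0 f.2; lra.
have -> : j = 0.
  apply: small; rewrite (_ : _ * d = W1 * - e.2 - W2 * - e.1); last by rewrite /W1 /W2 /d; ring.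
  by apply: hb; rewrite normrN /B; have:= normr_ge0 e.1; have:= normr_ge0 e.2;
    have:= normr_ge0 f.1; have:= normr_ge0 f.2; lra.
by rewrite !mulr0z addr0.
Qed.

End LatticePoints.

Section Hyperbolic.
Variables (R : realType) (L : lattice R) (mu lambda : R).
Local Notation plane := (R * R)%type.
Local Notation D := (diag_map mu lambda).
Hypothesis hypD : hyperbolic_automorphism L mu lambda.

Lemma diag_mapD (a b : R) (x y : plane) :
  diag_map a b (x + y) = diag_map a b x + diag_map a b y.
Proof. by apply: plane_eqP; rewrite /= mulrDr. Qed.

Lemma diag_mapB (a b : R) (x y : plane) :
  diag_map a b (x - y) = diag_map a b x - diag_map a b y.
Proof. by apply: plane_eqP; rewrite /= mulrBr. Qed.

Lemma diag_mapMz (a b : R) (x : plane) i :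
  diag_map a b (x *~ i) = diag_map a b x *~ i.
Proof. by apply: plane_eqP; rewrite /= ?fst_mulrz ?snd_mulrz/= ?fst_mulrz ?snd_mulrz/= mulrA. Qed.

Lemma diag_mapK (a b : R) : a != 0 -> b != 0 ->
  cancel (diag_map a b) (diag_map a^-1 b^-1).
Proof. by move=> a0 b0 x; apply: plane_eqP; rewrite /= mulKf. Qed.

Lemma lambda_neq0 : lambda != 0.
Proof. by case: hypD => _ h _; rewrite -normr_gt0; lra. Qed.

Lemma mu_neq0 : mu != 0.
Proof.
case: hypD => _ h hm; rewrite -normr_gt0 hm invr_gt0 normr_gt0; exact: lambda_neq0.
Qed.

Lemma norm_mu_lt1 : `|mu| < 1.
Proof. by case: hypD => _ h ->; rewrite invf_lt1//; lra. Qed.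

Lemma norm_mu_lambda : `|mu| * `|lambda| = 1.
Proof. by case: hypD => _ h ->; rewrite mulVf// normr_eq0; exact: lambda_neq0. Qed.

Lemma lattice_diag x : (L : set plane) x -> (L : set plane) (D x).
Proof. by case: hypD => DL _ _ Lx; rewrite -DL; exists x. Qed.

Lemma lattice_diagV x : (L : set plane) x ->
  (L : set plane) (diag_map mu^-1 lambda^-1 x).
Proof.
case: hypD => DL _ _ Lx; move: Lx; rewrite -{1}DL => -[y Ly <-].
by rewrite diag_mapK// ?mu_neq0 ?lambda_neq0.
Qed.

Lemma contract_to_zero (a b r : R) : `|a| < 1 -> 0 < r ->
  exists n, `|a ^+ n * b| < r.
Proof.
move=> a1 r0.
have : (fun n => a ^+ n * b) @ \oo --> (0 : R).
  rewrite -(mul0r b); apply: cvgMl; exact: cvg_expr.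
move=> /cvgrPdist_lt /(_ r r0) [n _ /(_ n (leqnn _))]; exists n.
by rewrite -normrN -sub0r.
Qed.

(** Iterating the contraction would otherwise produce arbitrarily short
    lattice vectors. *)
Lemma lattice_fst_eq0 w : (L : set plane) w -> w.1 = 0 -> w = 0.
Proof.
move=> Lw w1; have [r r0 disc] := lattice_discrete L.
have Lit n : (L : set plane) (iter n (diag_map mu^-1 lambda^-1) w).
  by elim: n => //= n; exact: lattice_diagV.
have it1 n : (iter n (diag_map mu^-1 lambda^-1) w).1 = 0.
  by elim: n => //= n ->; rewrite mulr0.
have it2 n : (iter n (diag_map mu^-1 lambda^-1) w).2 = lambda^-1 ^+ n * w.2.
  by elim: n => [|n IH]; rewrite ?expr0 ?mul1r//= IH exprS mulrA.
have [n hn] : exists n, `|lambda^-1 ^+ n * w.2| < r.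
  apply: contract_to_zero => //; case: hypD => _ h _.
  by rewrite normfV invf_lt1//; lra.
have := disc _ (Lit n); rewrite it1 normr0 it2 => /(_ r0 hn) /(congr1 snd).
rewrite it2 /= => /eqP; rewrite mulf_eq0 expf_eq0 invr_eq0 (negbTE lambda_neq0) andbF /=.
by move=> /eqP w2; apply: plane_eqP.
Qed.

Lemma lattice_snd_eq0 w : (L : set plane) w -> w.2 = 0 -> w = 0.
Proof.
move=> Lw w2; have [r r0 disc] := lattice_discrete L.
have Lit n : (L : set plane) (iter n D w).
  by elim: n => //= n; exact: lattice_diag.
have it2 n : (iter n D w).2 = 0.
  by elim: n => //= n ->; rewrite mulr0.
have it1 n : (iter n D w).1 = mu ^+ n * w.1.
  by elim: n => [|n IH]; rewrite ?expr0 ?mul1r//= IH exprS mulrA.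
have [n hn] := contract_to_zero w.1 norm_mu_lt1 r0.
have := disc _ (Lit n); rewrite it2 normr0 it1 => /(_ hn r0) /(congr1 fst).
rewrite it1 /= => /eqP; rewrite mulf_eq0 expf_eq0 (negbTE mu_neq0) andbF /=.
by move=> /eqP w1; apply: plane_eqP.
Qed.

Lemma lattice_eq_fst x y : (L : set plane) x -> (L : set plane) y ->
  x.1 = y.1 -> x = y.
Proof.
move=> Lx Ly E; apply/eqP; rewrite -subr_eq0; apply/eqP.
by apply: lattice_fst_eq0; [exact: latticeB | rewrite /= E subrr].
Qed.

Lemma lattice_eq_snd x y : (L : set plane) x -> (L : set plane) y ->
  x.2 = y.2 -> x = y.
Proof.
move=> Lx Ly E; apply/eqP; rewrite -subr_eq0; apply/eqP.
by apply: lattice_snd_eq0; [exact: latticeB | rewrite /= E subrr].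
Qed.

End Hyperbolic.

(** * The tiles of a bi-partition *)

(** Tile 0 is [0, -f.1] x [0, e.2] and tile 1 is [-e.1, 0] x [0, f.2]; the tiles
    based at the upper end of tile i are those based at the basis vector i. *)
Definition tile_left (R : realType) (e f : R * R) (i : 'I_2) : R :=
  if i == 0 then 0 else - e.1.
Definition tile_right (R : realType) (e f : R * R) (i : 'I_2) : R :=
  if i == 0 then - f.1 else 0.
Definition tile_step (R : realType) (e f : R * R) (i : 'I_2) : R * R :=
  if i == 0 then e else f.
Definition tile_height (R : realType) (e f : R * R) (i : 'I_2) : R :=
  (tile_step e f i).2.

Section Tiles.
Variables (R : realType) (L : lattice R) (e f : R * R).
Local Notation plane := (R * R)%type.
Hypotheses (Lef : lattice_basis L e f).
Hypotheses (e1_gt0 : 0 < e.1) (e2_gt0 : 0 < e.2).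
Hypotheses (f1_lt0 : f.1 < 0) (f2_gt0 : 0 < f.2).
Local Notation xl := (tile_left e f).
Local Notation xr := (tile_right e f).
Local Notation ht := (tile_height e f).
Local Notation step := (tile_step e f).

Lemma tile_height_gt0 i : 0 < ht i.
Proof. by rewrite /tile_height /tile_step; case: ifP. Qed.

Lemma tile_left_lt_right i : xl i < xr i.
Proof. by rewrite /tile_left /tile_right; move: e1_gt0 f1_lt0; case: (i == 0); lra. Qed.

(* The signs of the two coordinates of a lattice vector decide in which
   direction it leaves the region at hand. *)
Local Ltac coordinate_cases Lw :=
  move: (e1_gt0) (e2_gt0) (f1_lt0) (f2_gt0) Lw => ? ? ? ? /(lattice_coords Lef)[a [b ->]];
  rewrite ?fst_comb ?snd_comb;
  have [A|->|A] := intr_cases R a; have [B|->|B] := intr_cases R b;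
  rewrite ?mulr0z ?mulr0 ?addr0 ?add0r => *.

(** According to the signs of its two coordinates, a lattice vector is at least as
    high as e + f, at least as far to the right as e, at least as far to the left
    as f, or not above the origin. *)
Lemma spine_gap w : (L : set plane) w -> f.1 < w.1 -> w.1 < e.1 ->
  0 < w.2 -> w.2 < e.2 + f.2 -> False.
Proof. by move=> Lw; coordinate_cases Lw; nra. Qed.

(** The inequalities say that the interiors of tile i and of the translate of tile
    j by w meet: distinct tiles have disjoint interiors. *)
Lemma tile_overlap w i j : (L : set plane) w ->
  w.1 + xl j < xr i -> xl i < w.1 + xr j -> w.2 < ht i -> 0 < w.2 + ht j ->
  w = 0 /\ i = j.
Proof.
move=> Lw; have E (k : 'I_2) : k = 0 \/ k = 1.
  by case: k => [[|[|//]] H]; [left|right]; apply: val_inj.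
rewrite /tile_left /tile_right /tile_height /tile_step.
have [->|->] := E i; have [->|->] := E j => /=; coordinate_cases Lw;
  try (exfalso; nra); by split.
Qed.

(** Horizontal spines do not enter tiles: the inequalities place part of the
    horizontal spine based at w in the interior of tile i. *)
Lemma hspine_outside_tiles w i : (L : set plane) w ->
  w.1 - e.1 < xr i -> xl i < w.1 - f.1 -> 0 < w.2 -> w.2 < ht i -> False.
Proof.
move=> Lw; rewrite /tile_left /tile_right /tile_height /tile_step.
by case: (i == 0); coordinate_cases Lw; nra.
Qed.

(** Vertical spines do not enter tiles: the inequalities place part of the vertical
    spine based at w in the interior of tile i. *)
Lemma vspine_outside_tiles w i : (L : set plane) w ->
  xl i < w.1 -> w.1 < xr i -> - (e.2 + f.2) < w.2 -> w.2 < ht i -> False.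
Proof.
move=> Lw; rewrite /tile_left /tile_right /tile_height /tile_step.
by case: (i == 0); coordinate_cases Lw; nra.
Qed.

End Tiles.

(** * Berg partitions and their offsets *)

Section BergConditions.
Variables (R : realType) (L : lattice R) (mu lambda : R).
Local Notation plane := (R * R)%type.
Local Notation D := (diag_map mu lambda).

Lemma ord2_cases (i : 'I_2) : i = 0 \/ i = 1.
Proof. by case: i => [[|[|//]] H]; [left|right]; apply: val_inj. Qed.

Lemma lower_leftE (P : bipartition L) i :
  lower_left P i = bp_shift P + (tile_left (bp_e P) (bp_f P) i, 0).
Proof. by rewrite /lower_left /tile_left; case: (i == 0). Qed.

Lemma upper_rightE (P : bipartition L) i : upper_right P i =
  bp_shift P + (tile_right (bp_e P) (bp_f P) i, tile_height (bp_e P) (bp_f P) i).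
Proof.
by rewrite /upper_right /tile_right /tile_height /tile_step; case: (i == 0).
Qed.

Lemma xsideE (P : bipartition L) i a : xside P i a <->
  (bp_shift P).1 + tile_left (bp_e P) (bp_f P) i <= a <=
  (bp_shift P).1 + tile_right (bp_e P) (bp_f P) i.
Proof. by rewrite /xside lower_leftE upper_rightE /= in_itv. Qed.

Lemma ysideE (P : bipartition L) i b : yside P i b <->
  (bp_shift P).2 <= b <= (bp_shift P).2 + tile_height (bp_e P) (bp_f P) i.
Proof. by rewrite /yside lower_leftE upper_rightE /= in_itv /= addr0. Qed.

(** The top sides of the two rectangles are, modulo e and f, two pieces of the
    segment formed by the bottom sides. *)
Lemma hspineE (P : bipartition L) X : hspine P X <->
  exists2 x, - (bp_e P).1 <= x <= - (bp_f P).1 & X = proj L (bp_shift P + (x, 0)).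
Proof.
have [e1 e2] := bp_e_quadrant P; have [f1 f2] := bp_f_quadrant P.
set z := bp_shift P; split.
- move=> [i _ [[a b] []]]; rewrite lower_leftE upper_rightE.
  move=> /xsideE ha hb <-; move: ha hb; rewrite /= addr0 -/z => ha hb.
  have [hb0|hb1] := hb.
  + exists (a - z.1); last by apply: (congr1 (proj L)); apply: plane_eqP; rewrite /=; lra.
    by move: ha; rewrite /tile_left /tile_right; case: (i == 0); lra.
  + exists (a - z.1 - (tile_step (bp_e P) (bp_f P) i).1).
      move: ha; rewrite /tile_left /tile_right /tile_step; case: (i == 0); lra.
    apply/projP; set w := (X in lattice_set _ X).
    have -> : w = tile_step (bp_e P) (bp_f P) i.
      by apply: plane_eqP; rewrite /w /= ?hb1 /tile_height; lra.
    rewrite /tile_step; case: (i == 0).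
      exact: basis_fst (bp_basis P).
    exact: basis_snd (bp_basis P).
- move=> [x hx ->].
  have [x0|x0] := leP x 0; [exists 1 | exists 0] => //; exists (z + (x, 0)) => //;
    split; try (by left; rewrite lower_leftE /= addr0); apply/xsideE;
    rewrite /tile_left /tile_right /= -/z; lra.
Qed.

Lemma vspineE (P : bipartition L) X : vspine P X <->
  exists2 y, 0 <= y <= (bp_e P).2 + (bp_f P).2 & X = proj L (bp_shift P + (0, y)).
Proof.
have [e1 e2] := bp_e_quadrant P; have [f1 f2] := bp_f_quadrant P.
set z := bp_shift P; split.
- move=> [i _ [[a b] []]]; rewrite lower_leftE upper_rightE.
  move=> ha /ysideE hb <-; move: ha hb; rewrite /= -/z.
  have Le := basis_fst (bp_basis P); have Lf := basis_snd (bp_basis P).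
  rewrite /tile_left /tile_right /tile_height /tile_step.
  have [->|->] := ord2_cases i => /= -[] /= -> hb.
  + exists (b - z.2); first lra.
    by apply: (congr1 (proj L)); apply: plane_eqP; rewrite /=; lra.
  + exists (b - z.2 + (bp_f P).2); first lra.
    apply/projP; rewrite (_ : _ - _ = - bp_f P); first exact: latticeN.
    by apply: plane_eqP; rewrite /=; lra.
  + exists (b - z.2 + (bp_e P).2); first lra.
    apply/projP; rewrite (_ : _ - _ = - bp_e P); first exact: latticeN.
    by apply: plane_eqP; rewrite /=; lra.
  + exists (b - z.2); first lra.
    by apply: (congr1 (proj L)); apply: plane_eqP; rewrite /=; lra.
- move=> [y hy ->]; have [y0|y0] := leP y (bp_e P).2.
    exists 0 => //; exists (z + (0, y)) => //; split.
      by left; rewrite lower_leftE /tile_left /= addr0.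
    by apply/ysideE; rewrite /tile_height /tile_step /= -/z; lra.
  exists 1 => //; exists (z + (0, y) - bp_e P); last first.
    apply/projP; rewrite (_ : _ - _ = - bp_e P); last by rewrite addrC addKr.
    exact/latticeN/(basis_fst (bp_basis P)).
  split; first by left; rewrite lower_leftE /tile_left /= addr0.
  by apply/ysideE; rewrite /tile_height /tile_step /= -/z; lra.
Qed.

(** By convexity, the inclusion of s + mu [-e.1, -f.1] in [-e.1, -f.1] is a
    condition on the two end points. *)
Definition valid_x (e f : plane) (s : R) : Prop :=
  - e.1 <= s - mu * e.1 <= - f.1 /\ - e.1 <= s - mu * f.1 <= - f.1.

Definition valid_y (e f : plane) (t : R) : Prop :=
  forall y, 0 <= y <= e.2 + f.2 ->
    exists2 y', 0 <= y' <= e.2 + f.2 & t + y = lambda * y'.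

Lemma valid_x_seg (e f : plane) s x : 0 < e.1 -> f.1 < 0 -> valid_x e f s ->
  - e.1 <= x <= - f.1 -> - e.1 <= s + mu * x <= - f.1.
Proof.
rewrite /valid_x => e1 f1 [h1 h2] hx; have [m0|m0] := leP 0 mu; first nra.
nra.
Qed.

(** The coordinates of tau are the horizontal and the vertical offset of the image
    of the spine cross, w the lattice translation between base points. *)
Definition berg_data (P : bipartition L) (w tau : plane) : Prop :=
  [/\ (L : set plane) w, (L : set plane) tau,
      D (bp_shift P) - bp_shift P = w + (tau.1, 0),
      valid_x (bp_e P) (bp_f P) tau.1 & valid_y (bp_e P) (bp_f P) tau.2].

Hypothesis hypD : hyperbolic_automorphism L mu lambda.

(** The image of the horizontal spine lies on a single translate of the spine,
    because two lattice translates of a horizontal line coincide only for the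
    same translation; likewise for the vertical spine.  The two translations
    differ from a common one by the horizontal and vertical offsets of the
    image, which are therefore the two coordinates of one lattice vector. *)
Lemma is_bergP (P : bipartition L) :
  is_berg mu lambda P <-> exists w tau, berg_data P w tau.
Proof.
have [e1 e2] := bp_e_quadrant P; have [f1 f2] := bp_f_quadrant P.
set e := bp_e P in e1 e2 *; set f := bp_f P in f1 f2 *; set z := bp_shift P; split.
- move=> [hs vs].
  have H x : - e.1 <= x <= - f.1 -> exists2 x', - e.1 <= x' <= - f.1 &
      (L : set plane) (D (z + (x, 0)) - (z + (x', 0))).
    move=> hx; have : hspine P (toral_map mu lambda (proj L (z + (x, 0)))).
      by apply: hs; exists (proj L (z + (x, 0))) => //; apply/hspineE; exists x.
    by rewrite toral_mapE// => /hspineE[x' hx' /projP ?]; exists x'.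
  have V y : 0 <= y <= e.2 + f.2 -> exists2 y', 0 <= y' <= e.2 + f.2 &
      (L : set plane) (D (z + (0, y')) - (z + (0, y))).
    move=> hy; have [|_ /vspineE[y' hy' ->]] := vs (proj L (z + (0, y))).
      by apply/vspineE; exists y.
    by rewrite toral_mapE// => /projP ?; exists y'.
  have [|a ha La] := H 0; first lra.
  have [|b hb Lb] := V 0; first lra.
  set wh := (X in lattice_set _ X) in La; set wv := (X in lattice_set _ X) in Lb.
  exists wh, (wv - wh); have Lt := latticeB Lb La.
  have E : wv - wh = (a, lambda * b).
    by apply: plane_eqP; rewrite /wh /wv /=; ring.
  have Hx x : - e.1 <= x <= - f.1 -> - e.1 <= a + mu * x <= - f.1.
    move=> hx; have [x' hx' Lx'] := H x hx.
    have : (D (z + (x, 0)) - (z + (x', 0))) = wh.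
      by apply: (lattice_eq_snd hypD) => //; rewrite /wh /=; ring.
    by move=> /(congr1 fst); rewrite /wh /= => ?; nra.
  split => //.
  + by apply: plane_eqP; rewrite E /wh /=; ring.
  + rewrite E /=; split.
      by have := Hx (- e.1); rewrite mulrN; apply; lra.
    by have := Hx (- f.1); rewrite mulrN; apply; lra.
  + rewrite E /= => y hy; have [y' hy' Ly'] := V y hy; exists y' => //.
    have : (D (z + (0, y')) - (z + (0, y))) = wv.
      by apply: (lattice_eq_fst hypD) => //; rewrite /wv /=; ring.
    by move=> /(congr1 snd); rewrite /wv /= => ?; nra.
- move=> [w [tau [Lw Lt Ez vx vy]]].
  have Ez1 := congr1 fst Ez; have Ez2 := congr1 snd Ez.
  rewrite /= -/z in Ez1 Ez2; split.
  + move=> _ [X /hspineE[x hx ->] <-]; rewrite toral_mapE//; apply/hspineE.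
    exists (tau.1 + mu * x); first exact: valid_x_seg.
    apply/projP; rewrite (_ : _ - _ = w) //; apply: plane_eqP; rewrite /= -/z; nra.
  + move=> _ /vspineE[y hy ->]; have [y' hy' Ey] := vy y hy.
    exists (proj L (z + (0, y'))); first by apply/vspineE; exists y'.
    rewrite toral_mapE//; apply/projP.
    rewrite (_ : _ - _ = w + tau); first exact: latticeD.
    apply: plane_eqP; rewrite /= -/z; nra.
Qed.

End BergConditions.

(** * Connectivity numbers *)

Section Stacks.
Variables (R : realType) (L : lattice R) (e f : R * R).
Local Notation plane := (R * R)%type.
Hypotheses (Lef : lattice_basis L e f).
Hypotheses (e1_gt0 : 0 < e.1) (e2_gt0 : 0 < e.2).
Hypotheses (f1_lt0 : f.1 < 0) (f2_gt0 : 0 < f.2).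
Hypothesis snd_free : forall w : plane, (L : set plane) w -> w.2 = 0 -> w = 0.
Local Notation xl := (tile_left e f).
Local Notation xr := (tile_right e f).
Local Notation ht := (tile_height e f).
Local Notation step := (tile_step e f).

(** The translates of tile j whose interior meets the open box with opposite
    corners (a, y0) and (b, y1). *)
Definition tiles_in_box (a b y0 y1 : R) (j : 'I_2) : set plane :=
  [set w | [/\ (L : set plane) w, w.1 + xl j < b, a < w.1 + xr j,
               w.2 < y1 & y0 < w.2 + ht j]].

Lemma lattice_step j : (L : set plane) (step j).
Proof.
rewrite /tile_step; case: (j == 0); first exact: basis_fst Lef.
exact: basis_snd Lef.
Qed.

(** A vertical strip which rests on a horizontal spine and meets no vertical
    spine is a stack of full-width slices of tiles: it rests on one tile, leaves
    it through its top, which is again on a horizontal spine, and so on.  Each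
    tile of type j moves the base point of the spine by the basis vector j. *)
Lemma tile_stack (delta : R) (n : nat) (z0 z1 : plane) (a b : R) :
  0 < delta -> delta <= e.2 -> delta <= f.2 ->
  (L : set plane) z0 -> (L : set plane) z1 -> a < b ->
  z0.1 - e.1 <= a -> b <= z0.1 - f.1 -> z1.1 - e.1 <= a -> b <= z1.1 - f.1 ->
  z0.2 <= z1.2 -> z1.2 - z0.2 < n%:R * delta ->
  (forall w, (L : set plane) w -> a < w.1 -> w.1 < b ->
     w.2 + (e.2 + f.2) <= z0.2 \/ z1.2 <= w.2) ->
  exists s : 'I_2 -> seq plane,
    [/\ forall j, uniq (s j),
        forall j w, w \in s j <-> tiles_in_box a b z0.2 z1.2 j w &
        z1 = z0 + (e *~ size (s 0) + f *~ size (s 1))].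
Proof.
move=> d0 de df; elim: n z0 => [|n IH] z0 L0 L1 ab a0 b0 a1 b1 z01 hn H.
  by exfalso; rewrite mul0r in hn; lra.
have [zE|zN] := eqVneq z0.2 z1.2.
  have z0E : z0 = z1.
    apply/eqP; rewrite -subr_eq0; apply/eqP; apply: snd_free.
      exact: latticeB.
    by rewrite /= zE subrr.
  exists (fun=> [::]); split => //; last by rewrite !mulr0z !addr0.
  move=> j w; split => // -[Lw h1 h2 h3 h4]; exfalso.
  have := hspine_outside_tiles Lef e1_gt0 e2_gt0 f1_lt0 f2_gt0 (w := z0 - w) (i := j).
  by apply; rewrite /=; [exact: latticeB|lra..].
have {zN}z01 : z0.2 < z1.2 by rewrite lt_neqAle zN.
have [j0 [l0 r0]] : exists j0, z0.1 + xl j0 <= a /\ b <= z0.1 + xr j0.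
  have [za|za] := leP z0.1 a.
    by exists 0; rewrite /tile_left /tile_right /=; lra.
  exists 1; rewrite /tile_left /tile_right /=; split; first lra.
  by rewrite addr0 leNgt; apply/negP => zb; move: (H _ L0 za zb) e2_gt0 f2_gt0; lra.
set z2 := z0 + step j0.
have L2 : (L : set plane) z2 by apply: latticeD => //; exact: lattice_step.
have [a2 b2] : z2.1 - e.1 <= a /\ b <= z2.1 - f.1.
  move: (e1_gt0) (f1_lt0) l0 r0; rewrite /z2 /tile_left /tile_right /tile_step.
  by have [->|->] := ord2_cases j0 => /= *; lra.
have h0 : 0 < ht j0 by exact: tile_height_gt0.
have z2E : z2.2 = z0.2 + ht j0 by [].
have hd : delta <= ht j0 by rewrite /tile_height /tile_step; case: (j0 == 0).
have z21 : z2.2 <= z1.2.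
  rewrite leNgt; apply/negP => h.
  have := hspine_outside_tiles Lef e1_gt0 e2_gt0 f1_lt0 f2_gt0 (w := z1 - z0) (i := j0).
  by apply; rewrite /=; [exact: latticeB|lra..].
have [|w Lw wa wb|s [s_uniq s_mem s_size]] := IH z2 L2 L1 ab a2 b2 a1 b1 z21.
- by move: hn; rewrite -natr1; lra.
- by have [?|?] := H w Lw wa wb; [left; lra|right].
have z0N : z0 \notin s j0.
  by apply/negP => /s_mem [_ _ _ _]; rewrite z2E; lra.
exists (fun j => if j == j0 then z0 :: s j else s j); split.
- by move=> j; case: eqP => [->|_] //=; rewrite z0N s_uniq.
- move=> j w; have hj : 0 < ht j by exact: tile_height_gt0.
  have sub : w \in s j -> tiles_in_box a b z0.2 z1.2 j w.
    by move=> /s_mem[? ? ? ? ?]; split => //; lra.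
  split.
    case: eqP => [jE|_] //; rewrite inE => /orP[/eqP ->|//].
    by rewrite jE; split => //; lra.
  move=> [Lw h1 h2 h3 h4].
  have [h5|h5] := ltP z2.2 (w.2 + ht j).
    have : w \in s j by apply/s_mem; split.
    by case: eqP => // _ ws; rewrite inE ws orbT.
  have [] := tile_overlap Lef e1_gt0 e2_gt0 f1_lt0 f2_gt0 (w := w - z0) (i := j0) (j := j).
  + exact: latticeB.
  + by rewrite /=; lra.
  + by rewrite /=; lra.
  + by rewrite /=; lra.
  + by rewrite /=; lra.
  + by move=> /eqP; rewrite subr_eq0 => /eqP -> ->; rewrite eqxx mem_head.
- rewrite s_size /z2 /tile_step.
  have [->|->] := ord2_cases j0 => /=; rewrite -addrA; congr (_ + _).
    by rewrite -[(size (s 0)).+1]addn1 PoszD mulrzDr mulr1z addrCA addrA.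
  by rewrite -[(size (s 1)).+1]addn1 PoszD mulrzDr mulr1z addrCA [f + _]addrC.
Qed.
End Stacks.

Section Crossings.
Variables (R : realType) (L : lattice R) (mu lambda : R).
Local Notation plane := (R * R)%type.
Local Notation D := (diag_map mu lambda).
Hypothesis hypD : hyperbolic_automorphism L mu lambda.

Lemma interior_prod (T U : topologicalType) (A : set T) (B : set U) x :
  (A `*` B)° x <-> A° x.1 /\ B° x.2.
Proof.
split=> [|[hA hB]]; last by exists (A, B).
case: x => a b [[P Q] /= [hP hQ] sub]; split.
  by apply: filterS hP => u Pu; have [] := sub (u, b) (conj Pu (nbhs_singleton hQ)).
by apply: filterS hQ => u Qu; have [] := sub (a, u) (conj (nbhs_singleton hP) Qu).
Qed.

Lemma rect_interior (P : bipartition L) i x : (rect P i)° x <->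
  (lower_left P i).1 < x.1 < (upper_right P i).1 /\
  (lower_left P i).2 < x.2 < (upper_right P i).2.
Proof.
rewrite interior_prod /xside /yside !interior_itv_bnd /=.
by rewrite !in_itv.
Qed.

Lemma open_intervals_meet (a b c d : R) : a < b -> c < d -> a < d -> c < b ->
  exists x, (a < x /\ x < b) /\ (c < x /\ x < d).
Proof.
move=> ab cd ad cb; have [ac|ca] := leP a c; have [bd|db] := leP b d.
- by exists ((c + b) / 2); lra.
- by exists ((c + d) / 2); lra.
- by exists ((a + b) / 2); lra.
- by exists ((a + d) / 2); lra.
Qed.

(** The open interval (A, B) is the image of (l, r) under multiplication by m. *)
Definition scaled_ends (m l r A B : R) : Prop :=
  [/\ A < B, (0 < m /\ A = m * l /\ B = m * r) \/ (m < 0 /\ A = m * r /\ B = m * l) &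
      forall x, (A < x /\ x < B) <-> exists2 t, l < t /\ t < r & x = m * t].

Lemma scaled_interval (m l r : R) : m != 0 -> l < r ->
  exists A B, scaled_ends m l r A B.
Proof.
move=> m0 lr; have E x : x = m * (x / m) by rewrite mulrCA mulfV ?mulr1.
have [mn|mp|mz] := ltgtP m 0; last by rewrite mz eqxx in m0.
- exists (m * r), (m * l); split; [by nra | by right | move=> x; split].
    by move=> [h1 h2]; exists (x / m) => //; move: h1 h2; rewrite {1 2}(E x); nra.
  by move=> [t [h1 h2] ->]; nra.
- exists (m * l), (m * r); split; [by nra | by left | move=> x; split].
    by move=> [h1 h2]; exists (x / m) => //; move: h1 h2; rewrite {1 2}(E x); nra.
  by move=> [t [h1 h2] ->]; nra.
Qed.

Lemma card_uniq_seq (T : eqType) (s : seq T) (A : set T) : uniq s ->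
  (forall x, x \in s <-> A x) -> A #= `I_(size s).
Proof.
case: s => [_ h|x0 s].
  by rewrite (_ : A = set0) ?II0// -subset0 => x /h.
set s' := x0 :: s => us h.
rewrite (_ : A = nth x0 s' @` `I_(size s')); last first.
  apply/seteqP; split=> x; first by move=> /h /(nthP x0)[i hi <-]; exists i.
  by move=> [i hi <-]; apply/h/mem_nth.
apply: inj_card_eq => i j; rewrite !inE => hi hj E.
by apply/eqP; rewrite -(nth_uniq x0 hi hj us) E.
Qed.

Lemma crossed_translatesE (P : bipartition L) (i j : 'I_2) w tau A B Y0 Y1 :
  berg_data mu lambda P w tau ->
  scaled_ends mu (tile_left (bp_e P) (bp_f P) i) (tile_right (bp_e P) (bp_f P) i) A B ->
  scaled_ends lambda 0 (tile_height (bp_e P) (bp_f P) i) Y0 Y1 ->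
  crossed_translates mu lambda P i j =
    tiles_in_box L (bp_e P) (bp_f P) (w.1 + tau.1 + A) (w.1 + tau.1 + B)
      (w.2 + Y0) (w.2 + Y1) j.
Proof.
move=> [_ _ Ez _ _] [AB _ ABP] [Y01 _ YP].
have [e1 e2] := bp_e_quadrant P; have [f1 f2] := bp_f_quadrant P.
have xlrj := tile_left_lt_right e1 f1 j; have hj := tile_height_gt0 e2 f2 j.
have Ez1 := congr1 fst Ez; have Ez2 := congr1 snd Ez; rewrite /= in Ez1 Ez2.
have inT (q : 'I_2) y : (rect P q)° y <->
    (tile_left (bp_e P) (bp_f P) q < y.1 - (bp_shift P).1 /\
     y.1 - (bp_shift P).1 < tile_right (bp_e P) (bp_f P) q) /\
    (0 < y.2 - (bp_shift P).2 /\ y.2 - (bp_shift P).2 < tile_height (bp_e P) (bp_f P) q).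
  rewrite rect_interior lower_leftE upper_rightE /=; clear; split=> -[H1 H2]; split; lra.
move: xlrj hj inT Ez1 Ez2 ABP YP; rewrite /tiles_in_box.
move: (tile_left _ _) (tile_right _ _) (tile_height _ _) (bp_shift P).
clear e1 e2 f1 f2 Ez => xl xr ht Z xlrj hj inT Ez1 Ez2 ABP YP.
apply/seteqP; split=> x.
  move=> [Lx [_ [[y /inT[hy1 hy2] <-] [y' /inT[h1 h2] /= E]]]].
  have E1 := congr1 fst E; have E2 := congr1 snd E; rewrite /= in E1 E2.
  have [A1 A2] : A < mu * (y.1 - Z.1) /\ mu * (y.1 - Z.1) < B.
    by apply/ABP; exists (y.1 - Z.1).
  have [B1 B2] : Y0 < lambda * (y.2 - Z.2) /\ lambda * (y.2 - Z.2) < Y1.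
    by apply/YP; exists (y.2 - Z.2).
  by clear hy1 hy2; split=> //; lra.
move=> [Lx h1 h2 h3 h4]; split=> //.
have [X [X1 X2]] : exists X, (A < X /\ X < B) /\
    (x.1 + xl j - w.1 - tau.1 < X /\ X < x.1 + xr j - w.1 - tau.1).
  by apply: open_intervals_meet; lra.
have [Y [y1 y2]] : exists Y, (Y0 < Y /\ Y < Y1) /\
    (x.2 - w.2 < Y /\ Y < x.2 + ht j - w.2).
  by apply: open_intervals_meet; lra.
have [t t1 Xt] := (ABP X).1 X1; have [u u1 Yu] := (YP Y).1 y1.
exists (D (Z + (t, u))); split.
  by exists (Z + (t, u)) => //; apply/inT; clear -t1 u1; rewrite /=; lra.
exists (Z + (X + w.1 + tau.1 - x.1, Y + w.2 - x.2)).
  by apply/inT; clear -X2 y2; rewrite /=; lra.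
by apply: plane_eqP; rewrite /=; lra.
Qed.

(** The image of a rectangle of a Berg partition is a stack of slices of tiles:
    its horizontal sides lie on horizontal spines since the image of the
    horizontal spine does, and no vertical spine enters its interior since the
    preimage of the vertical spine lies in the vertical spine.  Counting
    the slices of each type yields the coordinates of the image of a basis vector. *)
Lemma image_stack (e f w1 tau : plane) (i : 'I_2) A B Y0 Y1 : lattice_basis L e f ->
  0 < e.1 -> 0 < e.2 -> f.1 < 0 -> 0 < f.2 ->
  (L : set plane) w1 -> (L : set plane) tau ->
  valid_x mu e f tau.1 -> valid_y lambda e f tau.2 ->
  scaled_ends mu (tile_left e f i) (tile_right e f i) A B ->
  scaled_ends lambda 0 (tile_height e f i) Y0 Y1 ->
  exists s : 'I_2 -> seq plane, [/\ forall j, uniq (s j),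
    forall j w, w \in s j <-> tiles_in_box L e f (w1.1 + tau.1 + A) (w1.1 + tau.1 + B)
      (w1.2 + Y0) (w1.2 + Y1) j w &
    D (tile_step e f i) = (e *~ size (s 0) + f *~ size (s 1)) *~ sgz lambda].
Proof.
move=> Lef e1 e2 f1 f2 Lw1 Ltau vx vy [AB ABE ABP] [Y01 YE YP].
have la0 := lambda_neq0 hypD; have mu0 := mu_neq0 hypD.
pose a := w1.1 + tau.1 + A; pose b := w1.1 + tau.1 + B.
set st := tile_step e f.
have Lst : (L : set plane) (st i) by exact: lattice_step.
have vseg x : - e.1 <= x <= - f.1 -> - e.1 <= tau.1 + mu * x <= - f.1.
  exact: valid_x_seg.
have [r1 r2 r3 r4] : [/\ - e.1 <= tile_left e f i <= - f.1,
    - e.1 <= tile_right e f i <= - f.1,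
    - e.1 <= tile_left e f i - (st i).1 <= - f.1 &
    - e.1 <= tile_right e f i - (st i).1 <= - f.1].
  rewrite /st /tile_left /tile_right /tile_step.
  by have [->|->] := ord2_cases i => /=; move: e1 f1; clear; split; lra.
have {r1 r2 r3 r4}[v1 v2 v3 v4] := And4 (vseg _ r1) (vseg _ r2) (vseg _ r3) (vseg _ r4).
have hH w : (L : set plane) w -> a < w.1 -> w.1 < b ->
    w.2 + (e.2 + f.2) <= w1.2 + Y0 \/ w1.2 + Y1 <= w.2.
  move=> Lw aw wb; have [?|g1] := leP (w.2 + (e.2 + f.2)) (w1.2 + Y0); first by left.
  have [?|g2] := leP (w1.2 + Y1) w.2; [by right|exfalso].
  have [Y [y1 y2]] : exists Y, (Y0 < Y /\ Y < Y1) /\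
      (w.2 - w1.2 < Y /\ Y < w.2 + (e.2 + f.2) - w1.2).
    by clear v1 v2 v3 v4 aw wb; apply: open_intervals_meet => //; lra.
  have [u u1 Yu] := (YP Y).1 y1.
  have [t t1 Xt] : exists2 t, tile_left e f i < t /\ t < tile_right e f i &
      w.1 - w1.1 - tau.1 = mu * t.
    by apply/ABP; rewrite /a /b in aw wb; clear -aw wb; lra.
  have [|y' y'1 yE] := vy (Y + w1.2 - w.2); first by clear -y2; lra.
  have := lattice_diagV hypD (latticeB (latticeB Lw Lw1) Ltau).
  rewrite (_ : diag_map _ _ _ = (t, u - y')); last first.
    apply: plane_eqP; rewrite /=; first by rewrite Xt mulKf.
    by apply: (mulfI la0); rewrite mulVKf//; clear -yE Yu; lra.
  move=> Lt; case: t1 => t1 t2.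
  by apply: (vspine_outside_tiles Lef e1 e2 f1 f2 (i := i) Lt) => //=;
    clear -u1 y'1; lra.
(* The lower and the upper end of the stack; they are exchanged if D reverses the
   vertical direction. *)
pose z0 := if 0 < lambda then w1 else w1 + D (st i).
pose z1 := if 0 < lambda then w1 + D (st i) else w1.
have LD : (L : set plane) (w1 + D (st i)).
  by apply: latticeD => //; apply: (lattice_diag hypD).
have [Lz0 Lz1] : (L : set plane) z0 /\ (L : set plane) z1.
  by rewrite /z0 /z1; case: ifP.
have [z02 z12] : z0.2 = w1.2 + Y0 /\ z1.2 = w1.2 + Y1.
  rewrite /z0 /z1; case: YE => [[l0 [-> ->]]|[l0 [-> ->]]].
    by rewrite l0 /= mulr0 addr0.
  by rewrite (lt_gtF l0) /= mulr0 addr0.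
have [q1 q2 q3 q4] : [/\ z0.1 - e.1 <= a, b <= z0.1 - f.1, z1.1 - e.1 <= a & b <= z1.1 - f.1].
  rewrite /z0 /z1 /a /b; case: ABE => [[_ [-> ->]]|[_ [-> ->]]];
  by case: ifP => _ /=; move: v1 v2 v3 v4; clear; split; lra.
pose delta := Num.min e.2 f.2.
have d0 : 0 < delta by rewrite lt_min e2.
have de : delta <= e.2 by rewrite ge_min lexx.
have df : delta <= f.2 by rewrite ge_min lexx orbT.
have [n hn] : exists n, z1.2 - z0.2 < n%:R * delta.
  exists (Num.bound ((z1.2 - z0.2) / delta)).
  rewrite -ltr_pdivrMr//; apply: archi_boundP; rewrite divr_ge0 ?(ltW d0)//.
  by rewrite z02 z12; move: Y01; clear; lra.
have ab : a < b by rewrite /a /b; move: AB; clear; lra.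
have z01 : z0.2 <= z1.2 by rewrite z02 z12; move: Y01; clear; lra.
rewrite -z02 -z12 in hH *.
have [s [us ms zs]] := tile_stack Lef e1 e2 f1 f2 (lattice_snd_eq0 hypD) d0 de df
  Lz0 Lz1 ab q1 q2 q3 q4 z01 hn hH.
exists s; split=> //; rewrite -/st; move: zs; rewrite /z0 /z1.
case: YE => [[l0 _]|[l0 _]].
  by rewrite l0 gtr0_sgz// mulr1z => /addrI.
rewrite (lt_gtF l0) ltr0_sgz// => zs; rewrite mulrN1z.
by apply/eqP; rewrite -addr_eq0; apply/eqP; apply: (@addrI _ w1); rewrite addrA -zs addr0.
Qed.

Lemma berg_crossings (P : bipartition L) (i : 'I_2) : is_berg mu lambda P ->
  exists c : 'I_2 -> nat,
    (forall j, crossed_translates mu lambda P i j #= `I_(c j)) /\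
    D (tile_step (bp_e P) (bp_f P) i) =
      (bp_e P *~ c 0 + bp_f P *~ c 1) *~ sgz lambda.
Proof.
move=> /(is_bergP hypD)[w [tau bd]]; have [Lw Ltau _ vx vy] := bd.
have [e1 e2] := bp_e_quadrant P; have [f1 f2] := bp_f_quadrant P.
have [A [B AB]] := scaled_interval (mu_neq0 hypD) (tile_left_lt_right e1 f1 i).
have [Y0 [Y1 Y01]] := scaled_interval (lambda_neq0 hypD) (tile_height_gt0 e2 f2 i).
have [s [us ms Ds]] := image_stack (bp_basis P) e1 e2 f1 f2 Lw Ltau vx vy AB Y01.
exists (fun j => size (s j)); split=> // j.
by rewrite (crossed_translatesE j bd AB Y01); exact: card_uniq_seq.
Qed.

End Crossings.

(** * The range of offsets *)

Section Window.
Variables (R : realType) (L : lattice R) (mu lambda : R).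
Local Notation plane := (R * R)%type.
Local Notation D := (diag_map mu lambda).
Hypothesis hypD : hyperbolic_automorphism L mu lambda.
Variables (e f : plane).
Hypotheses (Lef : lattice_basis L e f).
Hypotheses (e1_gt0 : 0 < e.1) (e2_gt0 : 0 < e.2).
Hypotheses (f1_lt0 : f.1 < 0) (f2_gt0 : 0 < f.2).
Variables (k l m n : nat).
Hypotheses (l_gt0 : (0 < l)%N) (m_gt0 : (0 < m)%N).
Hypothesis De : D e = (e *~ k + f *~ l) *~ sgz lambda.
Hypothesis Df : D f = (e *~ m + f *~ n) *~ sgz lambda.

Local Notation ev i j := (e *~ i + f *~ j).

(** A lattice vector whose coordinates have opposite signs is at least as wide as
    e - f; so in a narrower vertical strip heights are ordered like the sums of the
    coordinates. *)
Lemma strip_height_ge0 i j : `|(ev i j).1| < e.1 - f.1 ->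
  0 <= i + j -> 0 <= (ev i j).2.
Proof.
move: (e1_gt0) (e2_gt0) (f1_lt0) (f2_gt0) => ? ? ? ?.
rewrite fst_comb snd_comb ltr_norml => /andP[h1 h2] hij.
have : 0 <= i%:~R + j%:~R :> R by rewrite -intrD ler0z.
by have [A|->|A] := intr_cases R i; have [B|->|B] := intr_cases R j;
   rewrite ?mulr0z ?mulr0 ?addr0 ?add0r => *; nra.
Qed.

Lemma strip_height_lt0 i j : `|(ev i j).1| < e.1 - f.1 ->
  i + j < 0 -> (ev i j).2 < 0.
Proof.
move: (e1_gt0) (e2_gt0) (f1_lt0) (f2_gt0) => ? ? ? ?.
rewrite fst_comb snd_comb ltr_norml => /andP[h1 h2] hij.
have : i%:~R + j%:~R <= -1 :> R by rewrite -intrD -[-1]/((-1)%:~R) ler_int; lia.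
by have [A|->|A] := intr_cases R i; have [B|->|B] := intr_cases R j;
   rewrite ?mulr0z ?mulr0 ?addr0 ?add0r => *; nra.
Qed.


(* The bottom and the top corner of the range of offsets. *)
Local Notation bot_i := (if 0 < lambda then 0 else - (k + m)%:Z : int).
Local Notation bot_j := (if 0 < lambda then 0 else - (l + n)%:Z : int).
Local Notation top_i := (if 0 < lambda then (k + m)%:Z - 1 else - 1 : int).
Local Notation top_j := (if 0 < lambda then (l + n)%:Z - 1 else - 1 : int).

Lemma bot_fst : (ev bot_i bot_j).1 = if 0 < lambda then 0 else mu * (e.1 + f.1).
Proof.
rewrite fst_comb; have [l0|l0] := ltP 0 lambda; first by rewrite !mulr0z; ring.
have {}l0 : lambda < 0 by rewrite lt_neqAle l0 (lambda_neq0 hypD).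
have := congr1 fst De; have := congr1 fst Df.
rewrite ltr0_sgz// !mulrN1z /= !fst_mulrz !mulrNz !PoszD !intrD; lra.
Qed.

Lemma top_fst : (ev top_i top_j).1 =
  if 0 < lambda then (mu - 1) * (e.1 + f.1) else - (e.1 + f.1).
Proof.
rewrite fst_comb; have [l0|l0] := ltP 0 lambda; last by rewrite !mulrNz; ring.
have := congr1 fst De; have := congr1 fst Df.
rewrite gtr0_sgz// !mulr1z /= !fst_mulrz !intrD !mulrNz; lra.
Qed.

Lemma bot_snd : (ev bot_i bot_j).2 = if 0 < lambda then 0 else lambda * (e.2 + f.2).
Proof.
rewrite snd_comb; have [l0|l0] := ltP 0 lambda; first by rewrite !mulr0z; ring.
have {}l0 : lambda < 0 by rewrite lt_neqAle l0 (lambda_neq0 hypD).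
have := congr1 snd De; have := congr1 snd Df.
rewrite ltr0_sgz// !mulrN1z /= !snd_mulrz !mulrNz !PoszD !intrD; lra.
Qed.

Lemma top_snd : (ev top_i top_j).2 =
  if 0 < lambda then (lambda - 1) * (e.2 + f.2) else - (e.2 + f.2).
Proof.
rewrite snd_comb; have [l0|l0] := ltP 0 lambda; last by rewrite !mulrNz; ring.
have := congr1 snd De; have := congr1 snd Df.
rewrite gtr0_sgz// !mulr1z /= !snd_mulrz !intrD !mulrNz; lra.
Qed.

Lemma valid_yP t : valid_y lambda e f t <->
  (ev bot_i bot_j).2 <= t <= (ev top_i top_j).2.
Proof.
have H0 : 0 < e.2 + f.2 by move: e2_gt0 f2_gt0; lra.
rewrite bot_snd top_snd; have [l0|l0] := ltP 0 lambda.
  split=> [v|ht y hy].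
    have [y0 /andP[? ?] E0] := v 0 ltac:(lra).
    have [y1 /andP[? ?] E1] := v (e.2 + f.2) ltac:(lra).
    by apply/andP; split; nra.
  exists ((t + y) / lambda); last by rewrite mulrCA mulfV ?mulr1// gt_eqF.
  by rewrite divr_ge0 ?(ltW l0)//= ?ler_pdivrMr//; lra.
have {}l0 : lambda < 0 by rewrite lt_neqAle l0 (lambda_neq0 hypD).
split=> [v|ht y hy].
  have [y0 /andP[? ?] E0] := v 0 ltac:(lra).
  have [y1 /andP[? ?] E1] := v (e.2 + f.2) ltac:(lra).
  by apply/andP; split; nra.
exists ((t + y) / lambda); last by rewrite mulrCA mulfV ?mulr1// lt_eqF.
rewrite -mulrNN -invrN divr_ge0 ?oppr_ge0 ?(ltW l0)//=; last lra.
rewrite ler_pdivrMr ?oppr_gt0//; lra.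
Qed.

(** The eigenvalues of the matrix are y and - x, so its trace gives y = K + N + x,
    whence x (N + x) <= x y = 1 <= M'.  For x = |mu| this lets the reflected image of
    the horizontal spine fit inside the spine when D reverses the orientation. *)
Lemma reversed_contraction (x y v u p q K M' L' N : R) :
  0 < x -> 0 < y -> x * y = 1 -> 0 < v -> 0 < u -> 0 < p -> 0 < q ->
  0 <= K -> 0 <= N -> 1 <= L' -> 1 <= M' ->
  (N + x) * u = M' * v -> (K + x) * v = L' * u ->
  (y - K) * p = L' * q -> (y - N) * q = M' * p ->
  x * v <= u /\ x * u <= v.
Proof.
move=> x0 y0 xy v0 u0 p0 q0 K0 N0 L1 M1 E1 E2 E3 E4.
have F1 : (N + x) * (K + x) = M' * L'.
  apply: (mulIf (lt0r_neq0 (mulr_gt0 u0 v0))).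
  by rewrite mulrACA E1 E2; ring.
have F2 : (y - K) * (y - N) = M' * L'.
  apply: (mulIf (lt0r_neq0 (mulr_gt0 p0 q0))).
  by rewrite mulrACA E3 E4; ring.
have tr : y = K + N + x.
  have : (y + x) * (y - x - K - N) = 0 by lra.
  by move/eqP; rewrite mulf_eq0 => /orP[/eqP|/eqP]; lra.
have G1 : x * (N + x) <= 1 by rewrite -xy ler_wpM2l//; lra.
have G2 : x * (K + x) <= 1 by rewrite -xy ler_wpM2l//; lra.
split.
  have : M' * (x * v) <= M' * u.
    rewrite mulrCA -E1 mulrA; apply: (le_trans (y := 1 * u)); rewrite ler_wpM2r//; lra.
  by rewrite ler_pM2l//; lra.
have : L' * (x * u) <= L' * v.
  rewrite mulrCA -E2 mulrA; apply: (le_trans (y := 1 * v)); rewrite ler_wpM2r//; lra.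
by rewrite ler_pM2l//; lra.
Qed.

Lemma reversed_spine : mu * lambda < 0 ->
  `|mu| * e.1 <= - f.1 /\ `|mu| * - f.1 <= e.1.
Proof.
move=> ml; have mu0 := mu_neq0 hypD; have la0 := lambda_neq0 hypD.
have De1 := congr1 fst De; have Df1 := congr1 fst Df.
have De2 := congr1 snd De; have Df2 := congr1 snd Df.
have nz (a : nat) : 0 <= a%:~R :> R by rewrite ler0z.
have pz (a : nat) : (0 < a)%N -> 1 <= a%:~R :> R by rewrite ler1z; lia.
have [E1 E2 E3 E4] : [/\ (n%:~R + `|mu|) * - f.1 = m%:~R * e.1,
    (k%:~R + `|mu|) * e.1 = l%:~R * - f.1, (`|lambda| - k%:~R) * e.2 = l%:~R * f.2 &
    (`|lambda| - n%:~R) * f.2 = m%:~R * e.2].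
  move: De1 Df1 De2 Df2; have [l0|l0] := ltP 0 lambda.
    have m0 : mu < 0 by nra.
    rewrite gtr0_sgz// !mulr1z /= !fst_mulrz !snd_mulrz (gtr0_norm l0) (ltr0_norm m0).
    by move=> *; split; lra.
  have {}l0 : lambda < 0 by rewrite lt_neqAle l0 la0.
  have m0 : 0 < mu by nra.
  rewrite ltr0_sgz// !mulrN1z /= !fst_mulrz !snd_mulrz (ltr0_norm l0) (gtr0_norm m0).
  by move=> *; split; lra.
apply: (reversed_contraction _ _ _ _ _ _ _ _ _ _ _ E1 E2 E3 E4);
  rewrite ?normr_gt0 ?oppr_gt0 ?(norm_mu_lambda hypD) ?pz ?nz//.
Qed.

Lemma valid_x_bot : valid_x mu e f (ev bot_i bot_j).1.
Proof.
have m1 := norm_mu_lt1 hypD; have la0 := lambda_neq0 hypD; have mu0 := mu_neq0 hypD.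
have rev := reversed_spine.
rewrite bot_fst /valid_x; move: e1_gt0 f1_lt0 rev => ? ?.
have [l0|l0] := ltP 0 lambda; have [m0|m0] := leP 0 mu; move: m1;
  rewrite ?(ger0_norm m0) ?(ltr0_norm m0) => m1.
- by move=> _; split; nra.
- by move=> rv; have [? ?] := rv ltac:(nra); split; nra.
- have {}l0 : lambda < 0 by rewrite lt_neqAle la0.
  have {}m0 : 0 < mu by rewrite lt_neqAle eq_sym mu0.
  by move=> rv; have [? ?] := rv ltac:(nra); split; nra.
- by move=> _; split; nra.
Qed.

Lemma valid_x_top : valid_x mu e f (ev top_i top_j).1.
Proof.
have m1 := norm_mu_lt1 hypD; have la0 := lambda_neq0 hypD; have mu0 := mu_neq0 hypD.
have rev := reversed_spine.
rewrite top_fst /valid_x; move: e1_gt0 f1_lt0 rev => ? ?.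
have [l0|l0] := ltP 0 lambda; have [m0|m0] := leP 0 mu; move: m1;
  rewrite ?(ger0_norm m0) ?(ltr0_norm m0) => m1.
- by move=> _; split; nra.
- by move=> rv; have [? ?] := rv ltac:(nra); split; nra.
- have {}l0 : lambda < 0 by rewrite lt_neqAle la0.
  have {}m0 : 0 < mu by rewrite lt_neqAle eq_sym mu0.
  by move=> rv; have [? ?] := rv ltac:(nra); split; nra.
- by move=> _; split; nra.
Qed.

(** The range of horizontal offsets has width (1 - |mu|) (e - f).1. *)
Lemma valid_x_dist s s' : valid_x mu e f s -> valid_x mu e f s' ->
  `|s - s'| < e.1 - f.1.
Proof.
have m1 := norm_mu_lt1 hypD; have mu0 := mu_neq0 hypD.
rewrite /valid_x ltr_norml; move: m1 e1_gt0 f1_lt0.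
have [m0|m0] := leP 0 mu; rewrite ?(ger0_norm m0) ?(ltr0_norm m0).
  have {}m0 : 0 < mu by rewrite lt_neqAle eq_sym mu0.
  by move=> ? ? ? [/andP[? ?] /andP[? ?]] [/andP[? ?] /andP[? ?]]; nra.
by move=> ? ? ? [/andP[? ?] /andP[? ?]] [/andP[? ?] /andP[? ?]]; nra.
Qed.

Lemma comb_sub i j i' j' : ev i j - ev i' j' = ev (i - i') (j - j').
Proof. by rewrite !mulrzBr opprD addrACA. Qed.

Definition valid_offset i j :=
  valid_x mu e f (ev i j).1 /\ valid_y lambda e f (ev i j).2.

(** The coordinate sum of the bottom corner of the range of offsets. *)
Definition offset_base (S : nat) : int := if 0 < lambda then 0 else - S%:Z.

(** The bottom and the top corner satisfy the horizontal condition, so they share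
    a narrow strip with every offset, where the coordinate sum orders heights. *)
Lemma offset_index_range i j : valid_offset i j ->
  0 <= i + j - offset_base (k + l + m + n) <= (k + l + m + n)%:Z - 2.
Proof.
move=> [vx /valid_yP /andP[y0 y1]].
have d0 := valid_x_dist vx valid_x_bot.
have d1 := valid_x_dist valid_x_top vx.
have c0 := @strip_height_lt0 (i - bot_i) (j - bot_j).
have c1 := @strip_height_lt0 (top_i - i) (top_j - j).
rewrite -comb_sub fst_sub snd_sub in c0; rewrite -comb_sub fst_sub snd_sub in c1.
apply/andP; split; rewrite leNgt; apply/negP => h.
  have sN : (i - bot_i) + (j - bot_j) < 0.
    by move: h; clear; rewrite /offset_base; case: ifP => _; lia.
  by have := c0 d0 sN; rewrite subr_lt0 ltNge y0.
have sN : (top_i - i) + (top_j - j) < 0.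
  by move: h; clear; rewrite /offset_base; case: ifP => _; lia.
by have := c1 d1 sN; rewrite subr_lt0 ltNge y1.
Qed.

(** Two offsets with the same coordinate sum differ by a multiple of e - f, which
    is wider than the range. *)
Lemma offset_index_inj i j i' j' : valid_offset i j -> valid_offset i' j' ->
  i + j = i' + j' -> i = i' /\ j = j'.
Proof.
move=> [vx _] [vx' _] E; have := valid_x_dist vx vx'.
rewrite -(fst_sub (ev i j)) comb_sub fst_comb.
have -> : j - j' = - (i - i') by move: E; clear; lia.
rewrite mulrNz mulrN -mulNr -mulrDl normrM gtr0_norm; last first.
  by move: e1_gt0 f1_lt0; lra.
rewrite gtr_pMr; last by move: e1_gt0 f1_lt0; lra.
by rewrite -intr_norm -[1]/(1%:~R) ltr_int; move: E; clear; split; lia.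
Qed.

(** A strip as wide as e - f contains a vector of each coordinate sum.  If it starts
    at the left end of the range, the heights are right as well, and only the
    excess of the strip over the range has to be excluded. *)
Lemma offset_index_surj (N : int) : 0 <= N <= (k + l + m + n)%:Z - 2 ->
  exists i j, valid_offset i j /\ i + j = N + offset_base (k + l + m + n).
Proof.
move=> hN; set c := N + offset_base (k + l + m + n).
have la0 := lambda_neq0 hypD; have mu0 := mu_neq0 hypD.
have W0 : 0 < e.1 - f.1 by move: e1_gt0 f1_lt0; lra.
have H0 : 0 < e.2 + f.2 by move: e2_gt0 f2_gt0; lra.
(* The left end of the range of horizontal offsets. *)
pose a := - e.1 + Num.max (mu * e.1) (mu * f.1).
have [i hi] : exists i : int, a <= (ev i (c - i)).1 < a + (e.1 - f.1).
  exists (Num.ceil ((a - f.1 * c%:~R) / (e.1 - f.1))).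
  set i := Num.ceil _; rewrite fst_comb intrB.
  have -> : e.1 * i%:~R + f.1 * (c%:~R - i%:~R) = i%:~R * (e.1 - f.1) + f.1 * c%:~R :> R.
    by ring.
  have /andP[] := ceil_itv ((a - f.1 * c%:~R) / (e.1 - f.1)); rewrite -/i.
  rewrite ltr_pdivlMr// ler_pdivrMr// intrB; lra.
set j := c - i in hi; exists i, j; have ij : i + j = c by rewrite /j addrC subrK.
set w := ev i j in hi.
have dist s : valid_x mu e f s -> `|w.1 - s| < e.1 - f.1.
  rewrite ltr_norml => vs; move: hi vs; rewrite /a /valid_x; move: (norm_mu_lt1 hypD).
  move: (e1_gt0) (f1_lt0).
  have [m0|m0] := leP 0 mu; rewrite ?(ger0_norm m0) ?(ltr0_norm m0).
    rewrite max_l; last nra.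
    have {}m0 : 0 < mu by rewrite lt_neqAle eq_sym mu0.
    by move=> ? ? ? /andP[? ?] [/andP[? ?] /andP[? ?]]; nra.
  rewrite max_r; last nra.
  by move=> ? ? ? /andP[? ?] [/andP[? ?] /andP[? ?]]; nra.
have c0 := @strip_height_ge0 (i - bot_i) (j - bot_j).
have c1 := @strip_height_ge0 (top_i - i) (top_j - j).
rewrite -comb_sub -/w fst_sub snd_sub in c0; rewrite -comb_sub -/w fst_sub snd_sub in c1.
have y0 : (ev bot_i bot_j).2 <= w.2.
  rewrite -subr_ge0; apply: c0; first exact: dist valid_x_bot.
  by move: hN ij; rewrite /c /offset_base; clear; case: ifP => _; lia.
have y1 : w.2 <= (ev top_i top_j).2.
  rewrite -subr_ge0; apply: c1; first by rewrite distrC; exact: dist valid_x_top.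
  by move: hN ij; rewrite /c /offset_base; clear; case: ifP => _; lia.
split=> //; split; last by apply/valid_yP; rewrite y0 y1.
(* Otherwise the preimage of w + f is a lattice vector inside the gap around
   the spine cross. *)
have Lw : (L : set plane) (w + f).
  by apply: latticeD; [apply/(lattice_coords Lef); exists i, j | exact: basis_snd Lef].
have := spine_gap Lef e1_gt0 e2_gt0 f1_lt0 f2_gt0 (lattice_diagV hypD Lw).
rewrite /= => gap.
have hy : 0 < lambda^-1 * (w.2 + f.2) /\ lambda^-1 * (w.2 + f.2) < e.2 + f.2.
  move: y0 y1; rewrite bot_snd top_snd; move: (e2_gt0) (f2_gt0) => ? ?.
  have [l0|l0] := ltP 0 lambda => y0 y1.
    by rewrite mulrC divr_gt0 ?ltr_pdivrMr//; lra.
  have {}l0 : lambda < 0 by rewrite lt_neqAle la0.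
  rewrite mulrC -mulrNN -invrN; split; first by rewrite divr_gt0 ?oppr_gt0//; lra.
  by rewrite ltr_pdivrMr ?oppr_gt0//; lra.
have hx : ~ (f.1 < mu^-1 * (w.1 + f.1) /\ mu^-1 * (w.1 + f.1) < e.1).
  by move=> [h1 h2]; case: hy => h3 h4; exact: gap.
have wE : w.1 + f.1 = mu * (mu^-1 * (w.1 + f.1)) by rewrite mulVKf.
set z := mu^-1 * (w.1 + f.1) in hx wE.
suff : valid_x mu e f w.1 by [].
clearbody w z; move: hi hx wE mu0; rewrite /valid_x /a.
move: (norm_mu_lt1 hypD) (e1_gt0) (f1_lt0); clear c0 c1 y0 y1 gap hy Lw dist hN.
move=> m1 e10 f10 hi hx wE mu0; move: hi hx.
have [m0|m0] := ltP 0 mu.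
  rewrite max_l; last nra.
  move=> /andP[h1 h2] hx; have zf : z <= f.1.
    by rewrite leNgt; apply/negP => h; apply: hx; split=> //; nra.
  have hz : mu * z <= mu * f.1 by rewrite ler_pM2l.
  have me : 0 < mu * e.1 by rewrite mulr_gt0.
  have mf : mu * f.1 < 0 by rewrite pmulr_rlt0.
  by split; lra.
have {}m0 : mu < 0 by rewrite lt_neqAle mu0.
rewrite max_r; last nra.
move=> /andP[h1 h2] hx; have zf : e.1 <= z.
  by rewrite leNgt; apply/negP => h; apply: hx; split=> //; nra.
have hz : mu * z <= mu * e.1 by rewrite ler_nM2l.
have me : mu * e.1 < 0 by rewrite nmulr_rlt0.
have mf : 0 < mu * f.1 by rewrite nmulr_rgt0.
by split; lra.
Qed.

(** The range of offsets is symmetric about its centre, as its bottom and top corner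
    add up to D (e + f) - (e + f). *)
Lemma offset_reflection i j : valid_offset i j -> exists i' j',
  [/\ valid_offset i' j', ev i' j' = D (e + f) - (e + f) - ev i j &
      i' + j' - offset_base (k + l + m + n) =
      (k + l + m + n)%:Z - 2 - (i + j - offset_base (k + l + m + n))].
Proof.
move=> [vx /valid_yP vy].
exists (bot_i + top_i - i), (bot_j + top_j - j).
have C : ev bot_i bot_j + ev top_i top_j = D (e + f) - (e + f).
  apply: plane_eqP.
    rewrite -[LHS]/((ev bot_i bot_j).1 + (ev top_i top_j).1) bot_fst top_fst /=.
    by case: ifP => _; ring.
  rewrite -[LHS]/((ev bot_i bot_j).2 + (ev top_i top_j).2) bot_snd top_snd /=.
  by case: ifP => _; ring.
have E : ev (bot_i + top_i - i) (bot_j + top_j - j) = D (e + f) - (e + f) - ev i j.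
  by rewrite -comb_sub -C !mulrzDr (addrACA (e *~ _)).
split=> //; last by rewrite /offset_base; clear; case: ifP => _; lia.
split; rewrite E; last first.
  by apply/valid_yP; rewrite -C; move: vy => /=; lra.
move: vx; rewrite /valid_x fst_sub.
have -> : (D (e + f) - (e + f)).1 = (mu - 1) * (e.1 + f.1) by rewrite /=; ring.
by move=> [/andP[? ?] /andP[? ?]]; split; lra.
Qed.

End Window.

(** * Vertical sections of unions of rectangles *)

Definition box (R : realType) (c d : R * R) : set (R * R) :=
  [set x | c.1 <= x.1 <= d.1 /\ c.2 <= x.2 <= d.2].

Definition translates (R : realType) (L A : set (R * R)) : set (R * R) :=
  [set x | exists2 w, L w & A (x - w)].

(** A rectangle is stackless when its translates never touch along horizontal
    sides of positive length, so that the vertical sections of the union of its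
    translates consist of single vertical sections of the rectangle. *)
Definition stackless (R : realType) (L : set (R * R)) (c d : R * R) : Prop :=
  [/\ c.1 < d.1, c.2 < d.2 & exists2 r, 0 < r & forall w, L w ->
      `|w.1| < d.1 - c.1 -> 0 < w.2 -> w.2 <= d.2 - c.2 + r -> False].

Section Stackless.
Variables (R : realType) (L : lattice R).
Local Notation plane := (R * R)%type.
Hypothesis snd_free : forall w : plane, (L : set plane) w -> w.2 = 0 -> w = 0.
Implicit Types (c d w : plane).

Lemma snd_inj w w' : (L : set plane) w -> (L : set plane) w' ->
  w.2 = w'.2 -> w = w'.
Proof.
move=> Lw Lw' E; apply/eqP; rewrite -subr_eq0; apply/eqP; apply: snd_free.
  exact: latticeB.
by rewrite /= E subrr.
Qed.

Lemma in_translate c d w (x y : R) : (L : set plane) w ->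
  c.1 + w.1 <= x <= d.1 + w.1 -> c.2 + w.2 <= y <= d.2 + w.2 ->
  translates L (box c d) (x, y).
Proof. by move=> Lw hx hy; exists w => //; split => /=; lra. Qed.

Section OneRectangle.
Variables (c d : plane).
Hypothesis cd : stackless L c d.
Local Notation S := (translates L (box c d)).

Lemma stackless_above : exists2 r, 0 < r & forall w x t, (L : set plane) w ->
  c.1 + w.1 < x -> x < d.1 + w.1 -> d.2 + w.2 < t -> t <= d.2 + w.2 + r ->
  ~ S (x, t).
Proof.
case: cd => cd1 cd2 [r r0 H]; exists r => // w x t Lw h1 h2 h3 h4 [w' Lw' [/= h5 h6]].
apply: (H (w' - w)); first exact: latticeB.
all: rewrite /= ?ltr_norml; lra.
Qed.

Lemma stackless_below : exists2 r, 0 < r & forall w x t, (L : set plane) w ->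
  c.1 + w.1 < x -> x < d.1 + w.1 -> t < c.2 + w.2 -> c.2 + w.2 - r <= t ->
  ~ S (x, t).
Proof.
case: cd => cd1 cd2 [r r0 H]; exists r => // w x t Lw h1 h2 h3 h4 [w' Lw' [/= h5 h6]].
apply: (H (w - w')); first exact: latticeB.
all: rewrite /= ?ltr_norml; lra.
Qed.

Definition open_above (x hi : R) :=
  forall r, 0 < r -> exists t, [/\ hi < t, t < hi + r & ~ S (x, t)].
Definition open_below (x lo : R) :=
  forall r, 0 < r -> exists t, [/\ t < lo, lo - r < t & ~ S (x, t)].

Lemma stackless_top w x y hi : (L : set plane) w ->
  c.1 + w.1 < x -> x < d.1 + w.1 -> c.2 + w.2 <= y <= d.2 + w.2 -> y < hi ->
  (forall t, y <= t <= hi -> S (x, t)) -> open_above x hi -> hi = d.2 + w.2.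
Proof.
move=> Lw h1 h2 h3 h4 HS Hup; have [r r0 H] := stackless_above.
apply/eqP; rewrite eq_le !leNgt; apply/andP; split; apply/negP => h5.
- pose t := Num.min hi (d.2 + w.2 + r).
  have th : t <= hi by rewrite ge_min lexx.
  have tr : t <= d.2 + w.2 + r by rewrite ge_min lexx orbT.
  have t0 : d.2 + w.2 < t by rewrite lt_min h5 /=; lra.
  by apply: (H w x t) => //; apply: HS; lra.
- have [|t [t1 t2]] := Hup (d.2 + w.2 - hi); first lra.
  by apply; apply: (in_translate Lw); lra.
Qed.

Lemma stackless_bottom w x y lo : (L : set plane) w ->
  c.1 + w.1 < x -> x < d.1 + w.1 -> c.2 + w.2 <= y <= d.2 + w.2 -> lo < y ->
  (forall t, lo <= t <= y -> S (x, t)) -> open_below x lo -> lo = c.2 + w.2.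
Proof.
move=> Lw h1 h2 h3 h4 HS Hdn; have [r r0 H] := stackless_below.
apply/eqP; rewrite eq_le !leNgt; apply/andP; split; apply/negP => h5.
- have [|t [t1 t2]] := Hdn (lo - (c.2 + w.2)); first lra.
  by apply; apply: (in_translate Lw); lra.
- pose t := Num.max lo (c.2 + w.2 - r).
  have th : lo <= t by rewrite le_max lexx.
  have tr : c.2 + w.2 - r <= t by rewrite le_max lexx orbT.
  have t0 : t < c.2 + w.2 by rewrite gt_max h5 /=; lra.
  by apply: (H w x t) => //; apply: HS; lra.
Qed.

Lemma stackless_open_above x : c.1 < x -> x < d.1 -> open_above x d.2.
Proof.
move=> h1 h2 r r0; have [s s0 H] := stackless_above.
pose t := Num.min r s.
have t0 : 0 < t by rewrite lt_min r0.
have tr : t <= r by rewrite ge_min lexx.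
have ts : t <= s by rewrite ge_min lexx orbT.
exists (d.2 + t / 2); split; [lra|lra|].
by apply: (H 0); rewrite /=; [exact: lattice0|lra..].
Qed.

Lemma stackless_open_below x : c.1 < x -> x < d.1 -> open_below x c.2.
Proof.
move=> h1 h2 r r0; have [s s0 H] := stackless_below.
pose t := Num.min r s.
have t0 : 0 < t by rewrite lt_min r0.
have tr : t <= r by rewrite ge_min lexx.
have ts : t <= s by rewrite ge_min lexx orbT.
exists (c.2 - t / 2); split; [lra|lra|].
by apply: (H 0); rewrite /=; [exact: lattice0|lra..].
Qed.

(** Every point of an open interval of the first axis lies on a translate whose
    interior projects onto nearby points of the interval; if all these
    translates have the same top, they are the same one. *)
Lemma stackless_interval (a b y : R) (P : R -> Prop) : a < b ->
  (forall x, a < x -> x < b -> S (x, y)) ->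
  (forall w x, (L : set plane) w -> a < x -> x < b ->
     c.1 + w.1 < x -> x < d.1 + w.1 -> c.2 + w.2 <= y <= d.2 + w.2 -> P w.2) ->
  (forall s t, P s -> P t -> s = t) ->
  exists w, [/\ (L : set plane) w, P w.2, c.1 + w.1 <= a, b <= d.1 + w.1 &
    c.2 + w.2 <= y <= d.2 + w.2].
Proof.
move=> ab HS HP Puniq; case: cd => cd1 cd2 _.
have hit x : a < x -> x < b -> exists w, [/\ (L : set plane) w, P w.2,
    c.1 + w.1 <= x <= d.1 + w.1 & c.2 + w.2 <= y <= d.2 + w.2].
  move=> ax xb; have [w Lw [/= h1 h2]] := HS x ax xb.
  have [x' [[g1 g2] [g3 g4]]] : exists x', (a < x' /\ x' < b) /\
      (c.1 + w.1 < x' /\ x' < d.1 + w.1).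
    by apply: open_intervals_meet; lra.
  exists w; split=> //; [|lra|lra].
  by apply: (HP w x') => //; lra.
have [w [Lw Pw hx hy]] := hit ((a + b) / 2) ltac:(lra) ltac:(lra).
have all_w x : a < x -> x < b -> c.1 + w.1 <= x <= d.1 + w.1.
  move=> ax xb; have [w' [Lw' Pw' h1 h2]] := hit x ax xb.
  by rewrite (snd_inj Lw Lw' (Puniq _ _ Pw Pw')).
exists w; split=> //; rewrite leNgt; apply/negP => h.
- pose t := Num.min b (c.1 + w.1).
  have t1 : t <= b by rewrite ge_min lexx.
  have t2 : t <= c.1 + w.1 by rewrite ge_min lexx orbT.
  have t3 : a < t by rewrite lt_min ab.
  by have := all_w ((a + t) / 2) ltac:(lra) ltac:(lra); lra.
- pose t := Num.max a (d.1 + w.1).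
  have t1 : a <= t by rewrite le_max lexx.
  have t2 : d.1 + w.1 <= t by rewrite le_max lexx orbT.
  have t3 : t < b by rewrite gt_max ab.
  by have := all_w ((b + t) / 2) ltac:(lra) ltac:(lra); lra.
Qed.

End OneRectangle.

Lemma stackless_sub c d c' d' : stackless L c d -> stackless L c' d' ->
  translates L (box c d) = translates L (box c' d') ->
  exists w, [/\ (L : set plane) w, c'.1 + w.1 <= c.1, d.1 <= d'.1 + w.1,
    c.2 = c'.2 + w.2 & d.2 = d'.2 + w.2].
Proof.
move=> cd cd' E; have [cd1 cd2 _] := cd.
pose y := (c.2 + d.2) / 2.
have inS x t : c.1 < x -> x < d.1 -> c.2 <= t <= d.2 -> translates L (box c' d') (x, t).
  move=> h1 h2 h3; rewrite -E; apply: (in_translate (lattice0 L)); rewrite /=; lra.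
have [|w x Lw h1 h2 h3 h4 h5|s t [-> _] [-> _]|w [Lw [w1 w2] h1 h2 h3]] //:=
  stackless_interval (P := fun s => s = c.2 - c'.2 /\ s = d.2 - d'.2) cd' cd1 (y := y).
- by move=> x h1 h2; apply: inS => //; rewrite /y; lra.
- have up := stackless_open_above cd h1 h2; have dn := stackless_open_below cd h1 h2.
  rewrite /open_above /open_below E in up dn.
  have bt : c.2 = c'.2 + w.2.
    apply: (stackless_bottom cd' Lw h3 h4 h5 _ _ dn); first by rewrite /y; lra.
    by move=> t ht; apply: inS => //; rewrite /y in ht; lra.
  have tp : d.2 = d'.2 + w.2.
    apply: (stackless_top cd' Lw h3 h4 h5 _ _ up); first by rewrite /y; lra.
    by move=> t ht; apply: inS => //; rewrite /y in ht; lra.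
  by split; lra.
- by exists w; split => //; lra.
Qed.

Lemma stackless_eq c d c' d' : stackless L c d -> stackless L c' d' ->
  translates L (box c d) = translates L (box c' d') ->
  exists w, [/\ (L : set plane) w, c = c' + w & d = d' + w].
Proof.
move=> cd cd' E.
have [w [Lw h1 h2 h3 h4]] := stackless_sub cd cd' E.
have [w' [Lw' h1' h2' h3' h4']] := stackless_sub cd' cd (esym E).
have w'E : w' = - w.
  by apply: snd_inj => //; [exact: latticeN | rewrite /=; lra].
rewrite w'E /= in h1' h2'.
by exists w; split=> //; apply: plane_eqP; rewrite /=; lra.
Qed.

End Stackless.

Section AffineImages.
Variables (R : realType) (L : lattice R).
Local Notation plane := (R * R)%type.
Implicit Types (c d w k : plane) (a b : R).

(** A coordinate with negative scale exchanges the two corners. *)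
Definition image_corner a b k c d : plane :=
  (k.1 + (if 0 < a then a * c.1 else a * d.1),
   k.2 + (if 0 < b then b * c.2 else b * d.2)).

Lemma scaled_segment a (x l r : R) : a != 0 ->
  ((if 0 < a then a * l else a * r) <= a * x <= (if 0 < a then a * r else a * l)) =
  (l <= x <= r).
Proof.
move=> a0; have [a1|a1] := ltP 0 a; first by rewrite !ler_pM2l.
have {}a1 : a < 0 by rewrite lt_neqAle a0.
by rewrite !ler_nM2l// andbC.
Qed.

Lemma image_width a (l r : R) : a != 0 ->
  (if 0 < a then a * r else a * l) - (if 0 < a then a * l else a * r) =
  `|a| * (r - l).
Proof.
move=> a0; have [a1|a1] := ltP 0 a; first by rewrite gtr0_norm// mulrBr.
by rewrite ler0_norm//; ring.
Qed.

Variables (a b : R).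
Hypotheses (a0 : a != 0) (b0 : b != 0).
Hypothesis abL : forall x, (L : set plane) (diag_map a b x) <-> (L : set plane) x.

Lemma box_image k c d (x : plane) :
  box (image_corner a b k c d) (image_corner a b k d c) (diag_map a b x + k) <->
  box c d x.
Proof.
rewrite /box /= -!(addrC k.1) -!(addrC k.2) !lerD2l.
by rewrite !scaled_segment.
Qed.

Lemma translates_image k c d :
  [set diag_map a b x + k | x in translates L (box c d)] =
  translates L (box (image_corner a b k c d) (image_corner a b k d c)).
Proof.
apply/seteqP; split=> y.
  move=> [x [w Lw /(box_image k) h] <-]; exists (diag_map a b w); first exact/abL.
  by move: h; rewrite diag_mapB addrAC.
move=> [w Lw h]; pose x := diag_map a^-1 b^-1 (y - k).
have xE : diag_map a b x = y - k.
  by rewrite /x; apply: plane_eqP; rewrite /= mulVKf.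
exists x; last by rewrite xE subrK.
have [w' w'E] : exists w', diag_map a b w' = w.
  exists (diag_map a^-1 b^-1 w); by apply: plane_eqP; rewrite /= mulVKf.
exists w'; first by apply/abL; rewrite w'E.
by apply/(box_image k); rewrite diag_mapB xE w'E addrAC subrK.
Qed.

Lemma stackless_image k c d : stackless L c d ->
  stackless L (image_corner a b k c d) (image_corner a b k d c).
Proof.
move=> [cd1 cd2 [r r0 H]].
have W (p q s : R) : s + p - (s + q) = p - q by ring.
have a1 : 0 < `|a| by rewrite normr_gt0.
have b1 : 0 < `|b| by rewrite normr_gt0.
split=> /=.
- by rewrite -subr_gt0 W image_width// mulr_gt0// subr_gt0.
- by rewrite -subr_gt0 W image_width// mulr_gt0// subr_gt0.
exists (`|b| * r); first exact: mulr_gt0.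
move=> w Lw; rewrite !W !image_width// => h1 h2 h3.
have [w' w'E] : exists w', diag_map a b w' = w.
  exists (diag_map a^-1 b^-1 w); by apply: plane_eqP; rewrite /= mulVKf.
have Lw' : (L : set plane) w' by apply/abL; rewrite w'E.
rewrite -w'E /= in h1 h2 h3.
rewrite normrM ltr_pM2l// in h1.
rewrite -mulrDr in h3.
have [b2|b2] := ltP 0 b.
  rewrite pmulr_rgt0// in h2; rewrite gtr0_norm// ler_pM2l// in h3.
  exact: (H w').
have {}b2 : b < 0 by rewrite lt_neqAle b0.
rewrite nmulr_rgt0// in h2; rewrite ltr0_norm// mulNr -mulrN ler_nM2l// in h3.
apply: (H (- w')); rewrite /= ?normrN ?oppr_gt0//; first exact: latticeN.
lra.
Qed.

End AffineImages.

Section Rigidity.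
Variables (R : realType) (L : lattice R).
Local Notation plane := (R * R)%type.
Hypothesis fst_free : forall w : plane, (L : set plane) w -> w.1 = 0 -> w = 0.
Hypothesis snd_free : forall w : plane, (L : set plane) w -> w.2 = 0 -> w = 0.

Section Tiles.
Variables (e f : plane).
Hypotheses (Lef : lattice_basis L e f).
Hypotheses (e1_gt0 : 0 < e.1) (e2_gt0 : 0 < e.2).
Hypotheses (f1_lt0 : f.1 < 0) (f2_gt0 : 0 < f.2).

Definition tile_lower (e f : plane) (i : 'I_2) : plane := (tile_left e f i, 0).
Definition tile_upper (e f : plane) (i : 'I_2) : plane :=
  (tile_right e f i, tile_height e f i).

(** A translate stacked on the narrower tile would be based at a lattice vector in
    the gap described by spine_gap. *)
Lemma narrow_stackless i : tile_right e f i - tile_left e f i <= e.1 ->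
  tile_right e f i - tile_left e f i <= - f.1 ->
  stackless L (tile_lower e f i) (tile_upper e f i).
Proof.
move=> h1 h2; split=> /=; [exact: tile_left_lt_right|exact: tile_height_gt0|].
exists ((e.2 + f.2 - tile_height e f i) / 2).
  move: e2_gt0 f2_gt0; rewrite /tile_height /tile_step.
  by case: (i == 0); lra.
move=> w Lw; rewrite ltr_norml => /andP[g1 g2] g3 g4.
apply: (spine_gap Lef e1_gt0 e2_gt0 f1_lt0 f2_gt0 Lw); [lra|lra|lra|].
move: g4; rewrite subr0; move: (e2_gt0) (f2_gt0); rewrite /tile_height /tile_step.
by case: (i == 0); lra.
Qed.

(** On the part of the wide tile that carries the narrow one, a vertical section
    of a stackless rectangle would end at the top of the wide tile; the lower end
    of that section would be the bottom of some translate of the wide tile, and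
    below that one, on part of the same columns, there is a further wide tile. *)
Lemma wide_not_stackless c d : e.1 < - f.1 -> stackless L c d ->
  translates L (box (tile_lower e f 0) (tile_upper e f 0)) <>
  translates L (box c d).
Proof.
move=> wide cd E; have [cd1 cd2 _] := cd.
have e10 := e1_gt0; have e20 := e2_gt0; have f10 := f1_lt0; have f20 := f2_gt0.
set S := translates L (box c d).
have inS z x t : (L : set plane) z -> z.1 <= x <= z.1 - f.1 ->
    z.2 <= t <= z.2 + e.2 -> S (x, t).
  move=> Lz hx ht; rewrite /S -E.
  by apply: (in_translate Lz); rewrite /tile_lower /tile_upper /tile_left
    /tile_right /tile_height /tile_step /=; lra.
have up x : 0 < x -> x < e.1 -> open_above L c d x e.2.
  move=> x0 x1 r r0; pose t := Num.min r f.2.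
  have tr : t <= r by rewrite ge_min lexx.
  have tf : t <= f.2 by rewrite ge_min lexx orbT.
  have t0 : 0 < t by rewrite lt_min r0.
  exists (e.2 + t / 2); split; [lra|lra|].
  rewrite -E => -[w Lw [/=]].
  rewrite /tile_left /tile_right /tile_height /tile_step /= => h1 h2.
  have Lwe : (L : set plane) (w - e).
    by apply: latticeB => //; exact: basis_fst Lef.
  have : w - e = 0 /\ (1 : 'I_2) = 0; last by case.
  by apply: (tile_overlap Lef e10 e20 f10 f20 Lwe);
    rewrite /tile_left /tile_right /tile_height /tile_step /=; lra.
have [|w x Lw h1 h2 h3 h4 h5|s t -> -> //|w [Lw wt w1 w2 wy]] :=
  stackless_interval snd_free (P := fun s => s = e.2 - d.2) cd e10 (y := e.2 / 2).
- by move=> x h1 h2; apply: (inS _ _ _ (lattice0 L)) => /=; lra.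
- have : e.2 = d.2 + w.2; last lra.
  apply: (stackless_top cd Lw h3 h4 h5 _ _ (up x h1 h2)); first lra.
  by move=> t ht; apply: (inS _ _ _ (lattice0 L)) => /=; lra.
have [r r0 below] := stackless_below cd.
set y0 := c.2 + w.2.
have low x : 0 < x -> x < e.1 -> exists z, [/\ (L : set plane) z,
    z.1 <= x <= z.1 - f.1 & z.2 = y0].
  move=> x0 x1; have : S (x, y0) by apply: (in_translate Lw); rewrite /y0; lra.
  rewrite /S -E => -[z Lz [/=]].
  rewrite /tile_left /tile_right /tile_height /tile_step /= => g1 g2.
  exists z; split=> //; first lra.
  apply/eqP; rewrite eq_le; apply/andP; split; first lra.
  rewrite leNgt; apply/negP => g3.
  pose t := Num.max z.2 (y0 - r).
  have tz : z.2 <= t by rewrite le_max lexx.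
  have tr : y0 - r <= t by rewrite le_max lexx orbT.
  have ty : t < y0 by rewrite gt_max g3 /=; lra.
  apply: (below w x t Lw); rewrite -/y0; [lra|lra|lra|lra|].
  by apply: (inS z) => //; lra.
have [z [Lz z1 z2]] := low (e.1 / 2) ltac:(lra) ltac:(lra).
have zall x : 0 < x -> x < e.1 -> z.1 <= x <= z.1 - f.1.
  move=> x0 x1; have [z' [Lz' z1' z2']] := low x x0 x1.
  by rewrite (snd_inj snd_free Lz Lz') // z2 z2'.
have zl : z.1 <= 0.
  rewrite leNgt; apply/negP => h; pose t := Num.min e.1 z.1.
  have t1 : t <= e.1 by rewrite ge_min lexx.
  have t2 : t <= z.1 by rewrite ge_min lexx orbT.
  have t0 : 0 < t by rewrite lt_min e10.
  by have := zall (t / 2) ltac:(lra) ltac:(lra); lra.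
have zr : e.1 <= z.1 - f.1.
  rewrite leNgt; apply/negP => h; pose t := Num.max 0 (z.1 - f.1).
  have t1 : 0 <= t by rewrite le_max lexx.
  have t2 : z.1 - f.1 <= t by rewrite le_max lexx orbT.
  have t0 : t < e.1 by rewrite gt_max e10.
  by have := zall ((t + e.1) / 2) ltac:(lra) ltac:(lra); lra.
have [zr'|zr'] := eqVneq e.1 (z.1 - f.1).
  have zE : z = e + f.
    apply/eqP; rewrite -subr_eq0; apply/eqP; apply: fst_free; last by rewrite /=; lra.
    apply: latticeB => //; apply: latticeD; first exact: basis_fst Lef.
    exact: basis_snd Lef.
  by rewrite zE /= /y0 in z2; lra.
have {}zr : 0 < z.1 - f.1 - e.1 by rewrite subr_gt0 lt_neqAle zr'.
pose x := Num.min e.1 (z.1 - f.1 - e.1) / 2.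
have t1 : Num.min e.1 (z.1 - f.1 - e.1) <= e.1 by rewrite ge_min lexx.
have t2 : Num.min e.1 (z.1 - f.1 - e.1) <= z.1 - f.1 - e.1 by rewrite ge_min lexx orbT.
have t0 : 0 < Num.min e.1 (z.1 - f.1 - e.1) by rewrite lt_min e10.
pose s := Num.min r e.2.
have s1 : s <= r by rewrite ge_min lexx.
have s2 : s <= e.2 by rewrite ge_min lexx orbT.
have s0 : 0 < s by rewrite lt_min r0.
have x0 : 0 < x by rewrite /x; lra.
apply: (below w x (y0 - s / 2) Lw); rewrite -/y0;
  [lra|rewrite /x; lra|lra|lra|].
apply: (inS (z - e)); rewrite /= /x ?z2; [|lra|lra].
by apply: latticeB => //; exact: basis_fst Lef.
Qed.

End Tiles.
End Rigidity.

Section Mirror.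
Variables (R : realType) (L : lattice R).
Local Notation plane := (R * R)%type.

(** The reflection exchanges the two tiles, so that statements about a wide tile 0
    apply to a wide tile 1. *)
Definition mirror (x : plane) : plane := (- x.1, x.2).

Lemma mirrorK : involutive mirror.
Proof. by move=> x; apply: plane_eqP; rewrite /= ?opprK. Qed.

Lemma mirror_basis e f : lattice_basis L e f ->
  lattice_basis [set x | (L : set plane) (mirror x)] (mirror f) (mirror e).
Proof.
move=> Lef; split=> [a b /[dup] /(congr1 fst) /= h1 /(congr1 snd) /= h2|].
  case: Lef => ind _; have [] := ind b a; last by move=> -> ->.
  by apply: plane_eqP; rewrite /=; move: h1 h2; rewrite /GRing.scale /=; lra.
have M i j : mirror (mirror f *~ i + mirror e *~ j) = e *~ j + f *~ i.
  by apply: plane_eqP; rewrite /= !(fst_mulrz, snd_mulrz) /=; ring.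
apply/seteqP; split=> x /=.
  move=> /(lattice_coords Lef)[i [j E]]; exists j, i.
  by apply: (inv_inj mirrorK); rewrite M.
by move=> [i [j ->]]; rewrite M; apply/(lattice_coords Lef); exists j, i.
Qed.

Lemma mirror_lattice_subproof : exists e f,
  lattice_basis [set x | (L : set plane) (mirror x)] e f.
Proof.
have [e [f Lef]] := latticeP L.
by exists (mirror f), (mirror e); exact: mirror_basis.
Qed.

Definition mirror_lattice : lattice R := Lattice mirror_lattice_subproof.

Lemma mirror_stackless (c d : plane) : stackless L c d ->
  stackless mirror_lattice (- d.1, c.2) (- c.1, d.2).
Proof.
move=> [cd1 cd2 [r r0 H]]; split=> /=; [by lra|by []|exists r => // w Lw].
rewrite opprK addrC => h1 h2 h3; apply: (H (mirror w)) => //=.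
by rewrite normrN.
Qed.

Lemma mirror_translates (c d x : plane) :
  translates mirror_lattice (box (- d.1, c.2) (- c.1, d.2)) x <->
  translates L (box c d) (mirror x).
Proof.
split=> -[w Lw [h1 h2]].
  by exists (mirror w) => //; split; rewrite /= in h1 h2 *; lra.
exists (mirror w); first by rewrite /= /mirror /= opprK -surjective_pairing.
by split; rewrite /= in h1 h2 *; lra.
Qed.

End Mirror.

Section Rigidity.
Variables (R : realType) (L : lattice R).
Local Notation plane := (R * R)%type.
Hypothesis fst_free : forall w : plane, (L : set plane) w -> w.1 = 0 -> w = 0.
Hypothesis snd_free : forall w : plane, (L : set plane) w -> w.2 = 0 -> w = 0.
Variables (e f : plane).
Hypotheses (Lef : lattice_basis L e f).
Hypotheses (e1_gt0 : 0 < e.1) (e2_gt0 : 0 < e.2).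
Hypotheses (f1_lt0 : f.1 < 0) (f2_gt0 : 0 < f.2).

Lemma wide_second_not_stackless c d : - f.1 < e.1 -> stackless L c d ->
  translates L (box (tile_lower e f 1) (tile_upper e f 1)) <>
  translates L (box c d).
Proof.
move=> wide cd E.
apply: (@wide_not_stackless _ (mirror_lattice L) _ _ (mirror f) (mirror e) _ _ _ _ _
    (- d.1, c.2) (- c.1, d.2)).
- move=> w Lw w1; apply: (inv_inj (@mirrorK R)); rewrite [RHS](_ : _ = 0); last first.
    by apply: plane_eqP; rewrite /= ?oppr0.
  by apply: fst_free => //=; rewrite w1 oppr0.
- move=> w Lw w2; apply: (inv_inj (@mirrorK R)); rewrite [RHS](_ : _ = 0); last first.
    by apply: plane_eqP; rewrite /= ?oppr0.
  exact: snd_free.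
- exact: mirror_basis.
- by rewrite /= oppr_gt0.
- by [].
- by rewrite /= oppr_lt0.
- by [].
- by rewrite /= opprK.
- exact: mirror_stackless.
have cE : tile_lower (mirror f) (mirror e) 0 =
    (- (tile_upper e f 1).1, (tile_lower e f 1).2).
  by rewrite /tile_lower /tile_left /tile_right /= oppr0.
have dE : tile_upper (mirror f) (mirror e) 0 =
    (- (tile_lower e f 1).1, (tile_upper e f 1).2).
  by rewrite /tile_lower /tile_upper /tile_left /tile_right /tile_height /tile_step /=.
rewrite cE dE; apply/seteqP; split=> x /mirror_translates h.
  by apply/mirror_translates; rewrite -E.
by apply/mirror_translates; rewrite E.
Qed.

(** The widths differ, for otherwise e + f would lie on the vertical axis. *)
Lemma narrow_tile : exists i : 'I_2,
  stackless L (tile_lower e f i) (tile_upper e f i) /\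
  forall c d j, stackless L c d ->
    translates L (box (tile_lower e f j) (tile_upper e f j)) =
    translates L (box c d) -> j = i.
Proof.
have [h|h|h] := ltgtP e.1 (- f.1).
- exists 1; split.
    apply: narrow_stackless => //; rewrite /tile_left /tile_right /=; lra.
  move=> c d j cd; have [->|->//] := ord2_cases j => E.
  by case: (wide_not_stackless fst_free snd_free Lef e1_gt0 e2_gt0 f1_lt0 f2_gt0 h cd).
- exists 0; split.
    apply: narrow_stackless => //; rewrite /tile_left /tile_right /=; lra.
  move=> c d j cd; have [->//|->] := ord2_cases j => E.
  by case: (wide_second_not_stackless h cd).
- have : e + f = 0.
    apply: fst_free; last by rewrite /= h addNr.
    by apply: latticeD; [exact: basis_fst Lef|exact: basis_snd Lef].
  by move=> /(congr1 snd) /=; move: e2_gt0 f2_gt0; lra.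
Qed.

Lemma unit_scale (s t w l r : R) : s != 0 -> l < r ->
  t + (if 0 < s then s * l else s * r) = l + w ->
  t + (if 0 < s then s * r else s * l) = r + w ->
  (s = 1 /\ t = w) \/ (s = -1 /\ t = l + r + w).
Proof.
move=> s0 lr; have lr0 : r - l != 0 by rewrite subr_eq0 gt_eqF.
have [s1|s1] := ltP 0 s => E1 E2; [left|right].
  have sE : s = 1 by apply: (mulIf lr0); lra.
  by rewrite sE in E1 *; split=> //; lra.
have sE : s = -1 by apply: (mulIf lr0); lra.
by rewrite sE in E1 *; split=> //; lra.
Qed.

Variables (a b : R) (k : plane).
Hypotheses (a0 : a != 0) (b0 : b != 0).
Hypothesis abL : forall x, (L : set plane) (diag_map a b x) <-> (L : set plane) x.

(** Lengths of vertical sections determine the narrow tile up to a translation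
    of the lattice, so an affine map that permutes the tiles of one bi-partition
    preserves its side lengths; lattice vectors off the axes then rule out
    reflections. *)
Lemma pieces_rigid :
  (forall i, exists j, [set diag_map a b x + k |
       x in translates L (box (tile_lower e f i) (tile_upper e f i))] =
     translates L (box (tile_lower e f j) (tile_upper e f j))) ->
  [/\ a = 1, b = 1 & (L : set plane) k] \/
  [/\ a = -1, b = -1 & (L : set plane) (k - (0, e.2 + f.2))].
Proof.
move=> H; have [i [st nst]] := narrow_tile; have [j] := H i.
rewrite (translates_image a0 b0 abL) => E.
have st' := stackless_image a0 b0 abL k st.
have ji := nst _ _ j st' (esym E); rewrite {j}ji in E.
have [w [Lw cE dE]] := stackless_eq snd_free st' st E.
have ca := congr1 fst cE; have cb := congr1 snd cE.
have da := congr1 fst dE; have db := congr1 snd dE.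
have [W1 W2 _] := st.
have Le := basis_fst Lef; have Lf := basis_snd Lef.
have Lab : (L : set plane) (diag_map a b e) by apply/abL.
have sa := unit_scale a0 W1 ca da; have sb := unit_scale b0 W2 cb db.
case: sa sb => [[aE kE]|[aE kE]] [[bE hE]|[bE hE]].
- by left; split=> //; rewrite (_ : k = w) //; exact: plane_eqP.
- suff /(congr1 fst) /= : e + diag_map a b e = 0.
    by rewrite aE => E0; exfalso; move: E0 e1_gt0; rewrite /=; lra.
  by apply: snd_free; [exact: latticeD | rewrite /= bE; ring].
- suff /(congr1 snd) /= : e + diag_map a b e = 0.
    by rewrite bE => E0; exfalso; move: E0 e2_gt0; rewrite /=; lra.
  by apply: fst_free; [exact: latticeD | rewrite /= aE; ring].
- right; split=> //.
  rewrite (_ : _ - _ = w - tile_step e f (if i == 0 then 1 else 0)).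
    by apply: latticeB => //; exact: lattice_step.
  apply: plane_eqP; rewrite /= ?kE ?hE /tile_lower /tile_upper /tile_left
    /tile_right /tile_height /tile_step /=; case: (i == 0) => /=; ring.
Qed.

End Rigidity.

(** * Homeomorphisms commuting with the automorphism *)

Section TorusTopology.
Variables (R : realType) (L : lattice R).
Local Notation plane := (R * R)%type.

Lemma proj_surj (X : torus L) : exists x, X = proj L x.
Proof. by exists (repr X); rewrite /proj reprK. Qed.

Lemma proj_add (x w : plane) : (L : set plane) w -> proj L (x + w) = proj L x.
Proof. by move=> Lw; apply/projP; rewrite addrAC subrr add0r. Qed.

Lemma plane_nbhsP (x : plane) (A : set plane) : nbhs x A <->
  exists2 r, 0 < r & forall y, `|x.1 - y.1| < r -> `|x.2 - y.2| < r -> A y.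
Proof.
rewrite nbhs_ballP; split=> -[r r0 H]; exists r => //.
  by move=> y h1 h2; apply: H; split.
by move=> y [h1 h2]; exact: H.
Qed.

Lemma proj_continuous : continuous (proj L).
Proof. exact: pi_continuous. Qed.

Lemma proj_open (U : set plane) : open U -> open (proj L @` U).
Proof.
move=> oU; rewrite /open /= /quotient_open openE => x [u Uu /projP Lux].
have /plane_nbhsP[r r0 H] : nbhs u U by exact: open_nbhs_nbhs.
apply/plane_nbhsP; exists r => // y h1 h2.
exists (y + (u - x)); last by rewrite -/(proj L y) proj_add.
by apply: H => /=; rewrite opprD addrCA; rewrite opprB -?addrA;
  [rewrite (_ : _ + _ = x.1 - y.1)//; ring | rewrite (_ : _ + _ = x.2 - y.2)//; ring].
Qed.

(** A fundamental parallelogram is contained in some square. *)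
Lemma lattice_cobounded : exists B : R, forall x : plane, exists w,
  [/\ (L : set plane) w, - B <= (x - w).1 <= B & - B <= (x - w).2 <= B].
Proof.
have [e [f Lef]] := latticeP L; have cr := basis_cross Lef.
exists (`|e.1| + `|f.1| + `|e.2| + `|f.2|) => x.
set d := e.1 * f.2 - e.2 * f.1 in cr.
pose s := (x.1 * f.2 - x.2 * f.1) / d; pose t := (e.1 * x.2 - e.2 * x.1) / d.
exists (e *~ Num.floor s + f *~ Num.floor t); split.
- by apply/(lattice_coords Lef); exists (Num.floor s), (Num.floor t).
all: rewrite -ler_norml ?fst_sub ?snd_sub ?fst_comb ?snd_comb.
all: have := floor_itv s; have := floor_itv t; move=> /andP[t1 t2] /andP[s1 s2].
all: rewrite intrD in s2; rewrite intrD in t2.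
- have -> : x.1 = e.1 * s + f.1 * t by rewrite /s /t /d; field.
  have -> : e.1 * s + f.1 * t - (e.1 * (Num.floor s)%:~R + f.1 * (Num.floor t)%:~R) =
    e.1 * (s - (Num.floor s)%:~R) + f.1 * (t - (Num.floor t)%:~R) by ring.
  apply: (le_trans (ler_normD _ _)); rewrite !normrM -!addrA; apply: lerD.
    by rewrite ler_piMr// ler_norml; lra.
  rewrite -[leLHS]addr0; apply: lerD; last by rewrite addr_ge0.
  by rewrite ler_piMr// ler_norml; lra.
- have -> : x.2 = e.2 * s + f.2 * t by rewrite /s /t /d; field.
  have -> : e.2 * s + f.2 * t - (e.2 * (Num.floor s)%:~R + f.2 * (Num.floor t)%:~R) =
    e.2 * (s - (Num.floor s)%:~R) + f.2 * (t - (Num.floor t)%:~R) by ring.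
  apply: (le_trans (ler_normD _ _)); rewrite !normrM -!addrA addrA -[leLHS]add0r; apply: lerD.
    by rewrite addr_ge0.
  apply: lerD; by rewrite ler_piMr// ler_norml; lra.
Qed.

(** Uniform continuity of a map of the torus, read on lifts to the plane. *)
Lemma torus_unif_continuous (h : torus L -> torus L) (r : R) : continuous h ->
  0 < r -> exists2 s, 0 < s & forall x y x' : plane,
    `|x.1 - y.1| < s -> `|x.2 - y.2| < s -> h (proj L x) = proj L x' ->
    exists y', [/\ h (proj L y) = proj L y', `|x'.1 - y'.1| < r & `|x'.2 - y'.2| < r].
Proof.
move=> hc r0; have [B HB] := lattice_cobounded.
pose K : set plane := `[- B, B] `*` `[- B, B].
have cK : compact K by apply: compact_setX; exact: segment_compact.
pose P (s : R) (x : plane) := forall y : plane, `|x.1 - y.1| < s -> `|x.2 - y.2| < s ->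
  exists x' y', [/\ h (proj L x) = proj L x', h (proj L y) = proj L y',
     `|x'.1 - y'.1| < r & `|x'.2 - y'.2| < r].
have [s s0 Hs] : exists2 s, 0 < s & K `<=` P s.
  have : \forall s \near (0 : R)^'+, K `<=` P s.
    move/compact_near_coveringP : cK; apply => x0 _.
    have [x0' x0'E] := proj_surj (h (proj L x0)).
    pose U : set plane := [set y | `|x0'.1 - y.1| < r / 2 /\ `|x0'.2 - y.2| < r / 2].
    have oU : open U.
      rewrite openE => y [y1 y2]; apply/plane_nbhsP.
      exists (Num.min (r / 2 - `|x0'.1 - y.1|) (r / 2 - `|x0'.2 - y.2|)).
        by rewrite lt_min !subr_gt0 y1.
      move=> z; rewrite !lt_min => /andP[z1 _] /andP[_ z2]; split.
        by rewrite (le_lt_trans (ler_distD y.1 _ _))// -ltrBrDl.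
      by rewrite (le_lt_trans (ler_distD y.2 _ _))// -ltrBrDl.
    have : nbhs x0 ((h \o proj L) @^-1` (proj L @` U)).
      apply: (continuous_comp (@proj_continuous x0) (hc _)).
      apply: open_nbhs_nbhs; split; first exact: proj_open.
      exists x0' => //; rewrite /U /= !subrr normr0; split; lra.
    move=> /plane_nbhsP[u u0 Hu].
    exists ([set x | `|x0.1 - x.1| < u / 2 /\ `|x0.2 - x.2| < u / 2],
            [set s | s < u / 2]) => /=.
      split; last by apply: nbhs_right_lt; lra.
      by apply/plane_nbhsP; exists (u / 2); [lra|move=> y ? ?; split].
    move=> [x s] /= [[x1 x2] su] y y1 y2.
    have [x' [x'1 x'2] x'E] := Hu x ltac:(lra) ltac:(lra).
    have [y' [y'1 y'2] y'E] := Hu y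
      ltac:(rewrite (le_lt_trans (ler_distD x.1 _ _))//; lra)
      ltac:(rewrite (le_lt_trans (ler_distD x.2 _ _))//; lra).
    exists x', y'; split=> //.
      by rewrite (le_lt_trans (ler_distD x0'.1 _ _))// (distrC x'.1); lra.
    by rewrite (le_lt_trans (ler_distD x0'.2 _ _))// (distrC x'.2); lra.
  move=> nr; have gt0 := nbhs_right_gt (0 : R).
  have both : \forall s \near (0 : R)^'+, K `<=` P s /\ 0 < s by exact: filterI.
  by have [s [? ?]] := @filter_ex _ _ (at_right_proper_filter (0 : R)) _ both; exists s.
exists s => // x y x' h1 h2 hx.
have [w [Lw w1 w2]] := HB x.
have xw v : proj L (v - w) = proj L v by rewrite proj_add//; exact: latticeN.
have [] := Hs (x - w) _ (y - w).
- by split; rewrite /= in_itv.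
- by rewrite /= opprB addrA subrK.
- by rewrite /= opprB addrA subrK.
move=> x1 [y1 []]; rewrite !xw hx => /projP Lx E n1 n2.
exists (y1 + (x' - x1)); split; first by rewrite proj_add.
  by rewrite (_ : _ - _ = x1.1 - y1.1)//=; ring.
by rewrite (_ : _ - _ = x1.2 - y1.2)//=; ring.
Qed.

End TorusTopology.

Section CountableValues.
Variable R : realType.

Lemma lattice_countable (L : lattice R) : countable (L : set (R * R)).
Proof.
have [e [f Lef]] := latticeP L.
have -> : (L : set (R * R)) =
    (fun ij : int * int => e *~ ij.1 + f *~ ij.2) @` [set: int * int].
  apply/seteqP; split=> w.
    by move=> /(lattice_coords Lef)[i [j ->]]; exists (i, j).
  by move=> [[i j] _ <-]; apply/(lattice_coords Lef); exists i, j.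
apply: card_le_trans (card_image_le _ _) _; exact: countableP.
Qed.

(** By the intermediate value theorem the values of a nonconstant continuous
    function contain an interval, which has positive measure. *)
Lemma countable_values_constant (g : R -> R) (A : set R) : countable A ->
  continuous g -> (forall t, A (g t)) -> forall s t, g s = g t.
Proof.
move=> cA cg gA; suff H s t : s <= t -> g s = g t.
  by move=> s t; have [st|/ltW st] := leP s t; [exact: H|rewrite (H t s)].
move=> st; apply/eqP/negPn/negP => gst.
pose lo := Num.min (g s) (g t); pose hi := Num.max (g s) (g t).
have lohi : lo < hi.
  by move: gst; rewrite /lo /hi; case: (ltgtP (g s) (g t)) => // ->; rewrite eqxx.
have sub : `[lo, hi] `<=` A.
  move=> v /=; rewrite in_itv /= => hv.
  have [|c _ <-//] := IVT st _ hv.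
  exact: continuous_subspaceT.
have : countable `[lo, hi] by exact: sub_countable (subset_card_le sub) cA.
move=> /countable_lebesgue_measure0; rewrite lebesgue_measure_itv /= lte_fin lohi.
by move=> /eqP; rewrite -EFinD eqe subr_eq0 gt_eqF.
Qed.

End CountableValues.

Section Leaves.
Variables (R : realType) (L : lattice R) (h : torus L -> torus L).
Local Notation plane := (R * R)%type.
(* The two coordinates enter through c1 and c2 so that stable and unstable
   leaves are treated together; c1 is the direction contracted by G. *)
Variables (c1 c2 : plane -> R) (mk : R -> R -> plane) (G : plane -> plane) (rho La : R).
Hypotheses (c1B : forall x y, c1 (x - y) = c1 x - c1 y)
           (c2B : forall x y, c2 (x - y) = c2 x - c2 y).
Hypotheses (c1mk : forall a b, c1 (mk a b) = a) (c2mk : forall a b, c2 (mk a b) = b).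
Hypothesis c_inj : forall x y, c1 x = c1 y -> c2 x = c2 y -> x = y.
Hypotheses (c1G : forall x, c1 (G x) = rho * c1 x) (c2G : forall x, c2 (G x) = La * c2 x).
Hypotheses (rho0 : rho != 0) (rho1 : `|rho| < 1) (La1 : 1 < `|La|).
Hypothesis LG : forall x, (L : set plane) x -> (L : set plane) (G x).
Hypothesis hG : forall x x', h (proj L x) = proj L x' -> h (proj L (G x)) = proj L (G x').
Hypothesis unif : forall r, 0 < r -> exists2 s, 0 < s & forall x y x' : plane,
    `|c1 x - c1 y| < s -> `|c2 x - c2 y| < s -> h (proj L x) = proj L x' ->
    exists y', [/\ h (proj L y) = proj L y', `|c1 x' - c1 y'| < r & `|c2 x' - c2 y'| < r].
Hypothesis disc : exists2 r : R, 0 < r & forall w, (L : set plane) w ->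
    `|c1 w| < r -> `|c2 w| < r -> w = 0.
Hypothesis c1_free : forall w, (L : set plane) w -> c1 w = 0 -> w = 0.
Hypothesis c2_free : forall w, (L : set plane) w -> c2 w = 0 -> w = 0.

Lemma c1_0 : c1 0 = 0. Proof. by rewrite -(subrr 0) c1B subrr. Qed.
Lemma c2_0 : c2 0 = 0. Proof. by rewrite -(subrr 0) c2B subrr. Qed.
Lemma c1N x : c1 (- x) = - c1 x. Proof. by rewrite -sub0r c1B c1_0 sub0r. Qed.
Lemma c2N x : c2 (- x) = - c2 x. Proof. by rewrite -sub0r c2B c2_0 sub0r. Qed.
Lemma c1D x y : c1 (x + y) = c1 x + c1 y.
Proof. by rewrite -[y in LHS]opprK c1B c1N opprK. Qed.
Lemma c2D x y : c2 (x + y) = c2 x + c2 y.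
Proof. by rewrite -[y in LHS]opprK c2B c2N opprK. Qed.
Definition coordE := (c1D, c2D, c1B, c2B, c1N, c2N, c1mk, c2mk, c1_0, c2_0).

(** Two nearby points on a contracted leaf stay close under all iterates of G,
    hence so do their images; expansion in the other direction then forces the
    images onto one contracted leaf. *)
Lemma leaf_local r : 0 < r -> exists2 s, 0 < s & forall x y x' : plane,
  c2 x = c2 y -> `|c1 x - c1 y| < s -> h (proj L x) = proj L x' ->
  exists y', [/\ h (proj L y) = proj L y', c2 y' = c2 x' & `|c1 x' - c1 y'| < r].
Proof.
move=> r0; have [d d0 Hd] := disc.
have La0 : 0 < 1 + `|La| by rewrite ltr_pwDl.
pose r1 := Num.min r (d / (1 + `|La|)).
have r1r : r1 <= r by rewrite ge_min lexx.
have r1d : (1 + `|La|) * r1 <= d.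
  by rewrite mulrC -ler_pdivlMr// ge_min lexx orbT.
have r10 : 0 < r1 by rewrite lt_min r0 divr_gt0.
have [s s0 Hs] := unif r10; exists s => // x y x' xy2 xy1 hx.
have xy2' : `|c2 x - c2 y| < s by rewrite xy2 subrr normr0.
have [y' [hy n1 n2]] := Hs x y x' xy1 xy2' hx.
exists y'; split=> //; last exact: lt_le_trans n1 r1r.
pose it n z := iter n G z.
have it1 n z : c1 (it n z) = rho ^+ n * c1 z.
  by elim: n => [|n IH]; rewrite ?expr0 ?mul1r// /it iterS c1G -/(it n z) IH exprS mulrA.
have it2 n z : c2 (it n z) = La ^+ n * c2 z.
  by elim: n => [|n IH]; rewrite ?expr0 ?mul1r// /it iterS c2G -/(it n z) IH exprS mulrA.
have hit n z z' : h (proj L z) = proj L z' -> h (proj L (it n z)) = proj L (it n z').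
  by move=> hz; elim: n => //= n; exact: hG.
have near n : `|c1 (it n x') - c1 (it n y')| < r1 /\ `|c2 (it n x') - c2 (it n y')| < r1.
  elim: n => [//|n [IH1 IH2]].
  have i1 : `|c1 (it n.+1 x) - c1 (it n.+1 y)| < s.
    rewrite !it1 -mulrBr normrM; apply: le_lt_trans xy1; rewrite ler_piMl//.
    by rewrite normrX exprn_ile1// ltW.
  have i2 : `|c2 (it n.+1 x) - c2 (it n.+1 y)| < s.
    by rewrite !it2 xy2 subrr normr0.
  have [y'' [hy'' m1 m2]] := Hs _ _ _ i1 i2 (hit n.+1 _ _ hx).
  have Lw : (L : set plane) (it n.+1 y' - y'').
    by apply/projP; rewrite -hy'' (hit _ _ _ hy).
  suff /eqP : it n.+1 y' - y'' = 0 by rewrite subr_eq0 => /eqP ->.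
  have e1 : c1 (it n.+1 y') = rho * c1 (it n y') by rewrite /it iterS c1G.
  have e1' : c1 (it n.+1 x') = rho * c1 (it n x') by rewrite /it iterS c1G.
  have e2 : c2 (it n.+1 y') = La * c2 (it n y') by rewrite /it iterS c2G.
  have e2' : c2 (it n.+1 x') = La * c2 (it n x') by rewrite /it iterS c2G.
  apply: Hd => //.
    rewrite c1B (le_lt_trans (ler_distD (c1 (it n.+1 x')) _ _))//.
    apply: lt_le_trans r1d; rewrite mulrDl mul1r addrC.
    apply: ltr_leD => //; rewrite e1 e1' -mulrBr normrM distrC.
    apply: ler_pM => //; rewrite ?(ltW IH1)//; apply: ltW; apply: lt_trans rho1 La1.
  rewrite c2B (le_lt_trans (ler_distD (c2 (it n.+1 x')) _ _))//.
  apply: lt_le_trans r1d; rewrite mulrDl mul1r addrC.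
  apply: ltr_leD => //; rewrite e2 e2' -mulrBr normrM distrC.
  by apply: ler_pM => //; rewrite ?(ltW IH2).
apply/esym/eqP; rewrite -subr_eq0; apply/negPn/negP => nz.
have d20 : 0 < `|c2 x' - c2 y'| by rewrite normr_gt0.
have [|n hn] := @contract_to_zero R La^-1 r1 _ _ d20.
  by rewrite normfV invf_lt1//; move: La1; lra.
have [_] := near n; rewrite !it2 -mulrBr normrM ltNge => /negP; apply.
move: hn; rewrite normrM (gtr0_norm r10) exprVn normfV mulrC ltr_pdivrMr; last first.
  by rewrite normr_gt0 expf_neq0// -normr_gt0; move: La1; lra.
by rewrite normrX mulrC => /ltW.
Qed.

Lemma leaf_global x x' y : h (proj L x) = proj L x' -> c2 y = c2 x ->
  exists2 y', h (proj L y) = proj L y' & c2 y' = c2 x'.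
Proof.
move=> hx yx; have [s s0 Hs] := leaf_local ltr01.
have [n hn] : exists n, `|c1 x - c1 y| < n.+1%:R * s.
  exists (Num.bound (`|c1 x - c1 y| / s)); rewrite -ltr_pdivrMr//.
  apply: lt_trans (archi_boundP _) _; first by rewrite divr_ge0 ?(ltW s0).
  by rewrite ltr_nat.
elim: n x x' hx yx hn => [|n IH] x x' hx yx hn.
  rewrite mul1r in hn.
  by have [y' [hy y2 _]] := Hs x y x' (esym yx) hn hx; exists y'.
pose z := mk ((n.+1%:R * c1 x + c1 y) / n.+2%:R) (c2 x).
have n2 : n.+2%:R != 0 :> R by rewrite pnatr_eq0.
have n0 : 0 < n.+2%:R :> R by rewrite ltr0n.
have E1 : c1 x - c1 z = (c1 x - c1 y) / n.+2%:R.
  by rewrite /z c1mk; apply: (mulIf n2); rewrite mulrBl !mulfVK// -[n.+2%:R]natr1; ring.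
have E2 : c1 z - c1 y = n.+1%:R * ((c1 x - c1 y) / n.+2%:R).
  rewrite /z c1mk; apply: (mulIf n2).
  by rewrite mulrBl -[RHS]mulrA !mulfVK// -[n.+2%:R]natr1; ring.
have small : `|(c1 x - c1 y) / n.+2%:R| < s.
  by rewrite normrM normfV (gtr0_norm n0) ltr_pdivrMr// mulrC.
have xz2 : c2 x = c2 z by rewrite /z c2mk.
have xz1 : `|c1 x - c1 z| < s by rewrite E1.
have [z' [hz z2 _]] := Hs x z x' xz2 xz1 hx.
have zy1 : `|c1 z - c1 y| < n.+1%:R * s.
  by rewrite E2 normrM ger0_norm// ltr_pM2l.
have [y' hy y2] := IH z z' hz (etrans yx xz2) zy1.
by exists y' => //; rewrite y2.
Qed.

Hypothesis nontrivial : exists2 w0, (L : set plane) w0 & w0 != 0.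

Lemma small_lattice_vector r : 0 < r -> exists w,
  [/\ (L : set plane) w, c1 w != 0 & `|c1 w| < r].
Proof.
move=> r0; have [w Lw w0] := nontrivial.
have it1 n : c1 (iter n G w) = rho ^+ n * c1 w.
  by elim: n => [|n IH]; rewrite ?expr0 ?mul1r// iterS c1G IH exprS mulrA.
have Lit n : (L : set plane) (iter n G w) by elim: n => //= n; exact: LG.
have [n hn] := contract_to_zero (c1 w) rho1 r0.
exists (iter n G w); split=> //; rewrite it1 // mulf_neq0 ?expf_neq0//.
by apply: contra_neq w0; exact: c1_free.
Qed.

(* Images of expanded leaves lie on expanded leaves. *)
Hypothesis other_leaf : forall x x' y, h (proj L x) = proj L x' -> c1 y = c1 x ->
  exists2 y', h (proj L y) = proj L y' & c1 y' = c1 x'.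

(** Two points of a contracted leaf that differ by the first coordinate of a lattice
    vector lie, on the torus, on a common expanded leaf, and so do their images; as
    the lattice is countable, the displacement between the images does not depend on
    the point.  Thus the map is additive for a dense group of translations, and being
    continuous it is linear. *)
Lemma leaf_linear x x' : h (proj L x) = proj L x' -> exists a : R,
  forall t, h (proj L (x + mk t 0)) = proj L (x' + mk (a * t) 0).
Proof.
move=> hx.
have /choice[phi Hphi] : forall t, exists s,
    h (proj L (x + mk t 0)) = proj L (x' + mk s 0).
  move=> t; have [|y' hy y2] := @leaf_global x x' (x + mk t 0) hx.
    by rewrite !coordE addr0.
  exists (c1 y' - c1 x'); rewrite hy; apply: (congr1 (proj L)).
  by apply: c_inj; rewrite !coordE ?addr0 // addrC subrK.
have uniq s s' : proj L (x' + mk s 0) = proj L (x' + mk s' 0) -> s = s'.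
  move=> /projP Lw; have w2 : c2 (x' + mk s 0 - (x' + mk s' 0)) = 0.
    by rewrite !coordE subrr.
  have /(congr1 c1) := c2_free Lw w2.
  by rewrite !coordE opprD addrACA subrr add0r => /eqP; rewrite subr_eq0 => /eqP.
have mk0 : mk 0 0 = 0 by apply: c_inj; rewrite !coordE.
have phi0 : phi 0 = 0.
  by apply: uniq; rewrite -Hphi mk0 !addr0.
have ucont r : 0 < r -> exists2 s, 0 < s & forall t t', `|t - t'| < s ->
    `|phi t - phi t'| < r.
  move=> r0; have [s s0 Hs] := leaf_local r0; exists s => // t t' tt'.
  have E2 : c2 (x + mk t 0) = c2 (x + mk t' 0) by rewrite !coordE.
  have E1 : `|c1 (x + mk t 0) - c1 (x + mk t' 0)| < s.
    by rewrite !coordE opprD addrACA subrr add0r.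
  have [y' [hy y2 y1]] := Hs _ _ _ E2 E1 (Hphi t).
  suff -> : phi t' = c1 y' - c1 x' by move: y1; rewrite !coordE opprB addrA [phi t + _]addrC.
  apply: uniq; rewrite -Hphi hy; apply: (congr1 (proj L)).
  by apply: c_inj; rewrite !coordE ?y2 ?coordE ?addr0// addrC subrK.
have phi_cont : continuous phi.
  move=> t; apply/cvgrPdist_lt => r r0; have [s s0 Hs] := ucont r r0.
  by apply/nbhs_ballP; exists s => // t' tt'; exact: Hs.
have add w t : (L : set plane) w -> phi (t + c1 w) = phi t + phi (c1 w).
  move=> Lw; pose g u := phi (u + c1 w) - phi u.
  have gA u : [set c1 z | z in (L : set plane)] (g u).
    have [|y' hy y1] := @other_leaf _ _ (x + mk u (- c2 w)) (Hphi u).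
      by rewrite !coordE.
    exists ((x' + mk (phi (u + c1 w)) 0) - y').
      apply/projP; rewrite -Hphi -hy; congr (h _); apply/projP.
      rewrite (_ : _ - _ = w) //; apply: c_inj; rewrite !coordE; ring.
    by rewrite !coordE y1 !coordE /g; ring.
  have g_cont : continuous g.
    move=> u; apply: cvgB; last exact: phi_cont.
    by apply: continuous_comp; [exact: cvgD (cvg_id) (cvg_cst _) | exact: phi_cont].
  have cA : countable [set c1 z | z in (L : set plane)].
    by apply: card_le_trans (card_image_le _ _) _; exact: lattice_countable.
  have := countable_values_constant cA g_cont gA t 0.
  rewrite /g phi0 add0r subr0 => E.
  by rewrite -[LHS](subrK (phi t)) E addrC.
have [s s0 Hs] := ucont 1 ltr01.
have [w [Lw w0 ws]] := small_lattice_vector s0.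
set b := c1 w in w0 ws; pose a := phi b / b.
pose xi t := phi t - a * t.
have xi_add z t : (L : set plane) z -> xi (t + c1 z) = xi t + xi (c1 z).
  by move=> Lz; rewrite /xi add// mulrDr; ring.
have xi_mz z t i : (L : set plane) z -> xi (t + c1 z * i%:~R) = xi t + xi (c1 z) * i%:~R.
  move=> Lz.
  have pos (n : nat) u : xi (u + c1 z * n%:R) = xi u + xi (c1 z) * n%:R.
    elim: n => [|n IH]; first by rewrite !mulr0 !addr0.
    by rewrite -natr1 [c1 z * _]mulrDr mulr1 addrA xi_add// IH mulrDr mulr1 [RHS]addrA.
  case: i => n; first exact: pos.
  rewrite NegzE !mulrNz !mulrN; have := pos n.+1 (t - c1 z * n.+1%:R).
  by rewrite subrK => ->; rewrite -pmulrn addrK.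
have xi_b : xi b = 0 by rewrite /xi /a mulfVK// subrr.
have near_lattice z t : (L : set plane) z -> c1 z != 0 -> exists i : int,
    `|t - c1 z * i%:~R| <= `|c1 z|.
  move=> Lz z0; exists (Num.floor (t / c1 z)).
  have := floor_itv (t / c1 z); rewrite intrD => /andP[f1 f2].
  have -> : t - c1 z * (Num.floor (t / c1 z))%:~R =
    c1 z * (t / c1 z - (Num.floor (t / c1 z))%:~R).
    by rewrite mulrBr mulrCA mulfV ?mulr1.
  rewrite normrM ler_piMr// ler_norml; lra.
pose B := 1 + `|a| * `|b|.
have xi_bounded t : `|xi t| <= B.
  have [i hi] := near_lattice w t Lw w0.
  have -> : xi t = xi (t - b * i%:~R).
    have := xi_mz w (t - b * i%:~R) i Lw; rewrite -/b subrK => ->.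
    by rewrite xi_b mul0r addr0.
  rewrite /xi; apply: le_trans (ler_normB _ _) _; apply: lerD.
    rewrite -[X in `|X|]subr0 -phi0; apply/ltW/Hs; rewrite subr0.
    exact: le_lt_trans hi ws.
  by rewrite normrM ler_wpM2l.
have xi_lattice z : (L : set plane) z -> xi (c1 z) = 0.
  move=> Lz; apply/eqP/negPn/negP => nz.
  have nz0 : 0 < `|xi (c1 z)| by rewrite normr_gt0.
  have xi0 : xi 0 = 0 by rewrite /xi phi0 mulr0 subr0.
  pose n := Num.bound (B / `|xi (c1 z)|).
  have := xi_bounded (0 + c1 z * (n : int)%:~R).
  rewrite xi_mz// xi0 add0r normrM leNgt => /negP; apply.
  rewrite mulrC -ltr_pdivrMr//; apply: lt_le_trans (archi_boundP _) _.
    by rewrite divr_ge0// ?(ltW nz0)// addr_ge0// mulr_ge0.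
  by rewrite -/n -[(n : int)%:~R]/(n%:R) ger0_norm.
exists a => t; suff xit : xi t = 0.
  by rewrite Hphi; move/eqP: xit; rewrite subr_eq0 => /eqP ->.
apply/eqP/negPn/negP => nz.
have nz0 : 0 < `|xi t| / 2 by rewrite divr_gt0// normr_gt0.
have [d d0 Hd] := ucont _ nz0.
have a1 : 0 < 1 + `|a| by rewrite ltr_pwDl.
have [|z [Lz z0]] := @small_lattice_vector (Num.min d (`|xi t| / 2 / (1 + `|a|))).
  by rewrite lt_min d0 divr_gt0.
rewrite lt_min => /andP[zd za].
have [i hi] := near_lattice z t Lz z0.
have E : xi t = xi (t - c1 z * i%:~R).
  have := xi_mz z (t - c1 z * i%:~R) i Lz; rewrite subrK => ->.
  by rewrite xi_lattice// mul0r addr0.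
set u := t - c1 z * i%:~R in hi E.
have p1 : `|phi u| < `|xi t| / 2.
  by rewrite -[X in `|X|]subr0 -phi0; apply: Hd; rewrite subr0; exact: le_lt_trans hi zd.
have p2 : `|a * u| <= `|xi t| / 2.
  rewrite ltr_pdivlMr// in za; apply: ltW; apply: le_lt_trans za.
  rewrite normrM [leRHS]mulrC; apply: ler_pM => //; lra.
have := ler_normB (phi u) (a * u); rewrite -/(xi u) -E; lra.
Qed.

End Leaves.

Section Centralizer.
Variables (R : realType) (L : lattice R) (mu lambda : R).
Local Notation plane := (R * R)%type.
Local Notation D := (diag_map mu lambda).
Local Notation Dinv := (diag_map mu^-1 lambda^-1).
Hypothesis hypD : hyperbolic_automorphism L mu lambda.

(** The linear parts that act on the torus and the translation parts that are
    compatible with D. *)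
Definition affine_data (a b : R) (c : plane) : Prop :=
  [/\ a != 0, b != 0,
      forall x, (L : set plane) (diag_map a b x) <-> (L : set plane) x &
      (L : set plane) (D c - c)].

Lemma centralizer_lift (h : torus L -> torus L) : centralizer L mu lambda h ->
  (forall x x', h (proj L x) = proj L x' -> h (proj L (D x)) = proj L (D x')) /\
  (forall x x', h (proj L x) = proj L x' -> h (proj L (Dinv x)) = proj L (Dinv x')).
Proof.
move=> [_ comm].
have fwd x x' : h (proj L x) = proj L x' -> h (proj L (D x)) = proj L (D x').
  move=> hx; have := congr1 (fun F => F (proj L x)) comm => /=.
  by rewrite toral_mapE// => ->; rewrite hx toral_mapE.
split=> // x x' hx; have [y hy] := proj_surj (h (proj L (Dinv x))).
have DK z : D (Dinv z) = z.
  by apply: plane_eqP; rewrite /= mulVKf ?(mu_neq0 hypD) ?(lambda_neq0 hypD).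
have := fwd _ _ hy; rewrite DK hx => /projP /(lattice_diagV hypD) Lw.
rewrite hy; apply/projP; rewrite -opprB; apply: latticeN.
by move: Lw; rewrite diag_mapB diag_mapK ?(mu_neq0 hypD) ?(lambda_neq0 hypD).
Qed.

(** The homeomorphism is linear along stable and unstable leaves, and the slopes are
    the same on all leaves since lattice vectors are mapped to lattice vectors. *)
Lemma centralizer_affine (h : torus L -> torus L) : centralizer L mu lambda h ->
  exists a b c, affine_data a b c /\
    forall x, h (proj L x) = proj L (diag_map a b x + c).
Proof.
move=> /[dup] /centralizer_lift[hD hDi] [[hc [g [gc hK gK]]] _].
have [_ la1 mE] := hypD.
have mu0 := mu_neq0 hypD; have la0 := lambda_neq0 hypD; have mu1 := norm_mu_lt1 hypD.
have nontriv : exists2 w0 : plane, (L : set plane) w0 & w0 != 0.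
  have [e [f Lef]] := latticeP L; exists e; first exact: basis_fst Lef.
  by apply: contra_neq (basis_cross Lef) => ->; rewrite !mul0r subrr.
have [r r0 disc] := lattice_discrete L.
have hor x x' y : h (proj L x) = proj L x' -> y.2 = x.2 ->
    exists2 y', h (proj L y) = proj L y' & y'.2 = x'.2.
  apply: (@leaf_global _ L h fst snd pair D mu lambda) => //.
  - by move=> s s0; exact: torus_unif_continuous.
  - by exists r.
have ver x x' y : h (proj L x) = proj L x' -> y.1 = x.1 ->
    exists2 y', h (proj L y) = proj L y' & y'.1 = x'.1.
  apply: (@leaf_global _ L h snd fst (fun u v => (v, u)) Dinv lambda^-1 mu^-1) => //.
  - by rewrite normfV invf_lt1 ?normr_gt0//.
  - by rewrite normfV invf_gt1 ?normr_gt0//.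
  - move=> s s0; have [s' s'0 H] := torus_unif_continuous hc s0.
    exists s' => // u v u' h1 h2 hu; have [v' [? ? ?]] := H u v u' h2 h1 hu.
    by exists v'.
  - by exists r => // w Lw h1 h2; exact: disc.
have linh x x' : h (proj L x) = proj L x' -> exists a : R,
    forall t, h (proj L (x + (t, 0))) = proj L (x' + (a * t, 0)).
  apply: (@leaf_linear _ L h fst snd pair D mu lambda) => //.
  - by move=> ? ? ? ?; exact: plane_eqP.
  - exact: lattice_diag hypD.
  - by move=> s s0; exact: torus_unif_continuous.
  - by exists r.
  - exact: lattice_fst_eq0 hypD.
  - exact: lattice_snd_eq0 hypD.
have linv x x' : h (proj L x) = proj L x' -> exists a : R,
    forall t, h (proj L (x + (0, t))) = proj L (x' + (0, a * t)).
  apply: (@leaf_linear _ L h snd fst (fun u v => (v, u)) Dinv lambda^-1 mu^-1) => //.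
  - by move=> ? ? ? ?; exact: plane_eqP.
  - by rewrite invr_eq0.
  - by rewrite normfV invf_lt1 ?normr_gt0//.
  - by rewrite normfV invf_gt1 ?normr_gt0//.
  - exact: lattice_diagV hypD.
  - move=> s s0; have [s' s'0 H] := torus_unif_continuous hc s0.
    exists s' => // u v u' h1 h2 hu; have [v' [? ? ?]] := H u v u' h2 h1 hu.
    by exists v'.
  - by exists r => // w Lw h1 h2; exact: disc.
  - exact: lattice_snd_eq0 hypD.
  - exact: lattice_fst_eq0 hypD.
have [c hc0] := proj_surj (h (proj L 0)).
have [a ha] := linh 0 c hc0.
have /choice[bt hb] : forall t, exists b : R, forall s,
    h (proj L (t, s)) = proj L (c + (a * t, b * s)).
  move=> t; have := ha t; rewrite add0r => /linv[b hb]; exists b => s.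
  have := hb s; rewrite (_ : (t, 0) + (0, s) = (t, s)); last first.
    by apply: plane_eqP; rewrite /= ?addr0 ?add0r.
  move=> ->; apply: (congr1 (proj L)); apply: plane_eqP; rewrite /=; ring.
have Lt w t : (L : set plane) w -> (L : set plane) (a * w.1, bt t * w.2).
  move=> Lw; have := ha (t + w.1); rewrite add0r.
  have -> : proj L (t + w.1, 0) = proj L (t, - w.2).
    apply/projP; rewrite (_ : _ - _ = w)//; apply: plane_eqP; rewrite /=; ring.
  rewrite hb => /esym/projP; rewrite (_ : _ - _ = (a * w.1, bt t * w.2))//.
  by apply: plane_eqP; rewrite /=; ring.
have [w0 Lw0 w0n] := nontriv.
have w02 : w0.2 != 0 by apply: contra_neq w0n; exact: (lattice_snd_eq0 hypD).
have btE t : bt t = bt 0.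
  have /(congr1 snd) /= := lattice_eq_fst hypD (Lt w0 t Lw0) (Lt w0 0 Lw0) erefl.
  by move=> /(mulIf w02).
set b := bt 0 in btE.
have hE x : h (proj L x) = proj L (diag_map a b x + c).
  by case: x => t s; rewrite hb btE addrC.
have inj x y : proj L (diag_map a b x + c) = proj L (diag_map a b y + c) ->
    proj L x = proj L y.
  by rewrite -!hE; exact: (can_inj hK).
have a0 : a != 0.
  apply/eqP => a0; have /inj/projP : proj L (diag_map a b (1, 0) + c) =
      proj L (diag_map a b 0 + c).
    by rewrite a0 /diag_map /= !mul0r !mulr0.
  move=> /(lattice_snd_eq0 hypD) /(_ _) => /(_ (subrr _)) /(congr1 fst) /= /eqP.
  by rewrite subr0 oner_eq0.
have b0 : b != 0.
  apply/eqP => b0; have /inj/projP : proj L (diag_map a b (0, 1) + c) =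
      proj L (diag_map a b 0 + c).
    by rewrite b0 /diag_map /= !mul0r !mulr0.
  move=> /(lattice_fst_eq0 hypD) /(_ _) => /(_ (subrr _)) /(congr1 snd) /= /eqP.
  by rewrite subr0 oner_eq0.
exists a, b, c; split=> //; split=> //.
- move=> x; split=> Lx; last by have := Lt x 0 Lx.
  have /inj/projP : proj L (diag_map a b x + c) = proj L (diag_map a b 0 + c).
    apply/projP; rewrite (_ : _ - _ = diag_map a b x)//.
    by apply: plane_eqP; rewrite /=; ring.
  by rewrite subr0.
- apply/projP; rewrite -hc0 -(hD _ _ hc0); congr (h (proj L _)).
  by apply: plane_eqP; rewrite /= mulr0.
Qed.

Lemma diag_continuous (a b : R) (c : plane) :
  continuous (fun x : plane => diag_map a b x + c).
Proof.
move=> x A /plane_nbhsP[r r0 H]; apply/plane_nbhsP.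
have B0 : 0 < 1 + `|a| + `|b| by have := normr_ge0 a; have := normr_ge0 b; lra.
exists (r / (1 + `|a| + `|b|)); first exact: divr_gt0.
move=> y; rewrite !ltr_pdivlMr// => h1 h2; apply: H => /=; rewrite opprD addrACA subrr
  addr0 -mulrBr normrM mulrC.
  by apply: le_lt_trans h1; rewrite ler_wpM2l//; have := normr_ge0 b; lra.
by apply: le_lt_trans h2; rewrite ler_wpM2l//; have := normr_ge0 a; lra.
Qed.

Definition torus_affine (a b : R) (c : plane) (X : torus L) : torus L :=
  proj L (diag_map a b (repr X) + c).

Lemma torus_affineE a b c x :
  (forall w, (L : set plane) w -> (L : set plane) (diag_map a b w)) ->
  torus_affine a b c (proj L x) = proj L (diag_map a b x + c).
Proof.
move=> H; apply/projP; set r := repr _.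
rewrite (_ : _ - _ = diag_map a b (r - x)).
  by apply: H; apply/projP; rewrite /r /proj reprK.
by apply: plane_eqP; rewrite /=; ring.
Qed.

Lemma torus_affine_continuous a b c :
  (forall w, (L : set plane) w -> (L : set plane) (diag_map a b w)) ->
  continuous (torus_affine a b c).
Proof.
move=> H; apply/quotient_continuous.
rewrite (_ : _ \o _ = proj L \o (fun x => diag_map a b x + c)); last first.
  by apply/funext => x; exact: torus_affineE.
move=> x; apply: continuous_comp; first exact: diag_continuous.
exact: proj_continuous.
Qed.

Lemma affine_centralizer a b c : affine_data a b c ->
  exists h, centralizer L mu lambda h /\
    forall x, h (proj L x) = proj L (diag_map a b x + c).
Proof.
move=> [a0 b0 abL Lc]; exists (torus_affine a b c).
have fwd w : (L : set plane) w -> (L : set plane) (diag_map a b w) by move/abL.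
have bwd w : (L : set plane) w -> (L : set plane) (diag_map a^-1 b^-1 w).
  move=> Lw; apply/abL; rewrite (_ : diag_map a b _ = w)//.
  by apply: plane_eqP; rewrite /= mulVKf.
split; last by move=> x; exact: torus_affineE.
split.
  split; first exact: torus_affine_continuous.
  exists (torus_affine a^-1 b^-1 (- diag_map a^-1 b^-1 c)); split.
  - exact: torus_affine_continuous.
  - move=> X; have [x ->] := proj_surj X; rewrite !torus_affineE//.
    apply: (congr1 (proj L)); apply: plane_eqP; rewrite /= mulrDr mulKf//; ring.
  - move=> X; have [x ->] := proj_surj X; rewrite !torus_affineE//.
    apply: (congr1 (proj L)); apply: plane_eqP; rewrite /= mulrBr !mulVKf//; ring.
apply/funext => X; have [x ->] := proj_surj X.
rewrite /= (toral_mapE hypD) !torus_affineE// (toral_mapE hypD).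
apply/projP; rewrite (_ : _ - _ = - (D c - c)); first exact: latticeN.
by apply: plane_eqP; rewrite /=; ring.
Qed.

End Centralizer.

(** * Equivalence of Berg partitions *)

Section Equivalence.
Variables (R : realType) (L : lattice R) (mu lambda : R).
Local Notation plane := (R * R)%type.
Local Notation D := (diag_map mu lambda).
Local Notation equiv := (@berg_equiv R L mu lambda).

Lemma berg_equiv_sym A B : equiv A B -> equiv B A.
Proof.
move=> [h [[[hc [g [gc hK gK]]] comm] <-]].
exists g; split.
  split; first by split=> //; exists h.
  apply/funext => X; have := congr1 (fun F => g (F (g X))) comm.
  by rewrite /= hK gK => ->.
apply/seteqP; split=> X.
  move=> [_ [Y AY <-] <-]; rewrite image_comp.
  by rewrite (_ : g \o h = id) ?image_id//; exact/funext.
move=> AX; exists (h @` X); first by exists X.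
by rewrite image_comp (_ : g \o h = id) ?image_id//; exact/funext.
Qed.

Lemma berg_equiv_trans A B C : equiv A B -> equiv B C -> equiv A C.
Proof.
move=> [h [[[hc [g [gc hK gK]]] comm] <-]] [h' [[[hc' [g' [gc' hK' gK']]] comm'] <-]].
exists (h' \o h); split.
  split; last by rewrite -compA comm [LHS]compA comm'.
  split; first by move=> x; apply: continuous_comp; [exact: hc|exact: hc'].
  exists (g \o g'); split.
  - by move=> x; apply: continuous_comp; [exact: gc'|exact: gc].
  - exact: can_comp.
  - exact: can_comp.
apply/seteqP; split=> X.
  by move=> [Y AY <-]; exists (h @` Y); [exists Y|rewrite image_comp].
by move=> [_ [Y AY <-] <-]; exists Y => //; rewrite image_comp.
Qed.

Lemma rectE (P : bipartition L) i x : rect P i x <->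
  box (tile_lower (bp_e P) (bp_f P) i) (tile_upper (bp_e P) (bp_f P) i)
      (x - bp_shift P).
Proof.
rewrite /rect /box /=; split=> -[].
  by move=> /xsideE h1 /ysideE h2; split; lra.
by move=> h1 h2; split; [apply/xsideE; lra | apply/ysideE; lra].
Qed.

Lemma proj_rectE (P : bipartition L) i y :
  (proj L @` rect P i) (proj L (y + bp_shift P)) <->
  translates L (box (tile_lower (bp_e P) (bp_f P) i)
                    (tile_upper (bp_e P) (bp_f P) i)) y.
Proof.
split=> [[x /rectE bx /esym/projP Lx]|[w Lw bx]].
  exists (y + bp_shift P - x) => //.
  by rewrite (_ : _ - _ = x - bp_shift P)//; apply: plane_eqP; rewrite /=; ring.
exists (y - w + bp_shift P); first by apply/rectE; rewrite addrK.
apply/projP; rewrite (_ : _ - _ = - w); first exact: latticeN.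
by apply: plane_eqP; rewrite /=; ring.
Qed.

Lemma pieces_image (P P' : bipartition L) (h : torus L -> torus L)
    (A : plane -> plane) (sigma : 'I_2 -> 'I_2) :
  (forall x, h (proj L x) = proj L (A x)) -> (forall y, exists x, A x = y) ->
  (forall j, exists i, sigma i = j) ->
  (forall i, exists2 w, (L : set plane) w &
     forall x, rect P i x <-> rect P' (sigma i) (A x + w)) ->
  [set h @` X | X in pieces P] = pieces P'.
Proof.
move=> hA surjA surjs H.
have E i : h @` (proj L @` rect P i) = proj L @` rect P' (sigma i).
  have [w Lw Hw] := H i; apply/seteqP; split=> Y.
    move=> [_ [x Px <-] <-]; rewrite hA; exists (A x + w); first exact/Hw.
    exact: proj_add.
  move=> [y Py <-]; have [x xE] := surjA (y - w); exists (proj L x).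
    by exists x => //; apply/Hw; rewrite xE subrK.
  by rewrite hA xE proj_add//; exact: latticeN.
apply/seteqP; split=> Z.
  by move=> [_ [i _ <-] <-]; exists (sigma i) => //; rewrite E.
move=> [j _ <-]; have [i <-] := surjs j.
by exists (proj L @` rect P i); [exists i|rewrite E].
Qed.

End Equivalence.

Section Index.
Variables (R : realType) (L : lattice R) (mu lambda : R).
Local Notation plane := (R * R)%type.
Local Notation D := (diag_map mu lambda).
Hypothesis hypD : hyperbolic_automorphism L mu lambda.

Definition acts_by (e f : plane) (k l m n : nat) : Prop :=
  D e = (e *~ k + f *~ l) *~ sgz lambda /\ D f = (e *~ m + f *~ n) *~ sgz lambda.

Lemma acts_by_swap e f k l m n : acts_by e f k l m n -> acts_by f e n m l k.
Proof. by move=> [h1 h2]; split; rewrite ?h1 ?h2 addrC. Qed.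

Lemma mulrz_sgz_inj : injective (fun x : plane => x *~ sgz lambda).
Proof.
move=> x y /=; have := lambda_neq0 hypD.
have [l0|l0|->] // := ltgtP lambda 0.
  by rewrite ltr0_sgz// !mulrN1z => _ /oppr_inj.
by rewrite gtr0_sgz// !mulr1z.
Qed.

Lemma mx22E (T : Type) (k l m n : T) :
  [/\ mx22 k l m n 0 0 = k, mx22 k l m n 0 1 = l, mx22 k l m n 1 0 = m &
      mx22 k l m n 1 1 = n].
Proof. by rewrite !mxE. Qed.

(** The crossing numbers are the coordinates, up to the sign of lambda, of the images
    of the basis vectors; the two orderings of the rectangles are the two orderings of
    the basis. *)
Lemma connectivityP (P : bipartition L) (k l m n : nat) : is_berg mu lambda P ->
  (exists s, connectivity_matrix mu lambda P s (mx22 k l m n)) <->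
  acts_by (bp_e P) (bp_f P) k l m n \/ acts_by (bp_f P) (bp_e P) k l m n.
Proof.
move=> bP; have /choice[N HN] := fun i => berg_crossings hypD i bP.
have Lef := bp_basis P.
have cr i j q : crossed_translates mu lambda P i j #= `I_q <-> q = N i j.
  have [H _] := HN i; split=> [h|->]; last exact: H.
  by apply/card_eq_II; apply: card_eq_trans (H j); rewrite card_eq_sym.
have act k' l' m' n' : acts_by (bp_e P) (bp_f P) k' l' m' n' <->
    [/\ k' = N 0 0, l' = N 0 1, m' = N 1 0 & n' = N 1 1].
  have [[_ E0] [_ E1]] := (HN 0, HN 1).
  rewrite /tile_step /= in E0 E1; rewrite /acts_by E0 E1; split.
    move=> [/mulrz_sgz_inj /(basis_coords_inj Lef)[[->] [->]]].
    by move=> /mulrz_sgz_inj /(basis_coords_inj Lef)[[->] [->]].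
  by move=> [-> -> -> ->].
have [c00 c01 c10 c11] := mx22E k l m n.
split.
  move=> [s Hs]; have H i j := (cr _ _ _).1 (Hs i j).
  have H00 := H 0 0; have H01 := H 0 1; have H10 := H 1 0; have H11 := H 1 1.
  rewrite c00 in H00; rewrite c01 in H01; rewrite c10 in H10; rewrite c11 in H11.
  have [s0|s0] := ord2_cases (s 0); have [s1|s1] := ord2_cases (s 1).
  - by have /perm_inj := etrans s0 (esym s1).
  - by left; apply/act; rewrite H00 H01 H10 H11 s0 s1.
  - by right; apply/acts_by_swap/act; rewrite H00 H01 H10 H11 s0 s1.
  - by have /perm_inj := etrans s0 (esym s1).
case=> [/act[h1 h2 h3 h4]|/acts_by_swap/act[h1 h2 h3 h4]].
  exists 1%g => i j; apply/cr; rewrite !perm1.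
  by have [->|->] := ord2_cases i; have [->|->] := ord2_cases j;
    rewrite ?c00 ?c01 ?c10 ?c11.
exists (tperm 0 1) => i j; apply/cr.
by have [->|->] := ord2_cases i; have [->|->] := ord2_cases j;
  rewrite ?tpermL ?tpermR ?c00 ?c01 ?c10 ?c11.
Qed.

End Index.

Section OffsetIndex.
Variables (R : realType) (L : lattice R) (mu lambda : R).
Local Notation plane := (R * R)%type.
Local Notation D := (diag_map mu lambda).
Hypothesis hypD : hyperbolic_automorphism L mu lambda.
Variables (k l m n : nat).
Hypotheses (l_gt0 : (0 < l)%N) (m_gt0 : (0 < m)%N).
Local Notation S := (k + l + m + n)%N.

Definition has_action (P : bipartition L) : Prop :=
  acts_by mu lambda (bp_e P) (bp_f P) k l m n \/
  acts_by mu lambda (bp_f P) (bp_e P) k l m n.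

(** The offset of a Berg partition is a lattice vector; the sum of its coordinates,
    counted from its smallest possible value, does not depend on the order of the
    basis and classifies the partition. *)
Definition berg_index (P : bipartition L) (N : int) : Prop :=
  exists w i j, berg_data mu lambda P w (bp_e P *~ i + bp_f P *~ j) /\
    N = i + j - offset_base lambda S.

Lemma has_action_ordered (P : bipartition L) : has_action P ->
  exists k' l' m' n', [/\ (0 < l')%N, (0 < m')%N, (k' + l' + m' + n')%N = S &
    acts_by mu lambda (bp_e P) (bp_f P) k' l' m' n'].
Proof.
case=> h; first by exists k, l, m, n; split.
exists n, m, l, k; split=> //; last exact: acts_by_swap.
by clear; lia.
Qed.

Lemma berg_index_ex (P : bipartition L) : is_berg mu lambda P ->
  exists N, berg_index P N.
Proof.
move=> /(is_bergP hypD)[w [tau H]].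
have [i [j E]] : exists i j, tau = bp_e P *~ i + bp_f P *~ j.
  by apply/(lattice_coords (bp_basis P)); case: H.
by exists (i + j - offset_base lambda S), w, i, j; rewrite -E.
Qed.

Lemma berg_index_range (P : bipartition L) N : has_action P -> berg_index P N ->
  0 <= N <= S%:Z - 2.
Proof.
move=> /has_action_ordered[k' [l' [m' [n' [l0 m0 SE [De Df]]]]]].
move=> [w [i [j [[_ _ _ vx vy] ->]]]]; rewrite -SE.
have [e1 e2] := bp_e_quadrant P; have [f1 f2] := bp_f_quadrant P.
exact: (offset_index_range hypD e1 e2 f1 f2 l0 m0 De Df).
Qed.

(** As mu differs from 1, a horizontal translation produces any offset. *)
Lemma berg_index_realized (e f : plane) N : lattice_basis L e f ->
  0 < e.1 /\ 0 < e.2 -> f.1 < 0 /\ 0 < f.2 ->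
  (acts_by mu lambda e f k l m n \/ acts_by mu lambda f e k l m n) ->
  0 <= N <= S%:Z - 2 ->
  exists P : bipartition L, [/\ bp_e P = e, bp_f P = f, is_berg mu lambda P &
    berg_index P N].
Proof.
move=> Lef He Hf act hN.
have [k' [l' [m' [n' [l0 m0 SE [De Df]]]]]] :=
  has_action_ordered (P := Bipartition 0 Lef He Hf) act.
case: (He) => e1 e2; case: (Hf) => f1 f2; rewrite -SE in hN.
have [i [j [[vx vy] ijE]]] := offset_index_surj hypD Lef e1 e2 f1 f2 l0 m0 De Df hN.
have mu1 : mu - 1 != 0.
  by rewrite subr_eq0; apply: contraTneq (norm_mu_lt1 hypD) => ->; rewrite normr1 ltxx.
pose P := Bipartition ((e *~ i + f *~ j).1 / (mu - 1), 0) Lef He Hf.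
have bd : berg_data mu lambda P 0 (e *~ i + f *~ j).
  split=> //; first exact: lattice0.
    by apply/(lattice_coords Lef); exists i, j.
  by apply: plane_eqP; rewrite /=; field.
exists P; split=> //; first by apply/(is_bergP hypD); exists 0, (e *~ i + f *~ j).
by exists 0, i, j; split=> //; rewrite ijE -SE addrK.
Qed.

(** The first row of the matrix expresses g' through g and D g; as D is diagonal
    and l nonzero, each coordinate of g' is a fixed multiple of that of g. *)
Lemma common_diagonal (g g' h h' : plane) : g.1 != 0 -> g.2 != 0 ->
  D g = (g *~ k + g' *~ l) *~ sgz lambda ->
  D h = (h *~ k + h' *~ l) *~ sgz lambda ->
  exists a b, diag_map a b g = h /\ diag_map a b g' = h'.
Proof.
move=> g1 g2 Dg Dh; exists (h.1 / g.1), (h.2 / g.2); split=> //.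
  by apply: plane_eqP; rewrite /= mulfVK.
have s0 : (sgz lambda)%:~R != 0 :> R by rewrite intr_eq0 sgz_eq0 (lambda_neq0 hypD).
have l0 : l%:~R != 0 :> R by rewrite intr_eq0; clear -l_gt0; lia.
have ls0 := mulf_neq0 l0 s0.
have G1 := congr1 fst Dg; have G2 := congr1 snd Dg.
have H1 := congr1 fst Dh; have H2 := congr1 snd Dh.
rewrite fst_mulrz fst_comb /= in G1; rewrite snd_mulrz snd_comb /= in G2.
rewrite fst_mulrz fst_comb /= in H1; rewrite snd_mulrz snd_comb /= in H2.
have key (t x x' y y' : R) : x != 0 ->
    t * x = (x * k%:~R + x' * l%:~R) * (sgz lambda)%:~R ->
    t * y = (y * k%:~R + y' * l%:~R) * (sgz lambda)%:~R -> y / x * x' = y'.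
  move=> x0 E1 E2; apply: (mulIf x0); apply: (mulIf ls0).
  have -> : y / x * x' * x = y * x' by field.
  by have := congr1 ( *%R y) E1; have := congr1 ( *%R x) E2; lra.
by apply: plane_eqP; rewrite /=; apply: key; eassumption.
Qed.

Lemma diag_basis_lattice (a b : R) (e f : plane) : lattice_basis L e f ->
  lattice_basis L (diag_map a b e) (diag_map a b f) ->
  forall x, (L : set plane) (diag_map a b x) <-> (L : set plane) x.
Proof.
move=> Lef Lef'; have C i j : diag_map a b (e *~ i + f *~ j) =
    diag_map a b e *~ i + diag_map a b f *~ j.
  by rewrite diag_mapD !diag_mapMz.
have [a0 b0] : a != 0 /\ b != 0.
  by have H := basis_cross Lef'; split; apply: contra_neq H => -> /=; ring.
move=> x; split=> [/(lattice_coords Lef')[i [j]]|/(lattice_coords Lef)[i [j ->]]].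
  rewrite -C => /(can_inj (diag_mapK a0 b0)) ->.
  by apply/(lattice_coords Lef); exists i, j.
by rewrite C; apply/(lattice_coords Lef'); exists i, j.
Qed.

Lemma lattice_basisC (e f : plane) : lattice_basis L e f -> lattice_basis L f e.
Proof.
move=> [ind E]; split=> [a b h|].
  by have [] := ind b a; [rewrite addrC|split].
rewrite E; apply/seteqP; split=> x [i [j ->]]; exists j, i; exact: addrC.
Qed.


Lemma equiv_of_affine (P P' : bipartition L) (a b : R) (c : plane)
    (sigma : 'I_2 -> 'I_2) :
  affine_data L mu lambda a b c -> (forall j, exists i, sigma i = j) ->
  (forall i, exists2 w, (L : set plane) w &
     forall x, rect P i x <-> rect P' (sigma i) (diag_map a b x + c + w)) ->
  berg_equiv mu lambda (pieces P) (pieces P').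
Proof.
move=> abc surj H; have [h [hC hE]] := affine_centralizer hypD abc.
exists h; split=> //; apply: pieces_image hE _ surj H => y.
case: abc => a0 b0 _ _; exists (diag_map a^-1 b^-1 (y - c)).
by apply: plane_eqP; rewrite /= mulVKf// subrK.
Qed.

Definition swap2 (i : 'I_2) : 'I_2 := if i == 0 then 1 else 0.

Lemma swap2K : involutive swap2.
Proof. by move=> i; have [->|->] := ord2_cases i. Qed.

Lemma diag_box (a b : R) (c d x c' d' : plane) : a != 0 -> 0 < b ->
  c' = image_corner a b 0 c d -> d' = image_corner a b 0 d c ->
  box c d x <-> box c' d' (diag_map a b x).
Proof.
move=> a0 b0 -> ->; have [h1 h2] := box_image a0 (lt0r_neq0 b0) 0 c d x.
by rewrite addr0 in h1 h2; split.
Qed.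

Lemma valid_y_scale (e f e' f' : plane) (b t : R) : 0 < b ->
  e'.2 + f'.2 = b * (e.2 + f.2) -> valid_y lambda e f t -> valid_y lambda e' f' (b * t).
Proof.
move=> b0 E v y; rewrite E => /andP[y0 y1].
have [|y' /andP[y'0 y'1] yE] := v (y / b).
  by rewrite divr_ge0 ?(ltW b0)//= ler_pdivrMr// mulrC.
exists (b * y'); first by rewrite mulr_ge0 ?(ltW b0)//= ler_pM2l.
by rewrite mulrCA -yE mulrDr mulrCA mulfV ?mulr1// lt0r_neq0.
Qed.

Lemma valid_x_scale (e f e' f' : plane) (a s : R) :
  (0 < a /\ e'.1 = a * e.1 /\ f'.1 = a * f.1) \/
  (a < 0 /\ e'.1 = a * f.1 /\ f'.1 = a * e.1) ->
  valid_x mu e f s -> valid_x mu e' f' (a * s).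
Proof.
by move=> [[a0 [E F]]|[a0 [E F]]]; rewrite /valid_x E F =>
  -[/andP[? ?] /andP[? ?]]; split; apply/andP; split; nra.
Qed.

(** Two bi-partitions in which D acts by the same matrix differ by a diagonal
    linear map, which commutes with D.  It carries offsets to offsets and keeps
    the sum of their coordinates. *)
Lemma same_index_equiv (P P' : bipartition L) N : has_action P -> has_action P' ->
  berg_index P N -> berg_index P' N -> berg_equiv mu lambda (pieces P) (pieces P').
Proof.
move=> act act' [w [i [j [bd NE]]]] [w' [i' [j' [bd' NE']]]].
have [e1 e2] := bp_e_quadrant P; have [f1 f2] := bp_f_quadrant P.
have [e1' e2'] := bp_e_quadrant P'; have [f1' f2'] := bp_f_quadrant P'.
have Lef := bp_basis P; have Lef' := bp_basis P'.
set e := bp_e P in bd e1 e2 Lef *; set f := bp_f P in bd f1 f2 Lef *.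
set e' := bp_e P' in bd' e1' e2' Lef' *; set f' := bp_f P' in bd' f1' f2' Lef' *.
have ij : i + j = i' + j' by move: NE; rewrite NE'; clear; lia.
have [Lw Lt Ez vx vy] := bd; have [Lw' Lt' Ez' vx' vy'] := bd'.
have center (a b : R) : (forall x, (L : set plane) (diag_map a b x) <-> (L : set plane) x) ->
    a * (e *~ i + f *~ j).1 = (e' *~ i' + f' *~ j').1 -> a != 0 -> b != 0 ->
    affine_data L mu lambda a b (bp_shift P' - diag_map a b (bp_shift P)).
  move=> abL tE a0 b0; split=> //.
  rewrite (_ : _ - _ = w' - diag_map a b w).
    by apply: latticeB => //; apply/abL.
  have z1 : mu * (bp_shift P).1 - (bp_shift P).1 = w.1 + (e *~ i + f *~ j).1 :=
    congr1 fst Ez.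
  have z1' : mu * (bp_shift P').1 - (bp_shift P').1 = w'.1 + (e' *~ i' + f' *~ j').1 :=
    congr1 fst Ez'.
  have z2 : lambda * (bp_shift P).2 - (bp_shift P).2 = w.2 + 0 := congr1 snd Ez.
  have z2' : lambda * (bp_shift P').2 - (bp_shift P').2 = w'.2 + 0 := congr1 snd Ez'.
  rewrite -tE in z1'; have az1 := congr1 ( *%R a) z1; have bz2 := congr1 ( *%R b) z2.
  by apply: plane_eqP; rewrite /=; lra.
have oriented : exists a b,
    (diag_map a b e = e' /\ diag_map a b f = f') \/
    (diag_map a b e = f' /\ diag_map a b f = e').
  have [e1n e2n f1n f2n] : [/\ e.1 != 0, e.2 != 0, f.1 != 0 & f.2 != 0].
    by split; rewrite ?(gt_eqF e1) ?(gt_eqF e2) ?(lt_eqF f1) ?(gt_eqF f2).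
  case: act act' => [[De _]|[De _]] [[De' _]|[De' _]].
  - have [a [b [h1 h2]]] := common_diagonal e1n e2n De De'.
    by exists a, b; left.
  - have [a [b [h1 h2]]] := common_diagonal e1n e2n De De'.
    by exists a, b; right.
  - have [a [b [h1 h2]]] := common_diagonal f1n f2n De De'.
    by exists a, b; right.
  - have [a [b [h1 h2]]] := common_diagonal f1n f2n De De'.
    by exists a, b; left.
have rectM (a b : R) (sigma : 'I_2 -> 'I_2) q : a != 0 -> 0 < b ->
    tile_lower e' f' (sigma q) = image_corner a b 0 (tile_lower e f q) (tile_upper e f q) ->
    tile_upper e' f' (sigma q) = image_corner a b 0 (tile_upper e f q) (tile_lower e f q) ->
    exists2 v, (L : set plane) v & forall x, rect P q x <->
      rect P' (sigma q) (diag_map a b x + (bp_shift P' - diag_map a b (bp_shift P)) + v).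
  move=> a0 b0 h1 h2; exists 0; first exact: lattice0.
  move=> x; have bx := diag_box (x - bp_shift P) a0 b0 h1 h2.
  have E : diag_map a b x + (bp_shift P' - diag_map a b (bp_shift P)) + 0 - bp_shift P' =
      diag_map a b (x - bp_shift P).
    by apply: plane_eqP; rewrite /=; ring.
  by split=> [/rectE/bx h|/rectE h]; apply/rectE; [rewrite E|apply/bx; rewrite -E].
have [a [b [[Me Mf]|[Me Mf]]]] := oriented.
- have me1 := congr1 fst Me; have me2 := congr1 snd Me.
  have mf1 := congr1 fst Mf; have mf2 := congr1 snd Mf; rewrite /= in me1 me2 mf1 mf2.
  have a0 : 0 < a by rewrite -(pmulr_lgt0 _ e1) me1.
  have b0 : 0 < b by rewrite -(pmulr_lgt0 _ e2) me2.
  have abL x : (L : set plane) (diag_map a b x) <-> (L : set plane) x.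
    by apply: (diag_basis_lattice Lef); rewrite Me Mf.
  have M : diag_map a b (e *~ i + f *~ j) = e' *~ i + f' *~ j.
    by rewrite diag_mapD !diag_mapMz Me Mf.
  have [iE jE] : i' = i /\ j' = j.
    apply: (offset_index_inj hypD e1' f1') (esym ij); first by split.
    by split; rewrite -M; [apply: valid_x_scale vx; left | apply: valid_y_scale vy => //; lra].
  have an : a != 0 by rewrite gt_eqF.
  apply: (equiv_of_affine (a := a) (b := b) (sigma := id)).
  + by apply: center => //; [rewrite iE jE -M | rewrite gt_eqF].
  + by move=> q; exists q.
  move=> q; apply: (rectM a b id q) => //; rewrite /image_corner a0 b0 /tile_lower
    /tile_upper /tile_left /tile_right /tile_height /tile_step /=;
    apply: plane_eqP => /=; clear rectM center M bd bd' vx vy vx' vy' Lt Lt' Ez Ez' abL;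
    case: (q == 0) => /=; lra.
have me1 := congr1 fst Me; have me2 := congr1 snd Me.
have mf1 := congr1 fst Mf; have mf2 := congr1 snd Mf; rewrite /= in me1 me2 mf1 mf2.
have a0 : a < 0 by rewrite -(pmulr_llt0 _ e1) me1.
have b0 : 0 < b by rewrite -(pmulr_lgt0 _ e2) me2.
have abL x : (L : set plane) (diag_map a b x) <-> (L : set plane) x.
  by apply: (diag_basis_lattice Lef); rewrite Me Mf; exact: lattice_basisC.
have M : diag_map a b (e *~ i + f *~ j) = e' *~ j + f' *~ i.
  by rewrite diag_mapD !diag_mapMz Me Mf addrC.
have [iE jE] : i' = j /\ j' = i.
  apply: (offset_index_inj hypD e1' f1'); [by split| |by rewrite -ij addrC].
  by split; rewrite -M; [apply: valid_x_scale vx; right | apply: valid_y_scale vy => //; lra].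
have an : a != 0 by rewrite lt_eqF.
apply: (equiv_of_affine (a := a) (b := b) (sigma := swap2)).
+ by apply: center => //; [rewrite iE jE -M | rewrite gt_eqF].
+ by move=> q; exists (swap2 q); rewrite swap2K.
move=> q; apply: (rectM a b swap2 q) => //; rewrite /image_corner (lt_gtF a0) b0 /tile_lower
  /tile_upper /tile_left /tile_right /tile_height /tile_step /swap2 /=;
  apply: plane_eqP => /=; clear rectM center M bd bd' vx vy vx' vy' Lt Lt' Ez Ez' abL;
    case: (q == 0) => /=; lra.
Qed.

(** The point reflection of the plane maps a bi-partition onto a bi-partition with
    the same basis and reverses the order of the possible offsets. *)
Lemma reflection_equiv_same_basis (P P' : bipartition L) N : has_action P ->
  bp_e P' = bp_e P -> bp_f P' = bp_f P ->
  berg_index P N -> berg_index P' (S%:Z - 2 - N) ->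
  berg_equiv mu lambda (pieces P) (pieces P').
Proof.
move=> act eE fE [w [i [j [bd NE]]]] [w' [i' [j' [bd' NE']]]].
have [k' [l' [m' [n' [l0 m0 SE [De Df]]]]]] := has_action_ordered act.
have [e1 e2] := bp_e_quadrant P; have [f1 f2] := bp_f_quadrant P.
have Lef := bp_basis P; have [Lw Lt Ez vx vy] := bd.
rewrite eE fE in bd'; have [Lw' Lt' Ez' vx' vy'] := bd'; rewrite eE fE in vx' vy'.
have [i1 [j1 [v1 E1 S1]]] := offset_reflection hypD e2 f2 De Df (conj vx vy).
rewrite SE in S1.
have [iE jE] : i' = i1 /\ j' = j1.
  apply: (offset_index_inj hypD e1 f1 (conj vx' vy') v1).
  by move: NE NE' S1; clear; lia.
rewrite iE jE in Ez' bd'; set e := bp_e P in e1 e2 Lef E1 Ez Ez' *.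
set f := bp_f P in f1 f2 Lef E1 Ez Ez' *.
set z := bp_shift P in Ez; set z' := bp_shift P' in Ez'.
have Le := basis_fst Lef; have Lf := basis_snd Lef.
have LDef : (L : set plane) (D (e + f) - (e + f)).
  apply: latticeB; last exact: latticeD.
  by apply: (lattice_diag hypD); exact: latticeD.
apply: (equiv_of_affine (a := -1) (b := -1) (c := z' + z + (0, e.2 + f.2)) (sigma := id)).
- split; rewrite ?oppr_eq0 ?oner_neq0//.
    move=> x; rewrite (_ : diag_map _ _ x = - x); last first.
      by apply: plane_eqP; rewrite /= mulN1r.
    by split=> /latticeN; rewrite ?opprK.
  rewrite (_ : _ - _ = w + w' + (D (e + f) - (e + f))).
    by apply: latticeD => //; exact: latticeD.
  have z1 : mu * z.1 - z.1 = w.1 + (e *~ i + f *~ j).1 := congr1 fst Ez.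
  have z2 : lambda * z.2 - z.2 = w.2 + 0 := congr1 snd Ez.
  have z1' : mu * z'.1 - z'.1 = w'.1 + (e *~ i1 + f *~ j1).1 := congr1 fst Ez'.
  have z2' : lambda * z'.2 - z'.2 = w'.2 + 0 := congr1 snd Ez'.
  rewrite E1 fst_sub in z1'.
  by apply: plane_eqP; rewrite /= in z1 z1' *; lra.
- by move=> q; exists q.
move=> q; exists (- (if q == 0 then f else e)).
  by apply: latticeN; case: ifP.
move=> x; rewrite !rectE eE fE -/e -/f -/z -/z' /box /tile_lower /tile_upper /tile_left
  /tile_right /tile_height /tile_step.
by case: (q == 0) => /=; split=> -[? ?]; split; lra.
Qed.

Lemma same_basis_classification (P P' : bipartition L) N N' : has_action P ->
  bp_e P' = bp_e P -> bp_f P' = bp_f P -> berg_index P N -> berg_index P' N' ->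
  berg_equiv mu lambda (pieces P) (pieces P') -> N' = N \/ N' = S%:Z - 2 - N.
Proof.
move=> act eE fE [w [i [j [bd NE]]]] [w' [i' [j' [bd' NE']]]] [h [hC hP]].
have [k' [l' [m' [n' [l0 m0 SE [De Df]]]]]] := has_action_ordered act.
have [a [b [c [[a0 b0 abL Lc] hE]]]] := centralizer_affine hypD hC.
have [e1 e2] := bp_e_quadrant P; have [f1 f2] := bp_f_quadrant P.
have Lef := bp_basis P; have [Lw Lt Ez vx vy] := bd.
rewrite eE fE in bd'; have [Lw' Lt' Ez' _ _] := bd'.
set e := bp_e P in e1 e2 Lef Lt Lt' Ez Ez' *.
set f := bp_f P in f1 f2 Lef Lt Lt' Ez Ez' *.
set t := e *~ i + f *~ j in Lt Ez; set t' := e *~ i' + f *~ j' in Lt' Ez'.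
set z := bp_shift P in Ez; set z' := bp_shift P' in Ez'.
pose kk := diag_map a b z + c - z'.
have z1 : mu * z.1 - z.1 = w.1 + t.1 := congr1 fst Ez.
have z2 : lambda * z.2 - z.2 = w.2 + 0 := congr1 snd Ez.
have z1' : mu * z'.1 - z'.1 = w'.1 + t'.1 := congr1 fst Ez'.
have z2' : lambda * z'.2 - z'.2 = w'.2 + 0 := congr1 snd Ez'.
have Le := basis_fst Lef; have Lf := basis_snd Lef.
have LD x : (L : set plane) x -> (L : set plane) (D x - x).
  by move=> Lx; apply: latticeB => //; exact: (lattice_diag hypD).
have [|[a1 b1 Lk]|[a1 b1 Lk]] := pieces_rigid (lattice_fst_eq0 hypD)
  (lattice_snd_eq0 hypD) Lef e1 e2 f1 f2 (k := kk) a0 b0 abL.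
- move=> q; have : pieces P' (h @` (proj L @` rect P q)).
    by rewrite -hP; exists (proj L @` rect P q) => //; exists q.
  move=> [q' _ hq]; exists q'.
  have rE y : translates L (box (tile_lower e f q') (tile_upper e f q')) y <->
      (h @` (proj L @` rect P q)) (proj L (y + z')).
    by rewrite -hq proj_rectE eE fE.
  apply/seteqP; split=> y.
    move=> [x /proj_rectE Px <-]; apply/rE; exists (proj L (x + z)) => //.
    rewrite hE; apply: (congr1 (proj L)).
    by apply: plane_eqP; rewrite /kk /=; ring.
  move=> /rE[_ [x Px <-]]; rewrite hE => /projP Lx.
  exists (diag_map a^-1 b^-1 (y - kk)); last first.
    by apply: plane_eqP; rewrite /= mulVKf// subrK.
  apply/proj_rectE; exists x => //; apply/projP; apply/abL.
  rewrite (_ : diag_map _ _ _ = diag_map a b x + c - (y + z')) //.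
  by apply: plane_eqP; rewrite /= !(mulrBr, mulrDr) !mulVKf// /kk /=; ring.
- left; have kE : kk = z + c - z' by rewrite /kk a1 b1 /diag_map !mul1r -surjective_pairing.
  have Lu : (L : set plane) (w - w' + (D c - c) - (D kk - kk)).
    by apply: latticeB; [apply: latticeD => //; exact: latticeB|exact: LD].
  have u0 : w - w' + (D c - c) - (D kk - kk) = 0.
    by apply: (lattice_snd_eq0 hypD Lu); rewrite kE /=; lra.
  have E : t' = t.
    apply: (lattice_eq_fst hypD) => //; clearbody t t'.
    by move: (congr1 fst u0); rewrite kE /=; lra.
  have [iE jE] := basis_coords_inj Lef E.
  by rewrite NE' NE iE jE.
right; pose k2 := kk - (0, e.2 + f.2).
have kE : kk = - z + c - z'.
  by rewrite /kk a1 b1 /diag_map !mulN1r.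
have Lu : (L : set plane) (w + w' - (D c - c) + (D k2 - k2) + (D (e + f) - (e + f))).
  apply: latticeD; last by apply: LD; exact: latticeD.
  by apply: latticeD; [apply: latticeB => //; exact: latticeD|exact: LD].
have u0 : w + w' - (D c - c) + (D k2 - k2) + (D (e + f) - (e + f)) = 0.
  by apply: (lattice_snd_eq0 hypD Lu); rewrite /k2 kE /=; lra.
have [i1 [j1 [v1 E1 S1]]] := offset_reflection hypD e2 f2 De Df (conj vx vy).
rewrite SE in S1.
have E : t' = e *~ i1 + f *~ j1.
  apply: (lattice_eq_fst hypD) => //; first by apply/(lattice_coords Lef); exists i1, j1.
  rewrite E1 -/e -/f -/t; clearbody t t'.
  by move: (congr1 fst u0); rewrite /k2 kE /=; lra.
have [iE jE] := basis_coords_inj Lef E.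
by rewrite NE' NE -S1 iE jE.
Qed.

(** Composite of the point reflection and a change of basis. *)
Lemma reflection_equiv (P P' : bipartition L) N : has_action P -> has_action P' ->
  berg_index P N -> berg_index P' (S%:Z - 2 - N) ->
  berg_equiv mu lambda (pieces P) (pieces P').
Proof.
move=> act act' iP iP'; have hN := berg_index_range act' iP'.
have [P0 [eE fE _ iP0]] :=
  berg_index_realized (bp_basis P) (bp_e_quadrant P) (bp_f_quadrant P) act hN.
have act0 : has_action P0 by rewrite /has_action eE fE.
apply: berg_equiv_trans (reflection_equiv_same_basis act eE fE iP iP0) _.
exact: same_index_equiv act0 act' iP0 iP'.
Qed.

Lemma equiv_classification (P P' : bipartition L) N N' : has_action P -> has_action P' ->
  berg_index P N -> berg_index P' N' ->
  berg_equiv mu lambda (pieces P) (pieces P') <-> N' = N \/ N' = S%:Z - 2 - N.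
Proof.
move=> act act' iP iP'; split=> [eqv|[E|E]]; last first.
- by rewrite E in iP'; exact: reflection_equiv act act' iP iP'.
- by rewrite E in iP'; exact: same_index_equiv act act' iP iP'.
have hN := berg_index_range act iP.
have [P0 [eE fE _ iP0]] :=
  berg_index_realized (bp_basis P') (bp_e_quadrant P') (bp_f_quadrant P') act' hN.
have act0 : has_action P0 by rewrite /has_action eE fE.
apply: (same_basis_classification act0 (esym eE) (esym fE) iP0 iP').
exact: berg_equiv_trans (same_index_equiv act0 act iP0 iP) eqv.
Qed.

End OffsetIndex.

(** * Bases adapted to a nonnegative matrix and the count *)

Section MatrixBasis.
Variables (R : realType) (L : lattice R) (mu lambda : R) (k l m n : nat).
Local Notation plane := (R * R)%type.
Local Notation D := (diag_map mu lambda).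
Hypothesis hypD : hyperbolic_automorphism L mu lambda.

(** Perron-Frobenius for a nonnegative matrix of size two: the eigenvalue of largest
    modulus is positive with eigenvector (p, q) in a quadrant of equal signs, and the
    other eigenvector (v, w) has coordinates of opposite signs. *)
Lemma perron_frobenius2 (La Mu p q v w K L' M N : R) :
  0 <= K -> 0 <= L' -> 0 <= M -> 0 <= N -> `|Mu| < `|La| ->
  p != 0 -> q != 0 -> v != 0 -> w != 0 ->
  La * p = p * K + q * L' -> La * q = p * M + q * N ->
  Mu * v = v * K + w * L' -> Mu * w = v * M + w * N ->
  [/\ 0 < L', 0 < M, 0 < La, 0 < p * q & v * w < 0].
Proof.
move=> K0 L0 M0 N0 ML p0 q0 v0 w0 E1 E2 E3 E4.
have LM : La != Mu by apply: contraTneq ML => ->; rewrite ltxx.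
have Lp : 0 < L'.
  rewrite lt_neqAle L0 andbT eq_sym; apply/eqP => L'0; move/eqP: LM; apply.
  have -> : La = K by apply: (mulIf p0); rewrite E1 L'0; ring.
  by apply/esym; apply: (mulIf v0); rewrite E3 L'0; ring.
have Mp : 0 < M.
  rewrite lt_neqAle M0 andbT eq_sym; apply/eqP => M'0; move/eqP: LM; apply.
  have -> : La = N by apply: (mulIf q0); rewrite E2 M'0; ring.
  by apply/esym; apply: (mulIf w0); rewrite E4 M'0; ring.
have C1 : (La - K) * (La - N) = L' * M.
  apply: (mulIf (mulf_neq0 p0 q0)).
  have -> : (La - K) * (La - N) * (p * q) = (La * p - p * K) * (La * q - q * N) by ring.
  by rewrite E1 E2; ring.
have C2 : (Mu - K) * (Mu - N) = L' * M.
  apply: (mulIf (mulf_neq0 v0 w0)).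
  have -> : (Mu - K) * (Mu - N) * (v * w) = (Mu * v - v * K) * (Mu * w - w * N) by ring.
  by rewrite E3 E4; ring.
have tr : La + Mu = K + N.
  apply: (mulfI (x := La - Mu)); first by rewrite subr_eq0.
  by lra.
have La0 : 0 < La.
  rewrite ltNge; apply/negP => h; move: ML; rewrite (ler0_norm h) ltNge => /negP; apply.
  by apply: le_trans (ler_norm _); lra.
have LaMu : Mu < La.
  by apply: le_lt_trans (ler_norm _) _; rewrite (gtr0_norm La0) in ML.
have LM0 : 0 < L' * M by exact: mulr_gt0.
have LaK : 0 < La - K by rewrite ltNge; apply/negP => h; nra.
have MuK : Mu - K < 0 by rewrite ltNge; apply/negP => h; nra.
split=> //.
- rewrite -(pmulr_rgt0 _ Lp).
  have -> : L' * (p * q) = (La - K) * p ^+ 2.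
    have -> : L' * (p * q) = p * (p * K + q * L' - p * K) by ring.
    by rewrite -E1; ring.
  by rewrite mulr_gt0// exprn_even_gt0.
- rewrite -(pmulr_rlt0 _ Lp).
  have -> : L' * (v * w) = (Mu - K) * v ^+ 2.
    have -> : L' * (v * w) = v * (v * K + w * L' - v * K) by ring.
    by rewrite -E3; ring.
  by rewrite pmulr_llt0// exprn_even_gt0.
Qed.

Lemma basis_neq0 e f : lattice_basis L e f -> e != 0 /\ f != 0.
Proof.
move=> /basis_cross cr; split; apply: contra_neq cr => -> /=; ring.
Qed.

Lemma opp_basis e f : lattice_basis L e f -> lattice_basis L (- e) (- f).
Proof.
move=> [ind E]; split=> [a b|].
  rewrite !scalerN -opprD => /eqP; rewrite oppr_eq0 => /eqP; exact: ind.
rewrite E; apply/seteqP; split=> x [i [j ->]]; exists (- i), (- j);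
  by rewrite ?mulNrz ?mulrNz ?opprK.
Qed.

Lemma acts_by_opp e f : acts_by mu lambda e f k l m n ->
  acts_by mu lambda (- e) (- f) k l m n.
Proof.
have DN x : D (- x) = - D x by apply: plane_eqP; rewrite /= mulrN.
by move=> [h1 h2]; split; rewrite DN ?h1 ?h2 !mulNrz -opprD mulNrz.
Qed.

(** By perron_frobenius2 the two vectors of the given basis lie on the same side of the
    horizontal axis and on opposite sides of the vertical one, so that a change of sign
    and of order brings them into the first and second quadrant. *)
Lemma quadrant_basis :
  (exists e f : plane, lattice_basis L e f /\
     (represented_by mu lambda e f (mx22 k%:Z l%:Z m%:Z n%:Z)^T \/
      represented_by mu lambda e f (- (mx22 k%:Z l%:Z m%:Z n%:Z)^T))) ->
  [/\ (0 < l)%N, (0 < m)%N & exists e f : plane,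
    [/\ lattice_basis L e f, 0 < e.1 /\ 0 < e.2, f.1 < 0 /\ 0 < f.2 &
      acts_by mu lambda e f k l m n \/ acts_by mu lambda f e k l m n]].
Proof.
move=> [e [f [Lef rep]]].
have [e0 f0] := basis_neq0 Lef.
have Le := basis_fst Lef; have Lf := basis_snd Lef.
have e1n : e.1 != 0 by apply: contra_neq e0; exact: (lattice_fst_eq0 hypD).
have f1n : f.1 != 0 by apply: contra_neq f0; exact: (lattice_fst_eq0 hypD).
have e2n : e.2 != 0 by apply: contra_neq e0; exact: (lattice_snd_eq0 hypD).
have f2n : f.2 != 0 by apply: contra_neq f0; exact: (lattice_snd_eq0 hypD).
have [s [s1 De Df]] : exists s : int, [/\ s = 1 \/ s = -1,
    D e = (e *~ k + f *~ l) *~ s & D f = (e *~ m + f *~ n) *~ s].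
  case: rep => -[]; rewrite !mxE /= => -> ->.
    by exists 1; rewrite !mulr1z; split=> //; left.
  by exists (-1); rewrite !mulrN1z !mulrNz !opprD; split=> //; right.
have la0 := lambda_neq0 hypD.
have G1 := congr1 fst De; have G2 := congr1 snd De.
have H1 := congr1 fst Df; have H2 := congr1 snd Df.
rewrite fst_mulrz fst_comb /= in G1; rewrite snd_mulrz snd_comb /= in G2.
rewrite fst_mulrz fst_comb /= in H1; rewrite snd_mulrz snd_comb /= in H2.
have ss : s%:~R * s%:~R = 1 :> R.
  by case: s1 => ->; rewrite ?mulrNz mulr1z ?mulrNN mulr1.
have sn (x : R) : `|s%:~R * x| = `|x|.
  by rewrite normrM; case: s1 => ->; rewrite ?mulrNz mulr1z ?normrN normr1 mul1r.
have nz (a : nat) : 0 <= a%:~R :> R by rewrite ler0z.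
have key (t x y z : R) : t * x = (y + z) * s%:~R -> s%:~R * t * x = y + z.
  by move=> E; rewrite -mulrA E mulrC -mulrA ss mulr1.
have ml : `|s%:~R * mu| < `|s%:~R * lambda|.
  rewrite !sn; case: hypD => _ h1 _; exact: lt_trans (norm_mu_lt1 hypD) h1.
have [l0 m0 La0 pq vw] := perron_frobenius2 (nz k) (nz l) (nz m) (nz n) ml
  e2n f2n e1n f1n (key _ _ _ _ G2) (key _ _ _ _ H2) (key _ _ _ _ G1) (key _ _ _ _ H1).
have sE : s = sgz lambda.
  case: s1 La0 => ->; rewrite ?mulrNz mulr1z ?mulN1r ?mul1r ?oppr_gt0 => h.
    by rewrite gtr0_sgz.
  by rewrite ltr0_sgz.
have act : acts_by mu lambda e f k l m n by rewrite /acts_by -sE.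
rewrite !ltr0z in l0 m0; split=> //.
have [e' [f' [Lef' act' [e2 f2] vw']]] : exists e' f', [/\ lattice_basis L e' f',
    acts_by mu lambda e' f' k l m n, 0 < e'.2 /\ 0 < f'.2 & e'.1 * f'.1 < 0].
  have [p0|p0] := ltP 0 e.2.
    by exists e, f; split=> //; split=> //; rewrite -(pmulr_rgt0 _ p0).
  have {}p0 : e.2 < 0 by rewrite lt_neqAle e2n.
  exists (- e), (- f); split; [exact: opp_basis|exact: acts_by_opp| |].
    by rewrite /= !oppr_gt0; split=> //; rewrite -(nmulr_rgt0 _ p0).
  by rewrite /= mulrNN.
have [v0|v0] := ltP 0 e'.1.
  exists e', f'; split=> //; last by left.
  by rewrite -(pmulr_rlt0 _ v0).
have {}v0 : e'.1 < 0.
  by rewrite lt_neqAle v0 andbT; apply: contraTneq vw' => ->; rewrite mul0r ltxx.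
exists f', e'; split; [exact: lattice_basisC| | |by right].
  by split=> //; rewrite -(nmulr_rlt0 _ v0).
by split.
Qed.

End MatrixBasis.

Theorem theorem5p2 (R : realType) (L : lattice R) (mu lambda : R)
    (k l m n : nat) :
  hyperbolic_automorphism L mu lambda ->
  mx22 (Posz k) (Posz l) (Posz m) (Posz n) \in unitmx ->
  (exists e f : R * R, lattice_basis L e f /\
     (represented_by mu lambda e f
        (mx22 (Posz k) (Posz l) (Posz m) (Posz n))^T \/
      represented_by mu lambda e f
        (- (mx22 (Posz k) (Posz l) (Posz m) (Posz n))^T))) ->
  berg_classes L mu lambda (mx22 k l m n) #= `I_((k + l + m + n) %/ 2)%N.
Proof.
move=> hypD _ /(quadrant_basis hypD)[l0 m0 [e [f [Lef He Hf act]]]].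
set S := (k + l + m + n)%N; set C := mx22 k l m n.
have S2 : (1 < S)%N by rewrite /S; clear -l0 m0; lia.
pose good (P : bipartition L) (N : nat) := [/\ is_berg mu lambda P,
  exists s, connectivity_matrix mu lambda P s C & berg_index mu lambda k l m n P N%:Z].
have conn P := connectivityP hypD (P := P) k l m n.
have good_ex N : (N <= S - 2)%N -> exists P : bipartition L, good P N.
  move=> hN; have hN' : 0 <= N%:Z <= S%:Z - 2 by move: hN S2; clear; lia.
  have [P [eE fE bP iP]] := berg_index_realized hypD l0 m0 Lef He Hf act hN'.
  by exists P; split=> //; apply/(conn _ bP); rewrite eE fE.
(* Only the values of F below S / 2 matter. *)
have /choice[F HF] : forall N : nat, exists P : bipartition L,
    (N < S %/ 2)%N -> good P N.
  move=> N; have [hN|hN] := ltnP N (S %/ 2).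
    by have [|P HP] := good_ex N; [move: hN; clear; lia|exists P].
  by have [|P _] := good_ex 0%N; [|exists P].
pose cls A := [set B | berg_partitions L mu lambda C B /\ berg_equiv mu lambda A B].
have memF N : (N < S %/ 2)%N -> berg_partitions L mu lambda C (pieces (F N)).
  by move=> hN; have [bP cP _] := HF N hN; exists (F N).
have classif P P' N N' : good P N -> good P' N' ->
    berg_equiv mu lambda (pieces P) (pieces P') <-> N' = N \/ (N' + N = S - 2)%N.
  move=> [bP cP iP] [bP' cP' iP'].
  have aP := (conn _ bP).1 cP; have aP' := (conn _ bP').1 cP'.
  rewrite (equiv_classification hypD l0 m0 aP aP' iP iP') -/S.
  by move: S2; clear; split=> -[?|?]; [left|right|left|right]; lia.
have equiv_refl N : (N < S %/ 2)%N ->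
    berg_equiv mu lambda (pieces (F N)) (pieces (F N)).
  by move=> hN; apply/(classif _ _ _ _ (HF N hN) (HF N hN)); left.
rewrite (_ : berg_classes L mu lambda C =
    (fun N => cls (pieces (F N))) @` `I_(S %/ 2)); last first.
  apply/seteqP; split=> X; last first.
    by move=> [N hN <-]; exists (pieces (F N)) => //; exact: memF.
  move=> [_ [P [bP cP] <-] <-].
  have [N iN] := berg_index_ex hypD k l m n bP.
  have aP := (conn _ bP).1 cP.
  have hN := berg_index_range hypD l0 m0 aP iN.
  have [N' N'E] : exists N' : nat, N = N'%:Z.
    by exists `|N|%N; move: hN; clear; lia.
  rewrite -/S in hN; rewrite {N}N'E in iN hN.
  have gP : good P N' by [].
  (* The smaller of the two indices that belong to the class. *)
  pose N0 := minn N' (S - 2 - N'); have hN0 : (N0 < S %/ 2)%N.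
    by rewrite /N0; move: hN S2; clear; lia.
  exists N0 => //; have eqv : berg_equiv mu lambda (pieces (F N0)) (pieces P).
    apply/(classif _ _ _ _ (HF N0 hN0) gP); rewrite /N0; move: hN S2; clear.
    by have [h|h] := leqP N' (S - 2 - N'); [left|right]; lia.
  apply/seteqP; split=> B [BB eB]; split=> //.
    exact: berg_equiv_trans (berg_equiv_sym eqv) eB.
  exact: berg_equiv_trans eqv eB.
apply: inj_card_eq => N N'; rewrite !inE => hN hN' E.
have : cls (pieces (F N)) (pieces (F N')).
  by rewrite E; split; [exact: memF|exact: equiv_refl].
move=> [_ /(classif _ _ _ _ (HF N hN) (HF N' hN'))].
by move: hN hN'; rewrite /= ; clear; move=> ? ? [?|?]; lia.
Qed.
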